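(* Let $p,p'$ be fixed, let $n'=n'(n)\to\infty$ as $n\to\infty$, and let $(\mathbf z'_i)_{i\ge1}$ be a deterministic sequence in $\mathcal Z$. Assume that Assumptions (A1)-(A4) and (B) of the context are satisfied, that $\frac1{n'}\sum_{i=1}^{n'}\boldsymbol\psi(\mathbf z'_i)\boldsymbol\psi(\mathbf z'_i)^T$ converges to a matrix $M_{\psi,\mathbf z'}$ as $n'\to\infty$, that $h=h_{n,n'}\to0$, $\lambda_{n,n'}\to\lambda_0$, and that $n'\exp(-Anh^{2p})\to0$ for every $A>0$, when $(n,n')\to\infty$. Then $$\hat\beta_{n,n'}\ \longrightarrow\ \arg\min_{\beta\in\mathbb R^{p'}}\mathbb G_{\infty,\infty}(\beta)\quad\text{in probability as }(n,n')\to\infty,$$ where $\mathbb G_{\infty,\infty}(\beta):=(\beta^*-\beta)^TM_{\psi,\mathbf z'}(\beta^*-\beta)+\lambda_0|\beta|_1$. Moreover, if $\lambda_0=0$ and $M_{\psi,\mathbf z'}$ is invertible, then $\hat\beta_{n,n'}$ is consistent and tends to the true value $\beta^*$.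
   Context: Setting. $(\mathbf X,\mathbf Z)$ with $\mathbf X=(X_1,X_2)\in\mathbb R^2$ and $\mathbf Z\in\mathbb R^p$ is a random vector with joint density $f_{\mathbf X,\mathbf Z}$; $f_{\mathbf Z}$ is the density of $\mathbf Z$. $\mathcal Z\subset\mathbb R^p$ is a compact set. $(\mathbf X_i,\mathbf Z_i)$, $i=1,\dots,n$, $\mathbf X_i=(X_{i,1},X_{i,2})$, are i.i.d. copies of $(\mathbf X,\mathbf Z)$. $g^*$ is one of $g_1(\mathbf x_1,\mathbf x_2)=4\cdot\mathbf 1\{x_{1,1}<x_{2,1},x_{1,2}<x_{2,2}\}-1$; $g_2(\mathbf x_1,\mathbf x_2)=\mathbf 1\{(x_{1,1}-x_{2,1})(x_{1,2}-x_{2,2})>0\}-\mathbf 1\{(x_{1,1}-x_{2,1})(x_{1,2}-x_{2,2})<0\}$; $g_3(\mathbf x_1,\mathbf x_2)=1-4\cdot\mathbf 1\{x_{1,1}<x_{2,1},x_{1,2}>x_{2,2}\}$. The conditional Kendall's tau is $\tau_{1,2|\mathbf Z=\mathbf z}=\mathbb P((X_{1,1}-X_{2,1})(X_{1,2}-X_{2,2})>0\mid\mathbf Z_1=\mathbf Z_2=\mathbf z)-\mathbb P((X_{1,1}-X_{2,1})(X_{1,2}-X_{2,2})<0\mid\mathbf Z_1=\mathbf Z_2=\mathbf z)=\mathbb E[g^*(\mathbf X_1,\mathbf X_2)\mid\mathbf Z_1=\mathbf Z_2=\mathbf z]$. Its kernel estimator is $\hat\tau_{1,2|\mathbf Z=\mathbf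 z}=\sum_{i,j=1}^nw_{i,n}(\mathbf z)w_{j,n}(\mathbf z)g^*(\mathbf X_i,\mathbf X_j)$, $w_{i,n}(\mathbf z)=K_h(\mathbf Z_i-\mathbf z)/\sum_{j=1}^nK_h(\mathbf Z_j-\mathbf z)$, where $K:\mathbb R^p\to\mathbb R$ is a kernel, $h=h_{n,n'}>0$ the bandwidth, $K_h(\mathbf u)=h^{-p}K(\mathbf u/h)$. Model. $\Lambda:[-1,1]\to\mathbb R$ is a known increasing continuously differentiable function, $\boldsymbol\psi=(\psi_1,\dots,\psi_{p'})^T:\mathbb R^p\to\mathbb R^{p'}$ is known, and for an unknown $\beta^*\in\mathbb R^{p'}$, $\Lambda(\tau_{1,2|\mathbf Z=\mathbf z})=\boldsymbol\psi(\mathbf z)^T\beta^*$ for all $\mathbf z\in\mathcal Z$. Estimator. $\hat\beta_{n,n'}:=\arg\min_{\beta\in\mathbb R^{p'}}\big[\frac1{n'}\sum_{i=1}^{n'}(\Lambda(\hat\tau_{1,2|\mathbf Z=\mathbf z'_i})-\boldsymbol\psi(\mathbf z'_i)^T\beta)^2+\lambda_{n,n'}|\beta|_1\big]$ with $\lambda_{n,n'}\ge0$. The notation $\arg\min$ for the limiting criterion denotes its unique minimizer (uniqueness is presupposed by the notation). $|\cdot|_1$ is the $l_1$ norm. (A1) $K$ is bounded, symmetrical, $\int K=1$, $\int|K|<\infty$, and of order $\alpha$ for some integer $\alpha>1$: for all $j=1,\dots,\alpha-1$ and all indices $i_1,\dots,i_j\in\{1,\dots,p\}$, $\int_{\mathbb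 R^p}K(\mathbf u)u_{i_1}\cdots u_{i_j}d\mathbf u=0$. (A2) $f_{\mathbf Z}$ is $\alpha$-times continuously differentiable and there is $C_{K,\alpha}>0$ such that for all $\mathbf z\in\mathcal Z$, $\int|K|(\mathbf u)\sum_{i_1,\dots,i_\alpha=1}^p|u_{i_1}\cdots u_{i_\alpha}|\sup_{t\in[0,1]}\big|\frac{\partial^\alpha f_{\mathbf Z}}{\partial z_{i_1}\cdots\partial z_{i_\alpha}}(\mathbf z+t\mathbf u)\big|d\mathbf u\le C_{K,\alpha}$. (A3) There are positive constants $f_{\mathbf Z,\min},f_{\mathbf Z,\max}$ with $f_{\mathbf Z,\min}\le f_{\mathbf Z}(\mathbf z)\le f_{\mathbf Z,\max}$ for every $\mathbf z\in\mathcal Z$. (A4) For every $\mathbf x\in\mathbb R^2$, $\mathbf z\mapsto f_{\mathbf X,\mathbf Z}(\mathbf x,\mathbf z)$ is differentiable almost everywhere up to order $\alpha$, $\mathbf z\in\mathcal Z$. For $0\le k\le\alpha$ and $\vec\iota=(i_1,\dots,i_\alpha)\in\{1,\dots,p\}^\alpha$ let $\mathcal H_{k,\vec\iota}(\mathbf u,\mathbf v,\mathbf x_1,\mathbf x_2,\mathbf z):=\sup_{t\in[0,1]}\big|\frac{\partial^kf_{\mathbf X,\mathbf Z}}{\partial z_{i_1}\cdots\partial z_{i_k}}(\mathbf x_1,\mathbf z+t\mathbf u)\,\frac{\partial^{\alpha-k}f_{\mathbf X,\mathbf Z}}{\partial z_{i_{k+1}}\cdots\partial z_{i_\alpha}}(\mathbf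 x_2,\mathbf z+t\mathbf v)\big|$. These are integrable and there is a finite constant $C_{\mathbf X\mathbf Z,\alpha}>0$ such that for every $\mathbf z\in\mathcal Z$, $\int|K|(\mathbf u)|K|(\mathbf v)\sum_{k=0}^\alpha\binom\alpha k\sum_{i_1,\dots,i_\alpha=1}^p\mathcal H_{k,\vec\iota}(\mathbf u,\mathbf v,\mathbf x_1,\mathbf x_2,\mathbf z)|u_{i_1}\cdots u_{i_k}v_{i_{k+1}}\cdots v_{i_\alpha}|\,d\mathbf u\,d\mathbf v\,d\mathbf x_1\,d\mathbf x_2\le C_{\mathbf X\mathbf Z,\alpha}$. (B) The functions $\psi_1,\dots,\psi_{p'}$ are bounded in absolute value on $\mathcal Z$ by a constant $C_\psi$. $\Lambda$ is continuously differentiable, and with $\mathcal T$ the range of $\mathbf z\mapsto\tau_{1,2|\mathbf Z=\mathbf z}$ from $\mathcal Z$ to $[-1,1]$, on an open neighborhood of $\mathcal T$ the derivative of $\Lambda$ is bounded (in absolute value) by a constant $C_{\Lambda'}$. *)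

(* Defs.v *)
From HB Require Import structures.
From mathcomp Require Import all_boot all_order all_algebra.
From mathcomp Require Import finmap.
From mathcomp Require Import all_classical all_reals all_analysis.

Set Implicit Arguments.
Unset Strict Implicit.
Unset Printing Implicit Defensive.

Import Order.TTheory GRing.Theory Num.Theory.
Import numFieldNormedType.Exports.

Local Open Scope classical_set_scope.
Local Open Scope ring_scope.

Section matrix_measurable.
Context {d : measure_display} {T : measurableType d} (m n : nat).

Definition mx_measurable : set (set 'M[T]_(m, n)) :=
  <<s \bigcup_(ij in [set: 'I_m * 'I_n])
        preimage_set_system setT (fun M : 'M[T]_(m, n) => M ij.1 ij.2)
          measurable >>.

Let mx_measurable0 : mx_measurable set0.
Proof. exact: sigma_algebra0. Qed.

Let mx_measurableC A : mx_measurable A -> mx_measurable (~` A).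
Proof. exact: sigma_algebraC. Qed.

Let mx_measurable_bigcup (F : (set 'M[T]_(m, n))^nat) :
  (forall i, mx_measurable (F i)) -> mx_measurable (\bigcup_i F i).
Proof. exact: sigma_algebra_bigcup. Qed.

(* On 'M[R]_(m, n) with R : realType this is the Borel sigma-algebra. *)
HB.instance Definition _ := @isMeasurable.Build d 'M[T]_(m, n)
  mx_measurable mx_measurable0 mx_measurableC mx_measurable_bigcup.

Lemma measurable_mx_entry (i : 'I_m) (j : 'I_n) :
  measurable_fun [set: 'M[T]_(m, n)] (fun M : 'M[T]_(m, n) => M i j).
Proof.
move=> _ B mB; rewrite setTI; apply: sub_sigma_algebra.
by exists (i, j) => //=; exists B => //; rewrite setTI.
Qed.

Lemma measurable_mxP d' (T' : measurableType d') (f : T' -> 'M[T]_(m, n)) :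
  (forall i j, measurable_fun [set: T'] (fun x => f x i j)) ->
  measurable_fun [set: T'] f.
Proof.
move=> mf; apply: (@measurability _ _ _ _ _ _
  (\bigcup_(ij in [set: 'I_m * 'I_n])
        preimage_set_system setT (fun M : 'M[T]_(m, n) => M ij.1 ij.2)
          measurable)) => //.
move=> _ [_ [ij _ [B mB <-]] <-].
rewrite !setTI; have := mf ij.1 ij.2 measurableT B mB.
by rewrite setTI.
Qed.

End matrix_measurable.

Section lebesgue_rV.
Context {R : realType}.
Local Open Scope ereal_scope.

Definition cons_rV n (xv : measurableTypeR R * 'rV[R]_n) : 'rV[R]_n.+1 :=
  row_mx (xv.1 : R)%:M xv.2 : 'rV[R]_(1 + n).

Definition uncons_rV n (v : 'rV[R]_n.+1) :
    measurableTypeR R * 'rV[R]_n :=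
  (v ord0 ord0, rsubmx (v : 'rV[R]_(1 + n))).

Lemma cons_rVK n : cancel (@cons_rV n) (@uncons_rV n).
Proof.
move=> [x v]; rewrite /uncons_rV /cons_rV /= row_mxKr; congr (_, _).
by rewrite mxE; case: splitP => // j _; rewrite (ord1 j) mxE.
Qed.

Lemma measurable_cons_rV n : measurable_fun setT (@cons_rV n).
Proof.
apply: measurable_mxP => i j; rewrite /cons_rV.
have [k jk|k jk] := splitP (j : 'I_(1 + n)).
  rewrite (_ : (fun _ => _) = fst)//; apply/funext => -[x v] /=.
  rewrite mxE; case: splitP => [l jl|l]; last by rewrite jk (ord1 k).
  by rewrite (ord1 i) (ord1 l) mxE.
rewrite (_ : (fun _ => _) = (fun v : 'rV[R]_n => v i k) \o snd).
  by apply: measurableT_comp => //; exact: measurable_mx_entry.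
apply/funext => -[x v] /=.
rewrite mxE; case: splitP => [l jl|l jl]; first by move: jk; rewrite jl (ord1 l).
by congr (v _ _); apply/val_inj/eqP; rewrite -(eqn_add2l 1) -jl -jk.
Qed.

Lemma measurable_uncons_rV n : measurable_fun setT (@uncons_rV n).
Proof.
apply/measurable_fun_pairP; split.
  exact: (@measurable_mx_entry _ R 1 n.+1 ord0 ord0).
apply: measurable_mxP => i j /=.
rewrite (_ : (fun _ => _) = (fun v : 'rV[R]_n.+1 => v i (rshift 1 j)))//.
  exact: (@measurable_mx_entry _ R 1 n.+1 i (rshift 1 j)).
by apply/funext => v; rewrite mxE.
Qed.

Section cons_measure.
Context n (mu : {sigma_finite_measure set 'rV[R]_n -> \bar R}).

Let nu := pushforward (@lebesgue_measure R \x mu) (@cons_rV n).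

Let nu0 : nu set0 = 0.
Proof. by rewrite /nu /pushforward preimage_set0 measure0. Qed.

Let nu_ge0 A : 0 <= nu A.
Proof. by rewrite /nu /pushforward; exact: measure_ge0. Qed.

Let measurable_preimage A :
  measurable A -> measurable (@cons_rV n @^-1` A).
Proof. by move=> mA; rewrite -[X in measurable X]setTI; exact: measurable_cons_rV. Qed.

Let nu_sigma_additive : semi_sigma_additive nu.
Proof.
move=> F mF tF mUF; rewrite /nu /pushforward preimage_bigcup.
apply: measure_semi_sigma_additive.
- by move=> k; exact: measurable_preimage.
- apply/trivIsetP => /= i j _ _ ij; rewrite -preimage_setI.
  by move/trivIsetP : tF => /(_ _ _ _ _ ij) ->//; rewrite preimage_set0.
- by rewrite -preimage_bigcup; exact: measurable_preimage.
Qed.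

HB.instance Definition _ := isMeasure.Build _ _ _ nu nu0 nu_ge0 nu_sigma_additive.

Let nu_sigma_finite : sigma_finite setT nu.
Proof.
have /sigma_finiteP[F [TF ndF Foo]] := sigma_finiteT (@lebesgue_measure R).
have /sigma_finiteP[G [TG ndG Goo]] := sigma_finiteT mu.
have TFG : [set: measurableTypeR R * 'rV[R]_n] = \bigcup_k (F k `*` G k).
  apply/seteqP; split=> // -[x y] _.
  have [i _ Fix] : (\bigcup_k F k) x by rewrite -TF.
  have [j _ Gjy] : (\bigcup_k G k) y by rewrite -TG.
  exists (maxn i j) => //; split => /=.
  - by move: x Fix; exact/subsetPset/ndF/leq_maxl.
  - by move: y Gjy; exact/subsetPset/ndG/leq_maxr.
exists (fun k => @uncons_rV n @^-1` (F k `*` G k)).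
  by rewrite -preimage_bigcup -TFG.
move=> k; have [mF Fk] := Foo k; have [mG Gk] := Goo k; split.
  rewrite -[X in measurable X]setTI; apply: measurable_uncons_rV => //.
  exact: measurableX.
rewrite /nu /pushforward -comp_preimage (_ : _ \o _ = id); last first.
  by apply/funext => x /=; rewrite cons_rVK.
by rewrite preimage_id product_measure1E// lte_mul_pinfty// ge0_fin_numE.
Qed.

HB.instance Definition _ := Measure_isSigmaFinite.Build _ _ _ nu nu_sigma_finite.

Definition cons_measure : {sigma_finite_measure set 'rV[R]_n.+1 -> \bar R} := nu.

End cons_measure.

(* Lebesgue measure on R^n, as the n-fold product of the one on R. *)
Fixpoint lebesgue_rV n : {sigma_finite_measure set 'rV[R]_n -> \bar R} :=
  if n is n'.+1 then cons_measure (lebesgue_rV n')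
  else \d_(0%R : 'rV[R]_0).

Lemma lebesgue_rV_box n (A : 'I_n -> set R) : (forall i, measurable (A i)) ->
  lebesgue_rV n [set v : 'rV[R]_n | forall i, A i (v ord0 i)] =
  \prod_(i < n) lebesgue_measure (A i).
Proof.
elim: n A => [|n IHn] A mA.
  by rewrite big_ord0 /= diracE mem_set// => -[].
rewrite big_ord_recl -(IHn (fun i => A (lift ord0 i)))//.
have mbox : measurable
    [set v : 'rV[R]_n | forall i, A (lift ord0 i) (v ord0 i)].
  rewrite (_ : [set _ | _] = \bigcap_(i in [set: 'I_n])
    ((fun v : 'rV[R]_n => v ord0 i) @^-1` A (lift ord0 i))).
    apply: fin_bigcap_measurable => // i _.
    by rewrite -[X in measurable X]setTI; exact: measurable_mx_entry.
  by apply/seteqP; split => v /= Av i //=; exact: Av.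
rewrite -product_measure1E//; last exact: (mA ord0).
congr ((lebesgue_measure \x lebesgue_rV n) _).
have E0 x (v : 'rV[R]_n) : cons_rV (x, v) ord0 ord0 = x.
  by rewrite -[LHS]/(uncons_rV _).1 cons_rVK.
have ES x (v : 'rV[R]_n) i : cons_rV (x, v) ord0 (lift ord0 i) = v ord0 i.
  have /(congr1 (fun xw : measurableTypeR R * 'rV[R]_n => xw.2 ord0 i)) := cons_rVK (x, v).
  rewrite /= mxE => <-; congr (row_mx _ _ _ _); exact/val_inj.
apply/seteqP; split => -[x v] /= => [Av|[Ax Av] i].
  by split => [|i]; [have := Av ord0; rewrite E0|rewrite -(ES x); exact: Av].
by have [j ->|->] := fintype.unliftP ord0 i; rewrite ?E0 ?ES.
Qed.

End lebesgue_rV.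

Section probability_notions.
Context {d : measure_display} {Omega : measurableType d} {R : realType}.
Variable P : probability Omega R.

Definition mutually_independent {d' : measure_display}
    {T : measurableType d'} (Y : nat -> Omega -> T) : Prop :=
  forall (J : {fset nat}) (A : nat -> set T), (forall i, measurable (A i)) ->
    (P (\bigcap_(i in [set` J]) (Y i @^-1` A i)) =
     \prod_(i <- J) P (Y i @^-1` A i))%E.

Definition has_density {d' : measure_display} {T : measurableType d'}
    (mu : set T -> \bar R) (Y : Omega -> T) (f : T -> R) : Prop :=
  [/\ measurable_fun setT f, forall y, 0 <= f y &
    forall A, measurable A -> P (Y @^-1` A) = (\int[mu]_(y in A) (f y)%:E)%E].

Definition cvg_in_probability {V : normedModType R}
    (Y : nat -> Omega -> V) (l : V) : Prop :=
  forall eps : R, 0 < eps ->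
    P [set w | eps <= `|Y n w - l|] @[n --> \oo] --> 0%E.

End probability_notions.

Section calculus.
Context {R : realType} {p : nat}.
Implicit Types (f : 'rV[R]_p -> R) (s : seq 'I_p) (k : nat).

(* partials [:: i_1; ...; i_k] f is d^k f / dz_{i_1} ... dz_{i_k}; like 'D_v
   itself it is only meaningful where the derivatives involved exist. *)
Definition partials s f : 'rV[R]_p -> R :=
  foldr (fun i g z => 'D_(delta_mx 0 i) g z) f s.

(* k-fold Frechet differentiability at the point z *)
Fixpoint times_differentiable k f (z : 'rV[R]_p) : Prop :=
  if k is k'.+1 then
    (\forall y \near z, times_differentiable k' f y) /\
    (forall s : k'.-tuple 'I_p, differentiable (partials s f) z)
  else True.

Definition times_continuously_differentiable k f : Prop :=
  (forall z, times_differentiable k f z) /\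
  (forall s : k.-tuple 'I_p, continuous (partials s f)).

Definition monomial s (u : 'rV[R]_p) : R := \prod_(i <- s) u 0 i.

End calculus.

(* F has derivative F' on A, taken along A (hence one-sided at the endpoints
   of a segment), and F' is continuous on A. *)
Definition C1_within {R : realType} (A : set R) (F F' : R -> R) : Prop :=
  (forall x, A x ->
     (F y - F x) / (y - x) @[y --> within A x^'] --> F' x) /\
  {within A, continuous F'}.

Section conditional_kendall_tau.
Context {R : realType} {p : nat}.
Implicit Types (f : 'rV[R]_2 * 'rV[R]_p -> R) (z : 'rV[R]_p).

Definition marginal_density f z : R :=
  \int[lebesgue_rV 2]_x f (x, z).

Definition conditional_density f z (x : 'rV[R]_2) : R :=
  f (x, z) / marginal_density f z.

(* P((X_1, X_2) \in E | Z_1 = Z_2 = z) for independent (X_1, Z_1), (X_2, Z_2)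
   with density f *)
Definition conditional_pair_prob f z (E : set ('rV[R]_2 * 'rV[R]_2)) : R :=
  \int[(lebesgue_rV 2 \x lebesgue_rV 2)%E]_(x in E)
    (conditional_density f z x.1 * conditional_density f z x.2).

Definition concordance (x1 x2 : 'rV[R]_2) : R :=
  (x1 0 0 - x2 0 0) * (x1 0 1 - x2 0 1).

Definition conditional_tau f z : R :=
  conditional_pair_prob f z [set x | 0 < concordance x.1 x.2] -
  conditional_pair_prob f z [set x | concordance x.1 x.2 < 0].

Definition g1 (x1 x2 : 'rV[R]_2) : R :=
  4 * ((x1 0 0 < x2 0 0) && (x1 0 1 < x2 0 1))%:R - 1.
Definition g2 (x1 x2 : 'rV[R]_2) : R :=
  (0 < concordance x1 x2)%R%:R - (concordance x1 x2 < 0)%R%:R.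
Definition g3 (x1 x2 : 'rV[R]_2) : R :=
  1 - 4 * ((x1 0 0 < x2 0 0) && (x2 0 1 < x1 0 1))%:R.

Definition scaled_kernel (K : 'rV[R]_p -> R) (h : R) (u : 'rV[R]_p) : R :=
  h ^- p * K (h^-1 *: u).

Definition kernel_weight (K : 'rV[R]_p -> R) (h : R) (n : nat)
    (Z : nat -> 'rV[R]_p) z (i : nat) : R :=
  scaled_kernel K h (Z i - z) / \sum_(j < n) scaled_kernel K h (Z j - z).

Definition tau_hat (g : 'rV[R]_2 -> 'rV[R]_2 -> R) (K : 'rV[R]_p -> R) (h : R)
    (n : nat) (XZ : nat -> 'rV[R]_2 * 'rV[R]_p) z : R :=
  let w := kernel_weight K h n (fun i => (XZ i).2) z in
  \sum_(i < n) \sum_(j < n) w i * w j * g (XZ i).1 (XZ j).1.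

End conditional_kendall_tau.

Section assumptions.
Context {R : realType} {p : nat}.
Implicit Types (K : 'rV[R]_p -> R) (Zset : set 'rV[R]_p) (alpha : nat)
  (f : 'rV[R]_2 * 'rV[R]_p -> R).

Definition kernel_of_order alpha K : Prop :=
  [/\ exists C : R, forall u, `|K u| <= C,
      forall u, K (- u) = K u,
      (lebesgue_rV p).-integrable setT (EFin \o K),
      \int[lebesgue_rV p]_u K u = 1 &
      forall (j : nat) (iota : j.-tuple 'I_p), (0 < j < alpha)%N ->
        (lebesgue_rV p).-integrable setT
          (fun u => (K u * monomial iota u)%:E) /\
        \int[lebesgue_rV p]_u (K u * monomial iota u) = 0].

Definition smooth_marginal alpha K Zset f : Prop :=
  let fZ := marginal_density f in
  times_continuously_differentiable alpha fZ /\
  exists2 C : R, 0 < C & forall z, Zset z ->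
    (\int[lebesgue_rV p]_u (`|K u|%:E *
       \sum_(iota : alpha.-tuple 'I_p) (`|monomial iota u|%:E *
         ereal_sup [set `|partials iota fZ (z + t *: u)|%:E
                   | t in `[0%R, 1%R]])) <= C%:E)%E.

Definition bounded_marginal Zset f : Prop :=
  exists fmin fmax : R, [/\ 0 < fmin, 0 < fmax &
    forall z, Zset z -> fmin <= marginal_density f z <= fmax].

(* |d_s1 f1 (y1) * d_s2 f2 (y2)|, with value +oo where one of the two partial
   derivatives does not exist: this way a bound on such a quantity carries the
   existence of the derivatives it mentions. *)
Definition abs_partials_prod (f1 f2 : 'rV[R]_p -> R) (s1 s2 : seq 'I_p)
    (y1 y2 : 'rV[R]_p) : \bar R :=
  if `[< times_differentiable (size s1) f1 y1 /\
         times_differentiable (size s2) f2 y2 >]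
  then `|partials s1 f1 y1 * partials s2 f2 y2|%:E else +oo%E.

Definition sup_partials f alpha (k : nat) (iota : alpha.-tuple 'I_p)
    (u v : 'rV[R]_p) (x1 x2 : 'rV[R]_2) (z : 'rV[R]_p) : \bar R :=
  ereal_sup [set abs_partials_prod (fun y => f (x1, y)) (fun y => f (x2, y))
                   (take k iota) (drop k iota) (z + t *: u) (z + t *: v)
            | t in `[0%R, 1%R]].

Definition weighted_sup_partials K f alpha (k : nat) (iota : alpha.-tuple 'I_p)
    (z : 'rV[R]_p)
    (y : 'rV[R]_p * 'rV[R]_p * 'rV[R]_2 * 'rV[R]_2) : \bar R :=
  let: (u, v, x1, x2) := y in
  (`|K u|%:E * `|K v|%:E * sup_partials f k iota u v x1 x2 z *
   `|monomial (take k iota) u * monomial (drop k iota) v|%:E)%E.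

Definition smooth_joint alpha K Zset f : Prop :=
  let mu := (lebesgue_rV p \x lebesgue_rV p \x lebesgue_rV 2 \x lebesgue_rV 2)%E in
  [/\ forall x : 'rV[R]_2, {ae lebesgue_rV p, forall z, Zset z ->
        times_differentiable alpha (fun y => f (x, y)) z},
      forall z (k : nat) (iota : alpha.-tuple 'I_p), Zset z -> (k <= alpha)%N ->
        mu.-integrable setT (weighted_sup_partials K f k iota z) &
      exists2 C : R, 0 < C & forall z, Zset z ->
        (\int[mu]_y (\sum_(k < alpha.+1) ('C(alpha, k)%:R%:E *
           \sum_(iota : alpha.-tuple 'I_p)
             weighted_sup_partials K f k iota z y)) <= C%:E)%E].

Definition bounded_design {p' : nat} Zset (psi : 'rV[R]_p -> 'cV[R]_p') : Prop :=
  exists C : R, forall z j, Zset z -> `|psi z j 0| <= C.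

Definition link_derivative_bounded Zset f (Lambda' : R -> R) : Prop :=
  exists (U : set R) (C : R),
    [/\ open U, conditional_tau f @` Zset `<=` U &
        forall x, U x -> -1 <= x <= 1 -> `|Lambda' x| <= C].

End assumptions.

Section penalized_regression.
Context {R : realType} {p p' : nat}.

Definition dotc (a b : 'cV[R]_p') : R := (a^T *m b) 0 0.

Definition l1_norm (b : 'cV[R]_p') : R := \sum_j `|b j 0|.

(* y i is the response observed at the design point z i, for i < m *)
Definition lasso_criterion (psi : 'rV[R]_p -> 'cV[R]_p') (m : nat)
    (z : nat -> 'rV[R]_p) (y : nat -> R) (lambda : R) (b : 'cV[R]_p') : R :=
  m%:R^-1 * (\sum_(i < m) (y i - dotc (psi (z i)) b) ^+ 2) + lambda * l1_norm b.

Definition limit_criterion (M : 'M[R]_p') (lambda0 : R)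
    (bstar b : 'cV[R]_p') : R :=
  dotc (bstar - b) (M *m (bstar - b)) + lambda0 * l1_norm b.

Definition is_minimizer (G : 'cV[R]_p' -> R) (b : 'cV[R]_p') : Prop :=
  forall b', G b <= G b'.

Definition is_unique_minimizer (G : 'cV[R]_p' -> R) (b : 'cV[R]_p') : Prop :=
  forall b', b' != b -> G b < G b'.

End penalized_regression.

(* Main.v *)
(* For a bounded G put V_G(z) := n^-2 sum_(i,j) K_h(Z_i - z) K_h(Z_j - z) G(X_i, X_j),
   so that the estimated conditional Kendall's tau at z is V_g(z) / V_1(z).  If
   z |-> f(., z) is continuous into L^1, uniformly on the compact set Z, then the
   mean of V_G(z) tends uniformly to
   theta_G(z) := \int \int G(x1, x2) f(x1, z) f(x2, z) dx1 dx2, and theta_1 = f_Z^2,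
   theta_g = f_Z^2 tau.  The continuity in L^1 follows from Scheffe's lemma: f_Z is
   continuous by (A2), and (A4) forces f(x, .) to be continuous at z for almost
   every x.  The mass that K puts far away from 0 is controlled by the Taylor bound
   of (A2) on f_Z.

   A Bernstein inequality for U-statistics (Hoeffding's averaging over the
   permutations of the sample) then gives
   P(|V_G(z) - theta_G(z)| >= eps) <= 2 exp(- A n h^(2p)) uniformly in z: the kernel
   of the U-statistic is O(h^(-2p)), but so is its second moment.

   Lambda is only known on [-1, 1], which the estimated tau may leave.  But a density
   charges both concordant and discordant pairs, so |tau| < 1 pointwise, and by
   compactness |tau| <= 1 - rho on Z; hence the estimated tau lies in [-1, 1] off an
   exponentially small event, and there uniform continuity of Lambda applies.  A
   union bound over the n' design points makes all responses uniformly close to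
   their limits.  The penalized criterion is then close to the limiting one on
   bounded sets and, being convex, has its minimizers close to the limiting one. *)

Require Import Defs.
From HB Require Import structures.
From mathcomp Require Import all_boot all_order all_algebra.
From mathcomp Require Import fingroup perm finmap.
From mathcomp Require Import all_classical all_reals all_analysis measurable_realfun.
From mathcomp Require Import ring lra zify.

Set Implicit Arguments.
Unset Strict Implicit.
Unset Printing Implicit Defensive.

Import Order.TTheory GRing.Theory Num.Theory.
Import numFieldNormedType.Exports.

Local Open Scope classical_set_scope.
Local Open Scope ring_scope.

(** * Real-valued integrals *)

(** Only limits are asserted, so the bias needs no rate; this is why continuity in L^1 can replace a
    Taylor expansion of the joint density, whose derivatives are controlled only through K-weighted
    suprema. The translates z + h u leave the compact set, and there neither f_Z nor the slices of f
    are bounded.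

    The second moment is as small as O(h^(-2p)) because, in the square of each factor K_h, one copy
    is bounded by a multiple of h^(-p) and the other is integrated against the density. With an
    exponential parameter t proportional to h^(2p), the constraint on t and the variance term both
    become free of h, and a single factor h^(2p) remains in the exponent.

    The diagonal terms i = j of V_G contribute O(1 / (n h^(2p))). The rate hypothesis with A = 1
    disposes of them: n' >= 1 eventually, so n h^(2p) exceeds every constant.

    The estimated tau can leave [-1, 1] because K, hence the weights, may take negative values. *)

Section real_integrable.
Context {d : measure_display} {T : measurableType d} {R : realType}.
Variable mu : {measure set T -> \bar R}.
Implicit Types f g : T -> R.

Lemma integrable_EFinZl c f : mu.-integrable setT (EFin \o f) ->
  mu.-integrable setT (EFin \o (fun x => c * f x)).
Proof. by move=> fi; have := integrableZl measurableT c fi. Qed.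

Lemma integrable_EFinD f g : mu.-integrable setT (EFin \o f) ->
  mu.-integrable setT (EFin \o g) ->
  mu.-integrable setT (EFin \o (fun x => f x + g x)).
Proof. by move=> fi gi; have := integrableD measurableT fi gi. Qed.

Lemma integrable_EFinB f g : mu.-integrable setT (EFin \o f) ->
  mu.-integrable setT (EFin \o g) ->
  mu.-integrable setT (EFin \o (fun x => f x - g x)).
Proof. by move=> fi gi; have := integrableB measurableT fi gi. Qed.

Lemma integrable_EFin_sum (I : finType) (F : I -> T -> R) :
  (forall i, mu.-integrable setT (EFin \o F i)) ->
  mu.-integrable setT (EFin \o (fun x => \sum_i F i x)).
Proof.
move=> iF; rewrite (_ : _ \o _ = fun x => (\sum_i (F i x)%:E)%E).
  by apply: integrable_sum => // i _; exact: iF.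
by apply/funext => x /=; rewrite sumEFin.
Qed.

Lemma measurable_EFin f : measurable_fun setT f ->
  measurable_fun setT (fun x => (f x)%:E).
Proof. by move=> mf; apply/measurable_EFinP. Qed.

Lemma integral_EFin_fine f : mu.-integrable setT (EFin \o f) ->
  (\int[mu]_x (f x)%:E = (\int[mu]_x f x)%:E)%E.
Proof. by move=> fi; rewrite fineK//; exact: integrable_fin_num fi. Qed.

Lemma ge0_integral_EFinZl (c : R) f : 0 <= c -> measurable_fun setT f ->
  (forall x, 0 <= f x) ->
  (\int[mu]_x (c * f x)%:E = c%:E * \int[mu]_x (f x)%:E)%E.
Proof.
move=> c0 mf f0; under eq_integral do rewrite EFinM.
rewrite ge0_integralZl// ?lee_fin//; first exact: measurable_EFin.
by move=> x _; rewrite lee_fin.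
Qed.

End real_integrable.

(** * Affine change of variables on R^n *)

Section lebesgue_affine.
Context {R : realType}.
Local Open Scope ereal_scope.

Let affine (c h : R) : measurableTypeR R -> measurableTypeR R :=
  fun x => (c + h * x)%R.

Let measurable_affine c h : measurable_fun setT (affine c h).
Proof. by apply: measurable_funD => //; exact: measurable_funM. Qed.

(** Lebesgue measure is determined by half-open intervals, and [h] times its image under the affine
    map gives []a, b]] the length [b - a]. *)
Lemma ge0_integral_affine1 (c h : R) (phi : R -> \bar R) : (0 < h)%R ->
  measurable_fun setT phi -> (forall x, 0 <= phi x) ->
  \int[lebesgue_measure]_y phi y =
  h%:E * \int[lebesgue_measure]_x phi (c + h * x)%R.
Proof.
move=> h0 mphi phi0.
have h0' : (0 <= h)%R by exact: ltW.
have -> : \int[lebesgue_measure]_x phi (c + h * x)%R =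
    \int[pushforward lebesgue_measure (affine c h)]_y phi y.
  by rewrite ge0_integral_pushforward.
rewrite -[h]/((NngNum h0')%:num).
rewrite -(@ge0_integral_mscale _ _ _
  (measure_function_pushforward__canonical__measure_function_Measure
    lebesgue_measure (measurable_affine c h)))//.
apply: eq_measure_integral => /= A mA _.
apply: (@lebesgue_measure_unique _ (mscale (NngNum h0')
  (measure_function_pushforward__canonical__measure_function_Measure
    lebesgue_measure (measurable_affine c h)))) => //= _ [[a b]] _ <-.
have E : affine c h @^-1` `]a, b] = `]((a - c) / h)%R, ((b - c) / h)%R]%classic.
  apply/seteqP; split => x; rewrite /= /affine !in_itv /=.
    move=> /andP[? ?]; rewrite ltr_pdivrMr// ler_pdivlMr//; apply/andP; split; lra.
  rewrite ltr_pdivrMr// ler_pdivlMr// => /andP[? ?]; apply/andP; split; lra.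
transitivity (h%:E * lebesgue_measure (affine c h @^-1` `]a, b])) => //.
rewrite E !lebesgue_measure_itv/= !lte_fin ltr_pM2r ?invr_gt0// ltrD2r.
case: ifPn => _; last by rewrite mule0.
by rewrite -!EFinD -EFinM; congr EFin; field; exact: lt0r_neq0.
Qed.

Lemma measurable_mx_affine m n (z : 'M[R]_(m, n)) (h : R) :
  measurable_fun setT (fun u : 'M[R]_(m, n) => z + h *: u)%R.
Proof.
apply: measurable_mxP => i j; under eq_fun do rewrite !mxE.
apply: measurable_funD => //; apply: measurable_funM => //.
exact: measurable_mx_entry.
Qed.

Lemma ge0_integral_cons n (phi : 'rV[R]_n.+1 -> \bar R) :
  measurable_fun setT phi -> (forall x, 0 <= phi x) ->
  \int[lebesgue_rV n.+1]_v phi v =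
  \int[lebesgue_measure]_x \int[lebesgue_rV n]_v phi (cons_rV (x, v)).
Proof.
move=> mphi phi0 /=.
rewrite ge0_integral_pushforward//; last exact: measurable_cons_rV.
rewrite fubini_tonelli1//; last by move=> x; exact: phi0.
by apply: measurableT_comp => //; exact: measurable_cons_rV.
Qed.

Lemma cons_rV0 n x (v : 'rV[R]_n) : cons_rV (x, v) ord0 ord0 = x.
Proof. by rewrite -[LHS]/(uncons_rV _).1 cons_rVK. Qed.

Lemma cons_rVS n x (v : 'rV[R]_n) i :
  cons_rV (x, v) ord0 (lift ord0 i) = v ord0 i.
Proof.
have /(congr1 (fun xw : measurableTypeR R * 'rV[R]_n => xw.2 ord0 i)) :=
  cons_rVK (x, v).
by rewrite /= mxE => <-; congr (row_mx _ _ _ _); exact/val_inj.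
Qed.

(** Tonelli splits off the first coordinate; each coordinate contributes one factor [h] by the
    one-dimensional formula. *)
Lemma ge0_integral_affine n (z : 'rV[R]_n) (h : R) (phi : 'rV[R]_n -> \bar R) :
  (0 < h)%R -> measurable_fun setT phi -> (forall x, 0 <= phi x) ->
  \int[lebesgue_rV n]_y phi y =
  (h ^+ n)%:E * \int[lebesgue_rV n]_u phi (z + h *: u)%R.
Proof.
move=> h0; elim: n z phi => [|n IHn] z phi mphi phi0.
  rewrite expr0 mul1e; apply: eq_integral => x _; congr phi.
  by apply/matrixP => i [].
have mphi' : measurable_fun setT (fun v : 'rV[R]_n.+1 => phi (z + h *: v)%R).
  by apply: measurableT_comp => //; exact: measurable_mx_affine.
rewrite !ge0_integral_cons//.
pose z1 := (uncons_rV z).1; pose z2 := (uncons_rV z).2.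
have E (x : R) (v : 'rV[R]_n) : (z + h *: cons_rV (x, v) = cons_rV (z1 + h * x, z2 + h *: v))%R.
  apply/matrixP => i j; rewrite (ord1 i).
  have [k ->|->] := fintype.unliftP ord0 j.
    rewrite [RHS]cons_rVS [RHS]mxE [X in _ = (_ + X)%R]mxE.
    rewrite [LHS]mxE [X in (_ + X = _)%R]mxE cons_rVS mxE.
    by congr (z _ _ + _)%R; exact/val_inj.
  by rewrite [RHS]cons_rV0 [LHS]mxE [X in (_ + X = _)%R]mxE cons_rV0.
have mc : measurable_fun setT (fun xv => phi (cons_rV xv)).
  by apply: measurableT_comp => //; exact: measurable_cons_rV.
rewrite (@ge0_integral_affine1 z1 h)//; first last.
- by move=> x; exact: integral_ge0.
- by apply: (@measurable_fun_fubini_tonelli_F _ _ _ _ _ (lebesgue_rV n)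
    (fun xv => phi (cons_rV xv))) => // x; exact: phi0.
rewrite exprS EFinM -muleA; congr (_ * _).
rewrite -ge0_integralZl//; first last.
- by rewrite lee_fin exprn_ge0// ltW.
- by move=> x _; exact: integral_ge0.
- apply: (@measurable_fun_fubini_tonelli_F _ _ _ _ _ (lebesgue_rV n)
    (fun xv => phi (z + h *: cons_rV xv)%R)) => //.
  by apply: (measurableT_comp mphi'); exact: measurable_cons_rV.
apply: eq_integral => x _.
rewrite (IHn z2)//.
- by congr (_ * _); apply: eq_integral => v _; rewrite E.
- by apply: (measurableT_comp (f := fun xv => phi (cons_rV xv))).
Qed.

End lebesgue_affine.

(** * Independent pairs *)

Section independence.
Context {d : measure_display} {Omega : measurableType d} {R : realType}.
Variable P : probability Omega R.
Local Open Scope ereal_scope.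

(** The law of [(U, V)] restricted to [E] and the scaled product are finite measures that agree on
    the generating pi-system of rectangles. The event [E] carries along a statement about the rest
    of the sample, so that variables can be adjoined one at a time. *)
Lemma product_law d1 d2 (T1 : measurableType d1) (T2 : measurableType d2)
    (mu1 : probability T1 R) (mu2 : probability T2 R)
    (U : Omega -> T1) (V : Omega -> T2) (E : set Omega) :
  measurable_fun setT U -> measurable_fun setT V -> measurable E ->
  (forall A B, measurable A -> measurable B ->
     P (U @^-1` A `&` (V @^-1` B `&` E)) = mu1 A * mu2 B * P E) ->
  forall C, measurable C ->
    P ((fun w => (U w, V w)) @^-1` C `&` E) = (mu1 \x mu2) C * P E.
Proof.
move=> mU mV mE UV C mC.
have mUV : measurable_fun setT (fun w => (U w, V w)).
  exact: measurable_fun_pair.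
pose k : {nonneg R} := NngNum (fine_ge0 (measure_ge0 P E)).
have kE : k%:num%:E = P E by rewrite /= fineK// fin_num_measure.
pose m1 := mscale k (mu1 \x mu2).
pose m2 := measure_function_pushforward__canonical__measure_function_Measure
  (mrestr P mE) mUV.
have m1E X : m1 X = (mu1 \x mu2) X * P E by rewrite /m1 /mscale kE muleC.
have m2E X : m2 X = P ((fun w => (U w, V w)) @^-1` X `&` E) by [].
rewrite -m1E -m2E; apply/esym.
apply: (@measure_unique _ _ _ [set A `*` B | A in measurable & B in measurable]
  (fun=> setT)) => //.
- exact: measurable_prod_measurableType.
- move=> _ _ [A1 mA1 [B1 mB1 <-]] [A2 mA2 [B2 mB2 <-]].
  by rewrite -setXI; exists (A1 `&` A2); [exact: measurableI|exists (B1 `&` B2) => //; exact: measurableI].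
- by move=> _; exists setT => //; exists setT => //; rewrite setXTT.
- by rewrite bigcup_const.
- move=> _ [A mA [B mB <-]].
  rewrite -[LHS]/(m1 _) m1E m2E product_measure1E// -UV//; congr (P _).
  by apply/seteqP; split => w /=; [move=> [? [? ?]]|move=> [[? ?] ?]].
- move=> _; rewrite -[X in X < _]/(m1 _) m1E probability_setT mul1e.
  by rewrite ltey_eq fin_num_measure.
Qed.

Lemma integral_product_law d1 d2 (T1 : measurableType d1)
    (T2 : measurableType d2) (mu1 : probability T1 R) (mu2 : probability T2 R)
    (U : Omega -> T1) (V : Omega -> T2) (phi : T1 * T2 -> \bar R) :
  measurable_fun setT U -> measurable_fun setT V ->
  (forall C, measurable C ->
     P ((fun w => (U w, V w)) @^-1` C) = (mu1 \x mu2) C) ->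
  measurable_fun setT phi -> (forall x, 0 <= phi x) ->
  \int[P]_w phi (U w, V w) = \int[mu1]_x \int[mu2]_y phi (x, y).
Proof.
move=> mU mV UV mphi phi0.
have mUV : measurable_fun setT (fun w => (U w, V w)).
  exact: measurable_fun_pair.
rewrite -[RHS](@fubini_tonelli1 _ _ _ _ _ mu1 mu2 phi mphi phi0).
pose law : {measure set (T1 * T2) -> \bar R} :=
  measure_function_pushforward__canonical__measure_function_Measure P mUV.
transitivity (\int[law]_x phi x); first by rewrite ge0_integral_pushforward.
by apply: (eq_measure_integral (mu1 \x mu2)) => C mC _; exact: UV.
Qed.

Context {d' : measure_display} {T : measurableType d'}.
Variables (Y : nat -> Omega -> T) (nu : probability T R).
Hypothesis mY : forall i, measurable_fun setT (Y i).
Hypothesis Y_indep : mutually_independent P Y.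
Hypothesis Y_law : forall i A, measurable A -> P (Y i @^-1` A) = nu A.

Let rect (J : {fset nat}) (A : nat -> set T) :=
  \bigcap_(i in [set` J]) (Y i @^-1` A i).

Let measurable_preim i A : measurable A -> measurable (Y i @^-1` A).
Proof. by move=> mA; rewrite -[X in measurable X]setTI; exact: mY. Qed.

Let measurable_rect J A : (forall i, measurable (A i)) -> measurable (rect J A).
Proof.
move=> mA; apply: fin_bigcap_measurable => // i _; exact: measurable_preim.
Qed.

Let rectU1 J A j B : j \notin J -> 
  Y j @^-1` B `&` rect J A =
  rect (j |` J)%fset (fun i => if i == j then B else A i).
Proof.
move=> jJ; apply/seteqP; split => w /=.
  move=> [Bw Aw] i /=; rewrite !inE => /orP[/eqP->|iJ]; first by rewrite eqxx.
  by case: ifPn => [/eqP ij|_]; [move: jJ; rewrite -ij iJ|exact: Aw].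
move=> Aw; split; first by have := Aw j; rewrite /= !inE eqxx; exact.
move=> i /= iJ; have := Aw i; rewrite /= !inE iJ orbT => /(_ isT).
by case: ifPn => // /eqP ij; move: jJ; rewrite -ij iJ.
Qed.

Let P_rectU1 J A j B : (forall i, measurable (A i)) -> measurable B ->
  j \notin J -> P (Y j @^-1` B `&` rect J A) = nu B * P (rect J A).
Proof.
move=> mA mB jJ; rewrite rectU1// !Y_indep//; last by move=> i; case: ifP.
rewrite big_fsetU1//= eqxx Y_law//; congr (_ * _).
apply: eq_big_seq => i iJ; case: ifPn => // /eqP ij.
by move: jJ; rewrite -ij iJ.
Qed.

Variables (psi : T * T -> R) (e : nat -> nat).
Hypothesis mpsi : measurable_fun setT psi.
Hypothesis psi0 : forall x, (0 <= psi x)%R.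

Let W m w : R := (\prod_(i < m) psi (Y (e i.*2) w, Y (e i.*2.+1) w))%R.

Let mW m : measurable_fun setT (W m).
Proof.
apply: measurable_prod => i _; apply: measurableT_comp => //.
exact: measurable_fun_pair.
Qed.

Lemma indep_prod_pairs m : {in [pred k | (k < m.*2)%N] &, injective e} ->
  (forall J A, (forall i, measurable (A i)) ->
    (forall k, (k < m.*2)%N -> e k \notin J) ->
    forall C, measurable C ->
      P (W m @^-1` C `&` rect J A) = P (W m @^-1` C) * P (rect J A)) /\
  \int[P]_w (W m w)%:E = (\int[nu \x nu]_x (psi x)%:E) ^+ m.
Proof.
elim: m => [|m IHm] einj.
  split=> [J A mA _ C mC|].
    have W0 w : W 0 w = 1%R by rewrite /W big_ord0.
    have -> : W 0 @^-1` C = if (1%R \in C) then setT else set0.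
      case: ifPn => [/set_mem C1|/negP C1]; apply/seteqP; split => // w /=.
        by rewrite W0.
      by rewrite W0 => C1'; apply: C1; rewrite inE.
    by case: ifP; rewrite ?setTI ?set0I ?probability_setT ?measure0 ?mul1e ?mul0e.
  rewrite expe0; under eq_integral do rewrite /W big_ord0.
  by rewrite integral_cst//= mul1e probability_setT.
have einj' i j : (i < m.*2.+2)%N -> (j < m.*2.+2)%N -> e i = e j -> i = j.
  by rewrite -doubleS => im jm; exact: einj.
have [|IH1 IH2] := IHm.
  by move=> i j; rewrite !inE => im jm; apply: einj'; lia.
set a := e m.*2; set b := e m.*2.+1.
have ab : a != b by apply/eqP => /einj'; lia.
have ltm k : (k < m.*2)%N -> e k != a /\ e k != b.
  by move=> km; split; apply/eqP => /einj'; lia.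
(* [W m] becomes a random variable of its own, with law [muW]; then [Y b] and [Y a] are adjoined in
   turn. *)
pose WW : {mfun Omega >-> R} := HB.pack (W m) (isMeasurableFun.Build _ _ _ _ _ (mW m)).
pose muW : probability R R := distribution P WW.
have WWE C : muW C = P (W m @^-1` C) by [].
have lawbW J A : (forall i, measurable (A i)) ->
    (forall k, (k < m.+1.*2)%N -> e k \notin J) ->
    forall C A1, measurable C -> measurable A1 ->
    P ((fun w => (Y b w, W m w)) @^-1` C `&` (Y a @^-1` A1 `&` rect J A)) =
    (nu \x muW) C * (nu A1 * P (rect J A)).
  move=> mA eJ C A1 mC mA1.
  have aJ : a \notin J by apply: eJ; rewrite doubleS; lia.
  have bJ : b \notin J by apply: eJ; rewrite doubleS; lia.
  rewrite -(P_rectU1 mA mA1 aJ).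
  apply: product_law => //.
    apply: measurableI; [exact: measurable_preim|exact: measurable_rect].
  move=> B D mB mD.
  have mA' i : measurable (if i == a then A1 else A i) by case: ifP.
  have mA'' i : measurable (if i == b then B else if i == a then A1 else A i).
    by case: ifP.
  rewrite setICA rectU1// rectU1//; last by rewrite !inE negb_or eq_sym ab.
  rewrite IH1//; last first.
    move=> k km; rewrite !inE !negb_or; have [-> ->] := ltm _ km.
    by apply: eJ; rewrite doubleS; lia.
  rewrite -rectU1//; last by rewrite !inE negb_or eq_sym ab.
  rewrite P_rectU1//; last by rewrite !inE negb_or eq_sym ab.
  by rewrite -rectU1// WWE muleCA muleA.
have Erect0 : rect fset0 (fun=> setT) = setT.
  by apply/seteqP; split => // w _ i.
have lawbW0 C : measurable C ->
    P ((fun w => (Y b w, W m w)) @^-1` C) = (nu \x muW) C.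
  move=> mC; have := lawbW fset0 (fun=> setT) (fun=> measurableT)
    (fun k _ => isT) C setT mC measurableT.
  by rewrite Erect0 preimage_setT !setIT !probability_setT !mule1.
have lawabW J A : (forall i, measurable (A i)) ->
    (forall k, (k < m.+1.*2)%N -> e k \notin J) ->
    forall C, measurable C ->
    P ((fun w => (Y a w, (Y b w, W m w))) @^-1` C `&` rect J A) =
    (nu \x (nu \x muW)) C * P (rect J A).
  move=> mA eJ C mC; apply: product_law => //.
  - by apply: measurable_fun_pair.
  - exact: measurable_rect.
  - by move=> A1 B mA1 mB; rewrite setICA lawbW// muleCA muleA.
have lawabW0 C : measurable C ->
    P ((fun w => (Y a w, (Y b w, W m w))) @^-1` C) = (nu \x (nu \x muW)) C.
  move=> mC; have := lawabW fset0 (fun=> setT) (fun=> measurableT)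
    (fun k _ => isT) C mC.
  by rewrite Erect0 !setIT !probability_setT !mule1.
(* The absolute value makes the integrand nonnegative everywhere, as Tonelli requires; it changes
   nothing, since [W m] is nonnegative. *)
pose phi (x : T * (T * R)) : R := (psi (x.1, x.2.1) * `|x.2.2|)%R.
have mphi : measurable_fun setT phi.
  apply: measurable_funM; last first.
    by apply: measurableT_comp => //; exact: measurableT_comp.
  by apply: measurableT_comp => //; apply: measurable_fun_pair => //; exact: measurableT_comp.
have Wphi w : W m.+1 w = phi (Y a w, (Y b w, W m w)).
  by rewrite /W big_ord_recr /phi /= mulrC ger0_norm// prodr_ge0.
have mphiC C : measurable C -> measurable (phi @^-1` C).
  by move=> mC; rewrite -[X in measurable X]setTI; exact: mphi.
have WphiC C : W m.+1 @^-1` C =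
    (fun w => (Y a w, (Y b w, W m w))) @^-1` (phi @^-1` C).
  by apply/seteqP; split => w /=; rewrite Wphi.
split.
  by move=> J A mA eJ C mC; rewrite WphiC lawabW ?lawabW0//; exact: mphiC.
have mYW : measurable_fun setT (fun w => (Y a w, (Y b w, W m w))).
  by apply: measurable_fun_pair => //; exact: measurable_fun_pair.
under eq_integral do rewrite Wphi.
have phi0 x : (0 <= (phi x)%:E) by rewrite lee_fin mulr_ge0.
have mEphi : measurable_fun setT (EFin \o phi) by exact/measurable_EFinP.
rewrite (integral_product_law (mu1 := nu) (mu2 := (nu \x muW)%E)
  (U := Y a) (V := fun w => (Y b w, W m w)) (phi := EFin \o phi))//; last first.
  exact: measurable_fun_pair.
transitivity (\int[nu]_y \int[nu]_y' ((psi (y, y'))%:E * \int[muW]_w `|w|%:E)).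
  apply: eq_integral => y _.
  rewrite /fubini_F fubini_tonelli1//.
  apply: eq_integral => y' _.
  rewrite /fubini_F /phi /=; under eq_integral do rewrite EFinM.
  - rewrite ge0_integralZl//; last by rewrite lee_fin.
    by apply/measurable_EFinP.
  - by apply: (measurableT_comp mEphi); exact: measurable_fun_pair.
  - by move=> x; exact: phi0.
have -> : \int[muW]_w `|w|%:E = (\int[nu \x nu]_x (psi x)%:E) ^+ m.
  rewrite -IH2 ge0_integral_distribution//=; last first.
    by apply/measurable_EFinP.
  by apply: eq_integral => w _ /=; rewrite ger0_norm// prodr_ge0.
set c := (X in X ^+ m.+1); have c0 : 0 <= c by apply: integral_ge0 => x _; rewrite lee_fin.
have mEpsi : measurable_fun setT (EFin \o psi) by exact/measurable_EFinP.
have Epsi0 x : 0 <= (EFin \o psi) x by rewrite lee_fin.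
rewrite -/c expeS muleC.
have cE : c = \int[nu]_y \int[nu]_y' (psi (y, y'))%:E.
  by rewrite /c (@fubini_tonelli1 _ _ _ _ _ nu nu (EFin \o psi)).
rewrite [X in _ = _ * X]cE.
rewrite -ge0_integralZl//; first last.
- exact: expe_ge0.
- by move=> y _; apply: integral_ge0 => y' _; exact: Epsi0.
- by apply: (@measurable_fun_fubini_tonelli_F _ _ _ _ _ nu (EFin \o psi)).
apply: eq_integral => y _; rewrite -ge0_integralZl//.
- by apply: eq_integral => y' _; rewrite muleC.
- by apply: (measurableT_comp mEpsi); exact: measurable_fun_pair.
- by move=> y' _; exact: Epsi0.
- exact: expe_ge0.
Qed.

End independence.

(** * Bernstein inequality for U-statistics *)

(** Double counting. Left multiplication by a permutation shows that the sum over [s] is the same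
    for all ordered pairs of distinct indices; summed over all these pairs, each [s] merely permutes
    the double sum. Ordered pairs are kept because the functions summed need not be symmetric. *)
Lemma sum_perm_pair (R : fieldType) n (f : 'I_n -> 'I_n -> R) (a b : 'I_n) :
  a != b ->
  (n * n.-1)%:R * (\sum_(s : 'S_n) f (s a) (s b)) =
  n`!%:R * \sum_i \sum_(j | j != i) f i j.
Proof.
pose G a b := \sum_(s : 'S_n) f (s a) (s b).
have Gconst a' b' : a != b -> a' != b' -> G a' b' = G a b.
  move=> ab ab'; pose b1 := tperm a a' b.
  (* The first transposition sends [a] to [a'] and [b] to [b1]; the second sends [b1] to [b'] and
     fixes [a']. *)
  pose p := (tperm a a' * tperm b1 b')%g.
  have pa : p a = a'.
    rewrite permM tpermL tpermD// 1?eq_sym//.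
    by rewrite -(inj_eq (@perm_inj _ (tperm a a'))) /b1 tpermR tpermK eq_sym in ab *.
  have pb : p b = b' by rewrite permM tpermL.
  rewrite /G [RHS](reindex_inj (mulgI p)) /=.
  by apply: eq_bigr => s _; rewrite !(permM p) pa pb.
move=> ab; rewrite -/(G a b).
have -> : (n * n.-1)%:R * G a b = \sum_i \sum_(j | j != i) G i j.
  transitivity (\sum_(i < n) \sum_(j < n | j != i) G a b).
    rewrite (eq_bigr (fun=> n.-1%:R * G a b)).
      by rewrite sumr_const card_ord -[RHS]mulr_natl natrM mulrA.
    move=> i _; rewrite sumr_const -[LHS]mulr_natl; congr (_%:R * _).
    by rewrite -[in RHS](card_ord n) -(cardC1 i); apply: eq_card => j; rewrite !inE.
  by apply: eq_bigr => i _; apply: eq_bigr => j ji; rewrite (Gconst i j)// eq_sym.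
rewrite /G; under eq_bigr do rewrite exchange_big /=.
rewrite exchange_big /=.
have E (s : 'S_n) : \sum_i \sum_(j | j != i) f (s i) (s j) =
    \sum_i \sum_(j | j != i) f i j.
  rewrite [RHS](reindex_inj (@perm_inj _ s)) /=; apply: eq_bigr => i _.
  rewrite [RHS](reindex_inj (@perm_inj _ s)) /=; apply: eq_bigl => j.
  by rewrite (inj_eq perm_inj).
by under eq_bigr do rewrite E; rewrite sumr_const card_Sn mulr_natl.
Qed.

Section exp_inequalities.
Context {R : realType}.

(** From [expR (- y) >= 1 - y] comes [expR y <= (1 - y)^-1], and [(1 + y + 2 y^2) (1 - y) = 1 + y^2
    (1 - 2 y)] is at least 1 for [y <= 1/2]. *)
Lemma expR_le_quadratic (y : R) : `|y| <= 2^-1 -> expR y <= 1 + y + 2 * y ^+ 2.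
Proof.
move=> y2; have y12 : y <= 2^-1 by rewrite (le_trans (ler_norm _)).
have y1 : 0 < 1 - y by lra.
have h : expR y <= (1 - y)^-1.
  rewrite -[y in expR y]opprK expRN lef_pV2 ?posrE ?expR_gt0//.
  exact: expR_ge1Dx.
rewrite (le_trans h)// -div1r ler_pdivrMr//.
have -> : (1 + y + 2 * y ^+ 2) * (1 - y) = 1 + y ^+ 2 * (1 - 2 * y) by ring.
by rewrite lerDl mulr_ge0 ?sqr_ge0//; lra.
Qed.

(** Jensen's inequality for the uniform mean, by the tangent of the exponential at the mean. *)
Lemma expR_mean_le (I : finType) (x : I -> R) : (0 < #|I|)%N ->
  expR (#|I|%:R^-1 * \sum_i x i) <= #|I|%:R^-1 * \sum_i expR (x i).
Proof.
move=> I0; have I0' : (0 : R) < #|I|%:R by rewrite ltr0n.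
set a := _^-1 * _.
have aE : \sum_i x i = #|I|%:R * a by rewrite /a mulrA divff ?mul1r// gt_eqF.
rewrite mulrC ler_pdivlMr//.
have -> : expR a * #|I|%:R = \sum_i expR a * (1 + (x i - a)).
  rewrite -mulr_sumr big_split sumrB !sumr_const/= aE -[a *+ _]mulr_natl subrr addr0.
  by [].
apply: ler_sum => i _.
have -> : expR (x i) = expR a * expR (x i - a) by rewrite -expRD addrC subrK.
rewrite ler_pM2l ?expR_gt0//.
exact: expR_ge1Dx.
Qed.

End exp_inequalities.

Section mgf.
Context {R : realType} {d : measure_display} {S : measurableType d}.
Variable rho : probability S R.

Lemma bounded_integrable (q : S -> R) (B : R) : measurable_fun setT q ->
  (forall x, `|q x| <= B) -> rho.-integrable setT (EFin \o q).
Proof.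
move=> mq qB; apply: measurable_bounded_integrable => //.
  by rewrite (le_lt_trans (@probability_le1 _ _ _ rho _ measurableT))// ltry.
exists B; split => //; first exact: num_real.
by move=> b Bb x _ /=; rewrite (le_trans (qB x))// ltW.
Qed.

(** The exponential is majorized by a quadratic [G] whose linear part has mean zero after centring,
    which leaves 1 plus [2 t^2] times the variance. The condition [4 t B <= 1] puts [t (q - mu)]
    within 1/2 of 0, where the majorant is valid. *)
Lemma mgf_le (q : S -> R) (B s2 t : R) : measurable_fun setT q ->
  (forall x, `|q x| <= B) -> \int[rho]_x (q x ^+ 2) <= s2 ->
  0 <= t -> 4 * (t * B) <= 1 ->
  (\int[rho]_x (expR (t * (q x - \int[rho]_y q y)))%:E <=
   (expR (2 * t ^+ 2 * s2))%:E)%E.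
Proof.
move=> mq qB q2 t0 tB; set mu := \int[rho]_y q y.
have iq := bounded_integrable mq qB.
have B0 : 0 <= B by rewrite (le_trans (normr_ge0 _) (qB point)).
have muB : `|mu| <= B.
  rewrite (le_trans (le_normr_Rintegral _ _))//.
  have -> : B = \int[rho]_x (cst B x).
    by rewrite Rintegral_cst//= probability_setT mulr1.
  apply: le_Rintegral => //; first exact: integrable_norm.
  by apply: (@bounded_integrable _ B) => // x; rewrite ger0_norm.
have mq2 : measurable_fun setT (fun x => q x ^+ 2) by exact: measurable_funX.
have iq2 : rho.-integrable setT (EFin \o (fun x => q x ^+ 2)).
  apply: (@bounded_integrable _ (B ^+ 2)) => // x.
  by rewrite normrX lerXn2r// nnegrE.
(* Coefficients of [1 + t (q - mu) + 2 t^2 (q - mu)^2] in powers of [q]. *)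
pose c0 := 1 - t * mu + 2 * t ^+ 2 * mu ^+ 2.
pose c1 := t - 4 * t ^+ 2 * mu.
pose G x := c0 + (c1 * q x + 2 * t ^+ 2 * q x ^+ 2).
have mG : measurable_fun setT G.
  by apply: measurable_funD => //; apply: measurable_funD; exact: measurable_funM.
have ic1 : rho.-integrable setT (EFin \o (fun x => c1 * q x)).
  exact: integrable_EFinZl.
have ic2 : rho.-integrable setT (EFin \o (fun x => 2 * t ^+ 2 * q x ^+ 2)).
  exact: integrable_EFinZl.
have ic12 : rho.-integrable setT (EFin \o (fun x => c1 * q x + 2 * t ^+ 2 * q x ^+ 2)).
  exact: integrable_EFinD.
have ic0 : rho.-integrable setT (EFin \o cst c0).
  by apply: (@bounded_integrable _ `|c0|).
have iG : rho.-integrable setT (EFin \o G) by exact: integrable_EFinD.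
have GE : \int[rho]_x G x = 1 + 2 * t ^+ 2 * (\int[rho]_x (q x ^+ 2) - mu ^+ 2).
  rewrite (@RintegralD _ _ _ rho setT (cst c0))// Rintegral_cst//=.
  rewrite RintegralD// !RintegralZl// probability_setT /= -/mu /c0 /c1; ring.
have mexp : measurable_fun setT (fun x => expR (t * (q x - mu))).
  apply: measurableT_comp => //.
  by apply: measurable_funM => //; exact: measurable_funB.
have le1 : (\int[rho]_x (expR (t * (q x - mu)))%:E <= \int[rho]_x (G x)%:E)%E.
  apply: ge0_le_integral => //.
  - exact: measurable_EFin.
  - exact: measurable_EFin.
  - move=> x _; rewrite lee_fin.
    have -> : G x = 1 + t * (q x - mu) + 2 * (t * (q x - mu)) ^+ 2.
      by rewrite /G /c0 /c1; ring.
    apply: expR_le_quadratic; rewrite normrM (ger0_norm t0).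
    have : `|q x - mu| <= 2 * B.
      by rewrite (le_trans (ler_normB _ _))//; have := qB x; lra.
    move=> /(ler_wpM2l t0); lra.
apply: (le_trans le1).
have -> : (\int[rho]_x (G x)%:E = (\int[rho]_x G x)%:E)%E.
  exact: integral_EFin_fine.
rewrite lee_fin GE (le_trans _ (expR_ge1Dx _))// lerD2l.
apply: ler_wpM2l; first by rewrite mulr_ge0// sqr_ge0.
by rewrite (le_trans _ q2)// gerBl sqr_ge0.
Qed.

End mgf.

Lemma lee_expe2r {R : realType} (x y : \bar R) n :
  (0 <= x -> x <= y -> x ^+ n <= y ^+ n)%E.
Proof.
move=> x0 xy; elim: n => [|n IH]; first by rewrite !expe0.
by rewrite !expeS; apply: lee_pmul => //; exact: expe_ge0.
Qed.

Section bernstein.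
Context {d : measure_display} {Omega : measurableType d} {R : realType}.
Variable P : probability Omega R.
Context {d' : measure_display} {T : measurableType d'}.
Variables (Y : nat -> Omega -> T) (nu : probability T R).
Hypothesis mY : forall i, measurable_fun setT (Y i).
Hypothesis Y_indep : mutually_independent P Y.
Hypothesis Y_law : forall i A, measurable A -> P (Y i @^-1` A) = nu A.

Definition ustat (q : T * T -> R) n w : R :=
  (n * n.-1)%:R^-1 *
  \sum_(i < n) \sum_(j < n | j != i) q (Y i w, Y j w).

Lemma measurable_ustat q n : measurable_fun setT q ->
  measurable_fun setT (ustat q n).
Proof.
move=> mq; apply: measurable_funM => //.
apply: measurable_sum => i; rewrite (_ : (fun _ => _) = fun w =>
  \sum_(j <- [seq j <- index_enum 'I_n | j != i]) q (Y i w, Y j w)); last first.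
  by apply/funext => w; rewrite big_filter.
by apply: measurable_sum => j; apply: measurableT_comp => //; exact: measurable_fun_pair.
Qed.

(* Hoeffding's device: a U-statistic is the average, over the permutations of
   the sample, of means of [n./2] independent terms. *)
Lemma ustat_mgf_le (q : T * T -> R) n (t c mu : R) : (1 < n)%N ->
  measurable_fun setT q ->
  (\int[nu \x nu]_x (expR (t * (q x - mu)))%:E <= (expR c)%:E)%E ->
  (\int[P]_w (expR (t * n./2%:R * (ustat q n w - mu)))%:E <=
    (expR (n./2%:R * c))%:E)%E.
Proof.
case: n => // n n1 mq qc; set m := n.+1./2.
have m0 : (0 < m)%N by rewrite /m; lia.
have m2n : (m.*2 <= n.+1)%N by rewrite /m; lia.
pose psi x := expR (t * (q x - mu)).
have mpsi : measurable_fun setT psi.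
  apply: measurableT_comp => //.
  by apply: measurable_funM => //; exact: measurable_funB.
(* The sample index at position [k] after [s]. Positions stay below [m.*2 <= n.+1], so the default
   value of [inord] never occurs. *)
pose e (s : 'S_n.+1) (k : nat) : nat := s (inord k).
have einj s : {in [pred k | (k < m.*2)%N] &, injective (e s)}.
  move=> i j; rewrite !inE => im jm /val_inj /perm_inj /(congr1 val).
  by rewrite /= !inordK//; lia.
pose X (s : 'S_n.+1) w : R :=
  \sum_(i < m) t * (q (Y (e s i.*2) w, Y (e s i.*2.+1) w) - mu).
have expX s w : expR (X s w) =
    \prod_(i < m) psi (Y (e s i.*2) w, Y (e s i.*2.+1) w).
  by rewrite /X expR_sum.
have mexpX s : measurable_fun setT (fun w => expR (X s w)).
  under eq_fun do rewrite expX.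
  apply: measurable_prod => i _; apply: measurableT_comp => //.
  exact: measurable_fun_pair.
have IX s : (\int[P]_w (expR (X s w))%:E <= (expR (m%:R * c))%:E)%E.
  under eq_integral do rewrite expX.
  have [_ ->] := indep_prod_pairs mY Y_indep Y_law mpsi
    (fun x => expR_ge0 _) (einj s).
  rewrite expRM_natl EFin_expe.
  apply: lee_expe2r => //.
  by apply: integral_ge0 => x _; rewrite lee_fin expR_ge0.
(* Each pair of positions [(2 i, 2 i + 1)], averaged over [s], gives the same U-statistic. *)
have avg w : t * m%:R * (ustat q n.+1 w - mu) =
    #|{: 'S_n.+1}|%:R^-1 * \sum_s X s w.
  have -> : \sum_s X s w =
      t * \sum_(i < m) (\sum_s q (Y (e s i.*2) w, Y (e s i.*2.+1) w) - (n.+1)`!%:R * mu).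
    rewrite /X exchange_big mulr_sumr; apply: eq_bigr => i _ /=.
    by rewrite -mulr_sumr sumrB sumr_const card_Sn -[mu *+ _]mulr_natl.
  rewrite (eq_bigr (fun=> (n.+1)`!%:R * (ustat q n.+1 w - mu))).
    rewrite sumr_const card_ord card_Sn -[X in _ * (_ * X)]mulr_natl.
    have : (n.+1)`!%:R != 0 :> R by rewrite pnatr_eq0 -lt0n fact_gt0.
    by move=> ?; field.
  move=> i _; rewrite mulrBr; congr (_ - _); rewrite /ustat.
  have ab : inord i.*2 != inord i.*2.+1 :> 'I_n.+1.
    rewrite -val_eqE /= !inordK//; have := ltn_ord i; lia.
  have := sum_perm_pair (fun a b : 'I_n.+1 => q (Y a w, Y b w)) ab.
  have n0 : (n.+1 * n)%:R != 0 :> R by rewrite pnatr_eq0 muln_eq0; lia.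
  by move/(canRL (mulKf n0)); rewrite mulrCA.
have N0 : (0 < #|{: 'S_n.+1}|)%N by apply/card_gt0P; exists 1%g.
apply: (@le_trans _ _
  (\int[P]_w (\sum_s (#|{: 'S_n.+1}|%:R^-1)%:E * (expR (X s w))%:E)))%E.
  apply: ge0_le_integral => //.
  - apply: measurable_EFin; apply: measurableT_comp => //.
    apply: measurable_funM => //; apply: measurable_funB => //.
    exact: measurable_ustat.
  - apply: emeasurable_sum => s; apply: emeasurable_funM => //.
    exact: measurable_EFin.
  - move=> w _; rewrite avg.
    rewrite [leRHS](eq_bigr (fun s => (#|{: 'S_n.+1}|%:R^-1 * expR (X s w))%:E))//.
    by rewrite sumEFin lee_fin -mulr_sumr; exact: expR_mean_le.
rewrite ge0_integral_sum//; first last.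
- by move=> s; apply: emeasurable_funM => //; exact: measurable_EFin.
apply: (@le_trans _ _
  (\sum_(s : 'S_n.+1) (#|{: 'S_n.+1}|%:R^-1 * expR (m%:R * c))%:E))%E.
  apply: lee_sum => s _; rewrite ge0_integralZl//.
  - by rewrite EFinM lee_wpmul2l// lee_fin invr_ge0.
  - exact: measurable_EFin.
rewrite sumEFin lee_fin sumr_const -[X in X <= _]mulr_natl mulrA divff ?mul1r//.
by rewrite pnatr_eq0 -lt0n.
Qed.

(** Chernoff's bound: Markov's inequality for the exponential of [t m (U - mu)], with [m = n./2]. *)
Lemma ustat_deviation (q : T * T -> R) n (B s2 t eps : R) : (1 < n)%N ->
  measurable_fun setT q -> (forall x, `|q x| <= B) ->
  \int[(nu \x nu)%E]_x (q x ^+ 2) <= s2 ->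
  0 <= t -> 4 * (t * B) <= 1 ->
  (P [set w | (eps <= ustat q n w - \int[(nu \x nu)%E]_x q x)%R] <=
   (expR (- (n./2%:R * (t * eps - 2 * t ^+ 2 * s2))))%:E)%E.
Proof.
move=> n1 mq qB q2 t0 tB; set mu := \int[_]_x q x.
have := mgf_le mq qB q2 t0 tB.
move=> /(ustat_mgf_le n1 mq); set F := (F in (\int[P]_w F w <= _)%E) => IF.
have mU : measurable_fun setT (fun w => ustat q n w - mu).
  by apply: measurable_funB => //; exact: measurable_ustat.
set A := [set w | _].
have mA : measurable A.
  rewrite (_ : A = (fun w => ustat q n w - mu) @^-1` `[eps, +oo[).
    by rewrite -[X in measurable X]setTI; exact: mU.
  by apply/seteqP; split => w; rewrite /A /= in_itv /= andbT.
have mF : measurable_fun setT F.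
  apply: measurable_EFin; apply: measurableT_comp => //.
  exact: measurable_funM.
have F0 w : (0 <= F w)%E by rewrite lee_fin expR_ge0.
have : ((expR (t * n./2%:R * eps))%:E * P A <=
    (expR (n./2%:R * (2 * t ^+ 2 * s2)))%:E)%E.
  apply: le_trans IF; rewrite -integral_cst//.
  apply: (@le_trans _ _ (\int[P]_(w in A) F w)%E).
    apply: ge0_le_integral => //.
    - by move=> w _; rewrite lee_fin expR_ge0.
    - exact: measurable_funS mF.
    - move=> w Aw; rewrite lee_fin ler_expR; apply: ler_wpM2l => //.
      by rewrite mulr_ge0.
  by apply: ge0_subset_integral.
rewrite muleC -lee_pdivlMr ?expR_gt0// => /le_trans; apply.
by rewrite -EFinM lee_fin -expRN -expRD ler_expR; lra.
Qed.

End bernstein.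

(** * Stability of minimizers of convex functions *)

Section mx_norm_entries.
Context {R : realType} {m n : nat}.
Implicit Types A : 'M[R]_(m, n).

Lemma normr_entry_le A i j : `|A i j| <= `|A|.
Proof.
rewrite [leRHS]mx_normrE; exact: (le_bigmax _ (fun ij => `|A ij.1 ij.2|) (i, j)).
Qed.

Lemma mx_normr_le A (c : R) : 0 <= c -> (forall i j, `|A i j| <= c) -> `|A| <= c.
Proof.
by move=> c0 Ac; rewrite [leLHS]mx_normrE; apply: bigmax_le => // ij _; exact: Ac.
Qed.

End mx_norm_entries.

Lemma normr_trmx {R : realType} m n (A : 'M[R]_(m, n)) : `|A^T| = `|A|.
Proof.
apply/eqP; rewrite eq_le; apply/andP; split; apply: mx_normr_le => // i j.
  by rewrite mxE normr_entry_le.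
by rewrite (le_trans _ (normr_entry_le A^T j i))// mxE.
Qed.

Lemma continuous_dist {R : realType} (V : normedModType R) (c : V) :
  continuous (fun v => `|v - c|).
Proof.
by move=> v; apply: cvg_norm; apply: cvgB; [exact: cvg_id|exact: cvg_cst].
Qed.

Section argmin.
Context {R : realType} {q : nat}.
Implicit Types (G H : 'cV[R]_q -> R) (b : 'cV[R]_q).

(** Closed bounded sets of row vectors are compact, and transposition is an isometry. *)
Lemma compact_sphere_cV (c : 'cV[R]_q) (r : R) : compact [set b | `|b - c| = r].
Proof.
pose S := [set v : 'rV[R]_q | `|v - c^T| = r].
have -> : [set b | `|b - c| = r] = trmx @` S.
  apply/seteqP; split => [b /= br|_ [v /= <- <-]].
    by exists b^T; rewrite /S ?trmxK//= -linearB normr_trmx.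
  by rewrite -normr_trmx linearB /= trmxK.
apply: continuous_compact.
  apply: continuous_subspaceT => v; apply/(@cvgrPdist_lt _ _ _ (nbhs v) (nbhs_filter v)) => e e0.
  apply: filterS (nbhsx_ballx v e e0) => u.
  by rewrite -ball_normE /= -linearB normr_trmx.
apply: bounded_closed_compact.
  exists (`|c^T| + r); split; first exact: num_real.
  move=> x cx v /= vr; rewrite (le_trans _ (ltW cx))//.
  by rewrite -vr addrC -[v in leLHS](subrK c^T) ler_normD.
rewrite (_ : S = (fun v => `|v - c^T|) @^-1` [set r])//.
apply: closed_comp; last exact: closed_eq.
by move=> v _; exact: continuous_dist.
Qed.

(* Convexity turns closeness of the criteria on a ball into localization of all
   minimizers: a minimizer outside of the ball yields a point of the sphere on
   the segment joining it to the centre. *)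
Lemma convex_argmin_stability G (b0 : 'cV[R]_q) (eps : R) : 0 < eps ->
  continuous G -> is_unique_minimizer G b0 ->
  exists2 delta : R, 0 < delta & forall H,
    (forall (t : R) a b, 0 <= t <= 1 ->
       H ((1 - t) *: a + t *: b) <= (1 - t) * H a + t * H b) ->
    (forall b, `|b - b0| <= eps -> `|H b - G b| <= delta) ->
    forall bm, is_minimizer H bm -> `|bm - b0| < eps.
Proof.
move=> eps0 cG minG.
have cS := @compact_sphere_cV b0 eps.
(* Compactness of the sphere makes the gap above the minimum uniform. *)
have : \forall d \near (0 : R)^'+, [set b | `|b - b0| = eps] `<=`
    (fun b => 3 * d < G b - G b0).
  apply: ((compact_near_coveringP _).1 cS _ _ (fun d b => 3 * d < G b - G b0)).
  move=> b /= beps.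
  have bb0 : b != b0 by apply: contraTneq eps0 => bb; rewrite -beps bb subrr normr0 ltxx.
  have gap : 0 < G b - G b0 by rewrite subr_gt0 minG.
  near=> b' d => /=.
  apply: (@lt_trans _ _ ((G b - G b0) / 2)).
    rewrite mulrC -ltr_pdivlMr//; near: d; apply: nbhs_right_lt.
    by rewrite !divr_gt0.
  suff : `|G b - G b'| < (G b - G b0) / 2 by rewrite ltr_norml => /andP[]; lra.
  by near: b'; apply: cvgr_dist_lt; [exact: cG|rewrite divr_gt0].
move=> [e /= e0 He].
pose d := e / 2.
have d0 : 0 < d by rewrite divr_gt0.
have {}He : [set b | `|b - b0| = eps] `<=` (fun b => 3 * d < G b - G b0).
  apply: He => //=; rewrite sub0r normrN gtr0_norm// /d; lra.
exists d => // H cH HG bm minH; rewrite ltNge; apply/negP => far.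
have far0 : 0 < `|bm - b0| by rewrite (lt_le_trans eps0).
pose t := eps / `|bm - b0|.
have t01 : 0 <= t <= 1.
  by apply/andP; split; rewrite /t ?ler_pdivrMr ?mul1r// divr_ge0// ltW.
pose b' := (1 - t) *: b0 + t *: bm.
have b'E : `|b' - b0| = eps.
  have -> : b' - b0 = t *: (bm - b0).
    by apply/matrixP => i j; rewrite !mxE; ring.
  by rewrite normrZ ger0_norm; [rewrite /t divfK// gt_eqF|case/andP: t01].
(* Convexity and minimality give [H b' <= H b0], hence [G b' - G b0 <= 2 d], against a gap above
   [3 d] on the sphere. *)
have := He _ b'E.
have := HG _ (_ : `|b' - b0| <= eps); rewrite b'E lexx => /(_ isT).
have := HG b0; rewrite subrr normr0 (ltW eps0) => /(_ isT).
have := cH _ b0 bm t01; rewrite -/b'.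
have := minH b0; rewrite !ler_norml; case/andP: t01 => t0 t1.
move=> h1 h2 /andP[h3 h4] /andP[h5 h6] h7.
have : t * H bm <= t * H b0 by rewrite ler_wpM2l.
lra.
Unshelve. all: by end_near. Qed.

End argmin.

(** * The penalized criterion *)

Lemma continuous_fun_sum {R : realType} (T : topologicalType) (I : finType)
    (F : I -> T -> R) : (forall i, continuous (F i)) ->
  continuous (fun x => \sum_i F i x).
Proof. by move=> cF; apply: continuous_big => //; exact: add_continuous. Qed.

Lemma continuous_fun_add {R : realType} (T : topologicalType) (f g : T -> R) :
  continuous f -> continuous g -> continuous (fun x => f x + g x).
Proof. by move=> cf cg x; apply: cvgD; [exact: cf|exact: cg]. Qed.

Lemma continuous_fun_mul {R : realType} (T : topologicalType) (f g : T -> R) :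
  continuous f -> continuous g -> continuous (fun x => f x * g x).
Proof. by move=> cf cg x; apply: cvgM; [exact: cf|exact: cg]. Qed.

Section lasso.
Context {R : realType} {p p' : nat}.
Implicit Types (a b v : 'cV[R]_p') (M : 'M[R]_p').

Lemma dotcE a b : dotc a b = \sum_j a j 0 * b j 0.
Proof. by rewrite /dotc mxE; apply: eq_bigr => j _; rewrite mxE. Qed.

Lemma dotcC a b : dotc a b = dotc b a.
Proof. by rewrite !dotcE; apply: eq_bigr => j _; rewrite mulrC. Qed.

Lemma dotcDr a b c : dotc a (b + c) = dotc a b + dotc a c.
Proof. by rewrite /dotc mulmxDr mxE. Qed.

Lemma dotcZr a t b : dotc a (t *: b) = t * dotc a b.
Proof. by rewrite /dotc -scalemxAr mxE. Qed.

Lemma dotcDl a b c : dotc (a + b) c = dotc a c + dotc b c.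
Proof. by rewrite dotcC dotcDr !(dotcC c). Qed.

Lemma dotcZl t a b : dotc (t *: a) b = t * dotc a b.
Proof. by rewrite dotcC dotcZr dotcC. Qed.

Lemma dotcBr a b c : dotc a (b - c) = dotc a b - dotc a c.
Proof. by rewrite /dotc mulmxBr mxE [X in _ + X]mxE. Qed.

Lemma normr_sum_le (I : finType) (F : I -> R) (c : R) :
  (forall i, `|F i| <= c) -> `|\sum_i F i| <= #|I|%:R * c.
Proof.
move=> Fc; rewrite (le_trans (ler_norm_sum _ _ _))// mulr_natl -sumr_const.
by apply: ler_sum.
Qed.

Lemma dotc_le a b : `|dotc a b| <= p'%:R * (`|a| * `|b|).
Proof.
rewrite dotcE -[X in X%:R](card_ord p'); apply: normr_sum_le => j.
by rewrite normrM ler_pM// normr_entry_le.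
Qed.

Lemma mulmx_normr_le M v : `|M *m v| <= p'%:R * (`|M| * `|v|).
Proof.
apply: mx_normr_le => [|i j]; first by rewrite !mulr_ge0.
rewrite mxE -[X in X%:R](card_ord p'); apply: normr_sum_le => k.
by rewrite normrM ler_pM// normr_entry_le.
Qed.

Lemma l1_norm_le b : `|l1_norm b| <= p'%:R * `|b|.
Proof.
rewrite /l1_norm -[X in X%:R](card_ord p'); apply: normr_sum_le => k.
by rewrite normr_id normr_entry_le.
Qed.

Lemma l1_norm_convex (t : R) a b : 0 <= t <= 1 ->
  l1_norm ((1 - t) *: a + t *: b) <= (1 - t) * l1_norm a + t * l1_norm b.
Proof.
move=> /andP[t0 t1]; rewrite /l1_norm !mulr_sumr -big_split; apply: ler_sum => j _.
rewrite !mxE (le_trans (ler_normD _ _))// !normrM.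
by rewrite (ger0_norm t0) ger0_norm ?subr_ge0.
Qed.

Variable psi : 'rV[R]_p -> 'cV[R]_p'.

Definition gram m (z : nat -> 'rV[R]_p) : 'M[R]_p' :=
  m%:R^-1 *: (\sum_(i < m) psi (z i) *m (psi (z i))^T).

Lemma dotc_gram m z v :
  dotc v (gram m z *m v) = m%:R^-1 * \sum_(i < m) dotc (psi (z i)) v ^+ 2.
Proof.
rewrite /gram -scalemxAl dotcZr; congr (_ * _).
rewrite mulmx_suml.
have -> : dotc v (\sum_(i < m) psi (z i) *m (psi (z i))^T *m v) =
    \sum_(i < m) dotc v (psi (z i) *m (psi (z i))^T *m v).
  by rewrite /dotc mulmx_sumr summxE.
apply: eq_bigr => i _; rewrite /dotc -mulmxA mulmxA mxE big_ord1 expr2.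
by congr (_ * _); rewrite -/(dotc v (psi (z i))) dotcC.
Qed.

Lemma lasso_criterion_convex m z y (lambda t : R) a b : 0 <= lambda ->
  0 <= t <= 1 ->
  lasso_criterion psi m z y lambda ((1 - t) *: a + t *: b) <=
  (1 - t) * lasso_criterion psi m z y lambda a +
  t * lasso_criterion psi m z y lambda b.
Proof.
move=> l0 t01; rewrite /lasso_criterion !mulrDr addrACA; apply: lerD; last first.
  rewrite [X in _ <= X + _]mulrCA [X in _ <= _ + X]mulrCA -mulrDr.
  apply: ler_wpM2l => //.
  exact: l1_norm_convex.
rewrite [X in _ <= X + _]mulrCA [X in _ <= _ + X]mulrCA -mulrDr.
apply: ler_wpM2l => //.
rewrite !mulr_sumr -big_split; apply: ler_sum => i _ /=.
rewrite dotcDr !dotcZr; case/andP: t01 => t0 t1.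
set u := dotc _ a; set v := dotc _ b.
rewrite -subr_ge0.
have -> : (1 - t) * (y i - u) ^+ 2 + t * (y i - v) ^+ 2 -
    (y i - ((1 - t) * u + t * v)) ^+ 2 = t * (1 - t) * (u - v) ^+ 2 by ring.
by rewrite mulr_ge0 ?sqr_ge0// mulr_ge0// subr_ge0.
Qed.

(** The first summand is free of [b] and does not affect minimizers; the second is small with the
    residuals [r]; what remains is the limiting criterion with the empirical Gram matrix and the
    actual penalty. *)
Lemma lasso_criterion_expand m z y (lambda : R) (bstar b : 'cV[R]_p') :
  let r i := y i - dotc (psi (z i)) bstar in
  lasso_criterion psi m z y lambda b =
  m%:R^-1 * (\sum_(i < m) r i ^+ 2) +
  2 * (m%:R^-1 * \sum_(i < m) r i * dotc (psi (z i)) (bstar - b)) +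
  dotc (bstar - b) (gram m z *m (bstar - b)) + lambda * l1_norm b.
Proof.
move=> r; rewrite /lasso_criterion dotc_gram; congr (_ + _).
rewrite mulrCA -!mulrDr; congr (_ * _); rewrite mulr_sumr -!big_split.
by apply: eq_bigr => i _; rewrite /= /r dotcBr; ring.
Qed.

Lemma continuous_limit_criterion M (lambda0 : R) (bstar : 'cV[R]_p') :
  continuous (limit_criterion M lambda0 bstar).
Proof.
have ce j : continuous (fun b => b j 0 : R) by exact: coord_continuous.
have -> : limit_criterion M lambda0 bstar = fun b =>
    \sum_i (bstar i 0 - b i 0) * (\sum_j M i j * (bstar j 0 - b j 0)) +
    lambda0 * \sum_j `|b j 0|.
  apply/funext => b; rewrite /limit_criterion dotcE; congr (_ + _).
  apply: eq_bigr => i _; rewrite !mxE; congr (_ * _).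
  by apply: eq_bigr => j _; rewrite !mxE.
have cb i : continuous (fun b : 'cV[R]_p' => bstar i 0 - b i 0).
  by move=> b; apply: (@continuousB _ _ _ (cst (bstar i 0))); [exact: cst_continuous|exact: ce].
apply: continuous_fun_add.
  apply: continuous_fun_sum => i; apply: continuous_fun_mul; first exact: cb.
  apply: continuous_fun_sum => j; apply: continuous_fun_mul; last exact: cb.
  exact: cst_continuous.
apply: continuous_fun_mul; first exact: cst_continuous.
apply: continuous_fun_sum => j b; apply: (continuous_comp (@ce j b)).
exact: norm_continuous.
Qed.

(** The deterministic half of the argument: randomness will enter only through the requirement that
    the first [m] residuals be at most [eta]. *)
Lemma lasso_argmin_close M (lambda0 : R) (bstar binf : 'cV[R]_p') (C eps : R) :
  0 < eps -> is_unique_minimizer (limit_criterion M lambda0 bstar) binf ->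
  exists2 eta : R, 0 < eta & forall m z y lambda, (0 < m)%N ->
    0 <= lambda -> (forall i, `|psi (z i)| <= C) ->
    `|gram m z - M| <= eta -> `|lambda - lambda0| <= eta ->
    (forall i, (i < m)%N -> `|y i - dotc (psi (z i)) bstar| <= eta) ->
    forall b, is_minimizer (lasso_criterion psi m z y lambda) b ->
      `|b - binf| < eps.
Proof.
move=> eps0 /(convex_argmin_stability eps0 (@continuous_limit_criterion _ _ _)).
move=> [d d0 stab].
(* [D] bounds [|bstar - b|] and [L] bounds [|b|] on the ball of radius [eps] about [binf]. The
   summands of [c] bound, per unit of [eta], the cross term, the Gram error and the penalty error;
   the final 1 makes [c] positive. *)
pose D := `|bstar - binf| + eps; pose L := `|binf| + eps.
have D0 : 0 <= D by rewrite addr_ge0// ltW.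
have L0 : 0 <= L by rewrite addr_ge0// ltW.
pose c := 2 * (p'%:R * (`|C| * D)) + p'%:R * (D * (p'%:R * D)) + p'%:R * L + 1.
have c0 : 0 < c by rewrite ltr_wpDl// !addr_ge0// !mulr_ge0// !mulr_ge0.
exists (d / c) => [|m z y lambda m0 l0 psiC MM ll yy b bmin].
  by rewrite divr_gt0.
set eta := d / c in MM ll yy *.
have eta0 : 0 <= eta by rewrite divr_ge0// ltW.
pose r i := y i - dotc (psi (z i)) bstar.
(* Subtracting the term free of [b] keeps the minimizers and makes closeness to the limiting
   criterion possible. *)
pose H b := lasso_criterion psi m z y lambda b - m%:R^-1 * (\sum_(i < m) r i ^+ 2).
apply: (stab H) => [t a a' t01|a aeps|a]; last first.
- by rewrite /H lerD2r; exact: bmin.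
- have aD : `|bstar - a| <= D.
    rewrite -[bstar](subrK binf) -addrA (le_trans (ler_normD _ _))// lerD2l.
    by rewrite distrC.
  have aL : `|a| <= L.
    rewrite -[a](subrK binf) addrC (le_trans (ler_normD _ _))// lerD2l//.
  rewrite /H (lasso_criterion_expand _ _ _ _ bstar) /limit_criterion -/r.
  set s1 := \sum_(i < m) _; set s2 := \sum_(i < m) _.
  set v := bstar - a in aD s2 *.
  have -> : m%:R^-1 * s1 + 2 * (m%:R^-1 * s2) + dotc v (gram m z *m v) +
     lambda * l1_norm a - m%:R^-1 * s1 - (dotc v (M *m v) + lambda0 * l1_norm a)
     = 2 * (m%:R^-1 * s2) + dotc v ((gram m z - M) *m v) +
       (lambda - lambda0) * l1_norm a.
    by rewrite mulmxBl dotcBr; ring.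
  have -> : d = 2 * (eta * (p'%:R * (`|C| * D))) + eta * (p'%:R * (D * (p'%:R * D))) +
      eta * (p'%:R * L) + eta.
    have -> : d = eta * c by rewrite /eta divfK// gt_eqF.
    by rewrite /c; ring.
  apply: (@le_trans _ _ (2 * (eta * (p'%:R * (`|C| * D))) +
      eta * (p'%:R * (D * (p'%:R * D))) + eta * (p'%:R * L))); last by rewrite lerDl.
  rewrite (le_trans (ler_normD _ _))// lerD//; last first.
    rewrite normrM ler_pM// (le_trans (l1_norm_le _))//; exact: ler_wpM2l.
  rewrite (le_trans (ler_normD _ _))// lerD//; last first.
    have -> : eta * (p'%:R * (D * (p'%:R * D))) =
      p'%:R * (D * (p'%:R * (eta * D))) by ring.
    apply: (le_trans (dotc_le _ _)); apply: ler_wpM2l => //.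
    apply: ler_pM => //; apply: (le_trans (mulmx_normr_le _ _)).
    by apply: ler_wpM2l => //; exact: ler_pM.
  rewrite normrM ger0_norm// ler_wpM2l// normrM ger0_norm ?invr_ge0//.
  rewrite mulrC ler_pdivrMr ?ltr0n// mulrC -[X in X%:R](card_ord m).
  apply: normr_sum_le => i; rewrite normrM ler_pM//; first exact: yy.
  rewrite (le_trans (dotc_le _ _))// ler_wpM2l// ler_pM//.
  by rewrite (le_trans (psiC _))// ler_norm.
- rewrite /H; apply: (le_trans (lerD (lasso_criterion_convex _ _ _ _ _ _ _) (lexx _))) => //.
  by rewrite le_eqVlt; apply/orP; left; apply/eqP; ring.
Qed.

(** A vector on which a semidefinite form vanishes lies in the kernel of its matrix, by the
    Cauchy-Schwarz argument; invertibility then makes the form definite. *)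
Lemma gram_limit_unique_minimizer M (bstar : 'cV[R]_p') :
  M \in unitmx -> M^T = M -> (forall v, 0 <= dotc v (M *m v)) ->
  is_unique_minimizer (limit_criterion M 0 bstar) bstar.
Proof.
move=> uM sM M0 b bb; rewrite /limit_criterion subrr mulmx0 /dotc mulmx0 mxE.
rewrite !mul0r !addr0 -/(dotc _ _) lt_neqAle M0 andbT eq_sym.
apply/negP => /eqP v0; set v := bstar - b in v0.
have vE : v = bstar - b by [].
clearbody v.
have vw w : dotc w (M *m v) = 0.
  apply/eqP; apply: contraT => wv.
  have sym : dotc v (M *m w) = dotc w (M *m v).
    rewrite dotcC /dotc trmx_mul sM mulmxA; congr (_ _ _); exact: mulmxA.
  pose x := dotc w (M *m v); pose u := dotc w (M *m w).
  have quad t : 0 <= 2 * t * x + t ^+ 2 * u.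
    have := M0 (v + t *: w).
    rewrite mulmxDr -scalemxAr !(dotcDr, dotcZr, dotcDl, dotcZl) v0 sym.
    rewrite -/x -/u; lra.
  have u0 : 0 <= u := M0 w.
  (* Close to the vertex of the parabola; [u + 1] instead of [u] keeps the denominator positive when
     [u = 0]. The value is negative unless [x = 0]. *)
  have := quad (- x / (u + 1)).
  have u1 : 0 < u + 1 by rewrite ltr_wpDl.
  have -> : 2 * (- x / (u + 1)) * x + (- x / (u + 1)) ^+ 2 * u =
    - (x ^+ 2 * (u + 2)) / (u + 1) ^+ 2 by field; rewrite gt_eqF.
  rewrite mulNr oppr_ge0 leNgt divr_gt0 ?exprn_gt0// mulr_gt0//; last by lra.
  by rewrite exprn_even_gt0.
have Mv : M *m v = 0.
  have := vw (M *m v); rewrite dotcE => /eqP; rewrite psumr_eq0; last first.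
    by move=> j _; rewrite -expr2 sqr_ge0.
  move=> /allP h; apply/matrixP => i j; rewrite (ord1 j) [RHS]mxE.
  have := h i; rewrite mem_index_enum => /(_ isT).
  by rewrite mulf_eq0 orbb => /eqP.
have : v = 0 by rewrite -[v]mul1mx -(mulVmx uM) -mulmxA Mv mulmx0.
by move/eqP; rewrite vE subr_eq0 eq_sym (negbTE bb).
Qed.

End lasso.

(** * L^1 continuity of densities *)

Section scheffe.
Context {d : measure_display} {X : measurableType d} {R : realType}.
Variable mu : {measure set X -> \bar R}.

(** A real-valued integral is the [fine] of the extended one, and [fine] sends infinity to 0; a
    positive value therefore certifies finiteness. *)
Lemma integrable_of_fine (u : X -> R) : measurable_fun setT u ->
  (forall x, 0 <= u x) -> 0 < \int[mu]_x u x -> mu.-integrable setT (EFin \o u).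
Proof.
move=> mu_ u0 iu; apply/integrableP; split; first exact: measurable_EFin.
under eq_integral do rewrite /= ger0_norm//.
move: iu; rewrite /Rintegral; case: (integral _ _ _) => [r _| |] /=; rewrite ?ltxx//.
exact: ltry.
Qed.

(** [|a - b| = a + b - 2 min(a, b)], and the minimum is dominated by [u], so dominated convergence
    applies to it; the remaining terms converge by hypothesis. *)
Lemma scheffe (u_ : nat -> X -> R) (u : X -> R) :
  (forall n, measurable_fun setT (u_ n)) -> measurable_fun setT u ->
  (forall n x, 0 <= u_ n x) -> (forall x, 0 <= u x) ->
  (forall n, mu.-integrable setT (EFin \o u_ n)) ->
  mu.-integrable setT (EFin \o u) ->
  {ae mu, forall x, u_ ^~ x @ \oo --> u x} ->
  \int[mu]_x u_ n x @[n --> \oo] --> \int[mu]_x u x ->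
  \int[mu]_x `|u_ n x - u x| @[n --> \oo] --> 0.
Proof.
move=> mu_ mu0 u_0 u0 iu_ iu cvu cvI.
(* m_ n is the pointwise minimum of u_ n and u *)
pose m_ n x := 2^-1 * (u_ n x + u x - `|u_ n x - u x|).
have mabs n : measurable_fun setT (fun x => `|u_ n x - u x|).
  by apply: measurableT_comp => //; exact: measurable_funB.
have mm n : measurable_fun setT (m_ n).
  by apply: measurable_funM => //; apply: measurable_funB => //; exact: measurable_funD.
have m0 n x : 0 <= m_ n x.
  rewrite mulr_ge0// subr_ge0 (le_trans (ler_normB _ _))//.
  by rewrite !ger0_norm.
have mle n x : m_ n x <= u x.
  by have := ler_norm (u_ n x - u x); rewrite /m_; lra.
have im n : mu.-integrable setT (EFin \o m_ n).
  apply: le_integrable iu => //; first exact: measurable_EFin.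
  by move=> x _ /=; rewrite lee_fin !ger0_norm.
have cvm : \int[mu]_x m_ n x @[n --> \oo] --> \int[mu]_x u x.
  have [|||||] := @dominated_convergence _ _ _ mu setT measurableT
    (fun n => EFin \o m_ n) (EFin \o u) (EFin \o u).
  - by move=> n; exact: measurable_EFin.
  - exact: measurable_EFin.
  - apply: filterS cvu => x cvx _ /=; apply/cvg_EFin; first exact: nearW.
    have -> : u x = 2^-1 * (u x + u x - `|u x - u x|).
      by rewrite subrr normr0 subr0; field.
    rewrite (_ : _ \o _ = fun n => m_ n x)// /m_.
    apply: cvgMl_tmp; apply: cvgB; first by apply: cvgD => //; exact: cvg_cst.
    by apply: cvg_norm; apply: cvgB => //; exact: cvg_cst.
  - exact: iu.
  - by apply: nearW => x n _ /=; rewrite lee_fin ger0_norm.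
  - move=> _ _; rewrite [X in _ --> X -> _]integral_EFin_fine// => h.
    exact: (fine_cvg h).
have E n : \int[mu]_x `|u_ n x - u x| =
    \int[mu]_x u_ n x + \int[mu]_x u x - 2 * \int[mu]_x m_ n x.
  rewrite -RintegralZl// -RintegralD// -RintegralB//.
  - by apply: eq_Rintegral => x _; rewrite /m_; lra.
  - exact: integrable_EFinD.
  - exact: integrable_EFinZl.
under eq_cvg do rewrite E.
have cvJ : (cst (\int[mu]_x u x) : nat -> R) @ \oo --> \int[mu]_x u x.
  exact: cvg_cst.
have J0 : \int[mu]_x u x + \int[mu]_x u x - 2 * \int[mu]_x u x = 0 by ring.
have h := cvgB (cvgD cvI cvJ) (cvgMl_tmp (a := 2) cvm).
by rewrite J0 in h; apply: h.
Qed.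

Section l1_continuity.
Context {V : normedModType R} (F : V -> X -> R).
Hypothesis mF : forall a, measurable_fun setT (F a).
Hypothesis F0 : forall a x, 0 <= F a x.

Let Fint a := \int[mu]_x F a x.

(** Valued in [\bar R], since slices away from the compact set need not be integrable. *)
Definition l1_dist a b : \bar R := (\int[mu]_x `|F a x - F b x|%:E)%E.

Lemma measurable_l1_integrand a b :
  measurable_fun setT (fun x => `|F a x - F b x|).
Proof. by apply: measurableT_comp => //; exact: measurable_funB. Qed.

Lemma l1_dist_triangle a b c : (l1_dist a c <= l1_dist a b + l1_dist b c)%E.
Proof.
have mE a' b' := measurable_EFin (measurable_l1_integrand a' b').
rewrite /l1_dist -ge0_integralD//; apply: ge0_le_integral => //.
  exact: emeasurable_funD.
by move=> x _; rewrite lee_fin ler_distD.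
Qed.

Lemma l1_distC a b : l1_dist a b = l1_dist b a.
Proof. by apply: eq_integral => x _; rewrite distrC. Qed.

(** Otherwise some sequence [a_ n] tends to [z] and stays at distance at least [eps]. The
    exceptional null set belongs to [z] alone, so it serves the whole sequence, and the radius [d0]
    keeps the integrals positive, hence the slices integrable. *)
Lemma l1_dist_continuous_at (z : V) (eps : R) : 0 < eps ->
  {for z, continuous Fint} -> 0 < Fint z ->
  {ae mu, forall x, {for z, continuous (fun a => F a x)}} ->
  exists2 delta : R, 0 < delta &
    forall a, `|a - z| < delta -> (l1_dist a z < eps%:E)%E.
Proof.
move=> eps0 cI Iz cF.
have [d0 d00 Ipos] : exists2 d0 : R, 0 < d0 &
    forall a, `|a - z| < d0 -> 0 < Fint a.
  have /cvgrPdist_lt/(_ _ Iz) := cI; rewrite -nbhs_ballE => -[/= d0 d00 h].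
  exists d0 => // a az; have := h a; rewrite -ball_normE /= distrC => /(_ az).
  by rewrite ltr_norml => /andP[]; lra.
apply: contrapT => /forall2NP bad.
have {}bad n : exists a, `|a - z| < Num.min d0 n.+1%:R^-1 /\ (eps%:E <= l1_dist a z)%E.
  have [|/existsNP[a /not_implyP[az /negP]]] := bad (Num.min d0 n.+1%:R^-1).
    by rewrite lt_min d00 invr_gt0 ltr0n.
  by rewrite -leNgt => ?; exists a.
have [a_ ha] := choice bad.
have a_d0 n : `|a_ n - z| < d0 by have [] := ha n; rewrite lt_min => /andP[].
have a_z : a_ n @[n --> \oo] --> z.
  apply/cvgrPdist_lt => e e0; near=> n; rewrite distrC.
  have [] := ha n; rewrite lt_min => /andP[_ h] _; apply: (lt_trans h).
  by near: n; exact: near_infty_natSinv_lt (PosNum e0).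
have ia n : mu.-integrable setT (EFin \o F (a_ n)).
  by apply: integrable_of_fine => //; exact: Ipos.
have iz : mu.-integrable setT (EFin \o F z) by exact: integrable_of_fine.
have : \int[mu]_x `|F (a_ n) x - F z x| @[n --> \oo] --> 0.
  apply: (scheffe (u_ := fun n => F (a_ n))) => //.
    by apply: filterS cF => x cx; exact: (cvg_comp _ _ a_z cx).
  exact: (cvg_comp _ _ a_z cI).
move=> /cvgrPdist_lt/(_ _ eps0)[N _ /(_ N)] /=; rewrite leqnn => /(_ isT).
have [_] := ha N; rewrite /l1_dist integral_EFin_fine; last first.
  by apply: integrable_norm; exact: integrable_EFinB.
by rewrite lee_fin sub0r normrN ltr_norml => h /andP[_]; rewrite ltNge h.
Unshelve. all: by end_near. Qed.

(** [a] ranges over the whole space, because the translates [z + h u] leave the compact set. Near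
    the centre [z0] of a covering neighbourhood, both [a] and [z] are compared with [z0]. *)
Lemma l1_dist_unif_continuous (Z : set V) (eps : R) : 0 < eps -> compact Z ->
  (forall z, Z z -> {for z, continuous Fint}) -> (forall z, Z z -> 0 < Fint z) ->
  (forall z, Z z -> {ae mu, forall x, {for z, continuous (fun a => F a x)}}) ->
  exists2 delta : R, 0 < delta & forall z a, Z z -> `|a - z| < delta ->
    (l1_dist a z < eps%:E)%E.
Proof.
move=> eps0 cZ cI I0 cF.
have : \forall d \near (0 : R)^'+, Z `<=`
    (fun z => forall a, `|a - z| < d -> (l1_dist a z < eps%:E)%E).
  apply: ((compact_near_coveringP _).1 cZ _ _ (fun d z => forall a, `|a - z| < d -> (l1_dist a z < eps%:E)%E)).
  move=> z0 Zz0.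
  have [|d0 d00 hd] := @l1_dist_continuous_at z0 (eps / 2) _ (cI _ Zz0) (I0 _ Zz0) (cF _ Zz0).
    by rewrite divr_gt0.
  near=> z e => /= a az.
  have zz0 : `|z - z0| < d0 / 2.
    near: z; apply: (filterS _ (nbhsx_ballx z0 (d0 / 2) _)); last by rewrite divr_gt0.
    by move=> z; rewrite -ball_normE /= distrC.
  have dd0 : e < d0 / 2 by near: e; apply: nbhs_right_lt; rewrite divr_gt0.
  rewrite (le_lt_trans (l1_dist_triangle a z0 z))// [eps]splitr EFinD.
  apply: lteD; last rewrite l1_distC; apply: hd.
    rewrite -[a](subrK z) -addrA (le_lt_trans (ler_normD _ _))//; lra.
  by rewrite (lt_le_trans zz0)//; lra.
move=> [e /= e0 He]; exists (e / 2); first by rewrite divr_gt0.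
move=> z a Zz; apply: (He (e / 2)) => //=; last by rewrite divr_gt0.
by rewrite sub0r normrN gtr0_norm ?divr_gt0//; lra.
Unshelve. all: by end_near. Qed.

End l1_continuity.

End scheffe.

(** * Concordance and discordance *)

Lemma lebesgue_rV_hyperplane {R : realType} n (i : 'I_n) (c : R) :
  lebesgue_rV n [set v : 'rV[R]_n | v ord0 i = c] = 0%E.
Proof.
pose A j : set R := if j == i then [set c] else setT.
rewrite (_ : [set _ | _] = [set v : 'rV[R]_n | forall j, A j (v ord0 j)]).
  rewrite lebesgue_rV_box => [|j]; last by rewrite /A; case: ifP.
  by rewrite (bigD1 i)//= /A eqxx lebesgue_measure_set1 mul0e.
apply/seteqP; split => v /= vi => [j|].
  by rewrite /A; case: ifPn => // /eqP ->.
by have := vi i; rewrite /A eqxx.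
Qed.

Lemma measurable_coord_lt {R : realType} n (i : 'I_n) (c : R) :
  measurable [set v : 'rV[R]_n | v ord0 i < c].
Proof.
rewrite (_ : [set _ | _] = (fun v : 'rV[R]_n => v ord0 i) @^-1` `]-oo, c[).
  by rewrite -[X in measurable X]setTI; exact: measurable_mx_entry.
by apply/seteqP; split => v /=; rewrite in_itv.
Qed.

Lemma measurable_coord_gt {R : realType} n (i : 'I_n) (c : R) :
  measurable [set v : 'rV[R]_n | c < v ord0 i].
Proof.
rewrite (_ : [set _ | _] = (fun v : 'rV[R]_n => v ord0 i) @^-1` `]c, +oo[).
  by rewrite -[X in measurable X]setTI; exact: measurable_mx_entry.
by apply/seteqP; split => v /=; rewrite in_itv /= andbT.
Qed.

Section positive_measure.
Context {d : measure_display} {T : measurableType d} {R : realType}.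
Variable mu : {measure set T -> \bar R}.

Lemma integral_gt0 (D B : set T) (f : T -> \bar R) :
  measurable D -> measurable B -> B `<=` D -> measurable_fun D f ->
  (forall x, D x -> (0 <= f x)%E) -> (forall x, B x -> (0 < f x)%E) ->
  (0 < mu B)%E -> (0 < \int[mu]_(x in D) f x)%E.
Proof.
move=> mD mB BD mf f0 fB muB; rewrite lt_neqAle integral_ge0// andbT.
apply/eqP => I0.
have : (\int[mu]_(x in D) `|f x| = 0)%E.
  by rewrite I0; apply: eq_integral => x; rewrite inE => /f0 /gee0_abs.
move=> /(ae_eq_integral_abs mu mD mf)[N [mN N0 DN]].
have : (mu B <= mu N)%E.
  apply: le_measure; rewrite ?inE//.
  by move=> x Bx; apply: DN => /= h; have := fB _ Bx; rewrite h ?ltxx//; exact: BD.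
by rewrite N0 leNgt muB.
Qed.

Let rational k : R := ratr (odflt 0 (choice.unpickle k : option rat)).

Let rational_between (x y : R) : x < y -> exists k, x < rational k < y.
Proof.
move=> xy; have [q] := rat_in_itvoo xy; rewrite in_itv /= => xqy.
by exists (choice.pickle q); rewrite /rational choice.pickleK.
Qed.

(** If every rational cut left a null side, the union of these sides [N k] would be null, and any
    two points of [E] outside it would have the same value of [phi]; then [E] would lie in a null
    set together with one fibre. Rational cuts keep the union countable. *)
Lemma split_positive (phi : T -> R) (E : set T) :
  measurable_fun setT phi -> measurable E ->
  (forall c, mu (phi @^-1` [set c]) = 0%E) -> (0 < mu E)%E ->
  exists k, (0 < mu (E `&` [set x | (phi x < rational k)%R]))%E /\
            (0 < mu (E `&` [set x | (rational k < phi x)%R]))%E.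
Proof.
move=> mphi mE fib muE; apply: contrapT => /forallNP bad.
have mlt k : measurable (E `&` [set x | phi x < rational k]).
  apply: measurableI => //.
  rewrite (_ : [set _ | _] = phi @^-1` `]-oo, rational k[).
    by rewrite -[X in measurable X]setTI; exact: mphi.
  by apply/seteqP; split => v /=; rewrite in_itv.
have mgt k : measurable (E `&` [set x | rational k < phi x]).
  apply: measurableI => //.
  rewrite (_ : [set _ | _] = phi @^-1` `]rational k, +oo[).
    by rewrite -[X in measurable X]setTI; exact: mphi.
  by apply/seteqP; split => v /=; rewrite in_itv /= andbT.
pose N k := if mu (E `&` [set x | phi x < rational k]) == 0%E
  then E `&` [set x | phi x < rational k] else E `&` [set x | rational k < phi x].
have mN k : measurable (N k) by rewrite /N; case: ifP.
have N0 k : mu (N k) = 0%E.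
  rewrite /N; case: ifPn => [/eqP //|h].
  apply/eqP; rewrite eq_le measure_ge0 andbT leNgt; apply/negP => h'.
  by apply: (bad k); split => //; rewrite lt_neqAle measure_ge0 andbT eq_sym.
have negN : mu.-negligible (\bigcup_k N k).
  by apply: negligible_bigcup => k; exact/(negligibleP mu (mN k))/N0.
have sep x y : E x -> E y -> phi x < phi y -> (\bigcup_k N k) x \/ (\bigcup_k N k) y.
  move=> Ex Ey /rational_between[k /andP[xk ky]].
  have [h|h] := eqVneq (mu (E `&` [set x | phi x < rational k])) 0%E.
    by left; exists k => //; rewrite /N h eqxx.
  by right; exists k => //; rewrite /N (negbTE h).
have negE : mu.-negligible E.
  have [[x [Ex Nx]]|h] := pselect (exists x, E x /\ ~ (\bigcup_k N k) x).
    have negf : mu.-negligible (phi @^-1` [set phi x]).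
      apply/negligibleP; last exact: fib.
      by rewrite -[X in measurable X]setTI; exact: mphi.
    apply: (negligibleS _ (negligibleU negN negf)) => y Ey.
    have [xy|xy|xy] := ltgtP (phi x) (phi y).
    - by have [|?] := sep _ _ Ex Ey xy => //; left.
    - by have [?|] := sep _ _ Ey Ex xy => //; left.
    - by right.
  apply: (negligibleS _ negN) => y Ey; apply: contrapT => Ny.
  by apply: h; exists y.
by move: muE; rewrite (negligibleP mu mE).1// ltxx.
Qed.

End positive_measure.

Section quadrants.
Context {d1 d2 : measure_display} {T1 : measurableType d1}
  {T2 : measurableType d2} {R : realType}.
Variables (m1 : {sigma_finite_measure set T1 -> \bar R})
  (m2 : {sigma_finite_measure set T2 -> \bar R}).
Variables (phi1 : T1 -> R) (phi2 : T2 -> R).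
Hypothesis mphi1 : measurable_fun setT phi1.
Hypothesis mphi2 : measurable_fun setT phi2.
Hypothesis fib1 : forall c, m1 (phi1 @^-1` [set c]) = 0%E.
Hypothesis fib2 : forall c, m2 (phi2 @^-1` [set c]) = 0%E.

Lemma product_measure_gt0 (Q : set (T1 * T2)) (B : set T1) :
  measurable Q -> measurable B -> (0 < m1 B)%E ->
  (forall x, B x -> (0 < m2 (xsection Q x))%E) -> (0 < (m1 \x m2)%E Q)%E.
Proof.
move=> mQ mB B0 QB; rewrite /product_measure1.
apply: (@integral_gt0 _ _ _ m1 setT B) => //.
by have := @measurable_fun_xsection _ _ _ _ _ m2 _ mQ.
Qed.

(** Almost every section of positive measure is split by some rational [r]. There are countably many
    of them, so a single [r] splits the sections over a set [A r] of positive measure, and [A r] is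
    in turn split by [phi1] at some [c]. Integrating the sections over the two halves gives the four
    quadrants. *)
Lemma quadrants_positive (S : set (T1 * T2)) : measurable S ->
  (0 < (m1 \x m2)%E S)%E ->
  exists c r : R,
  [/\ (0 < (m1 \x m2) (S `&` [set x | (phi1 x.1 < c /\ phi2 x.2 < r)%R]))%E,
      (0 < (m1 \x m2) (S `&` [set x | (phi1 x.1 < c /\ r < phi2 x.2)%R]))%E,
      (0 < (m1 \x m2) (S `&` [set x | (c < phi1 x.1 /\ phi2 x.2 < r)%R]))%E &
      (0 < (m1 \x m2) (S `&` [set x | (c < phi1 x.1 /\ r < phi2 x.2)%R]))%E].
Proof.
move=> mS S0.
pose rational k : R := ratr (odflt 0 (choice.unpickle k : option rat)).
have mlt d (T : measurableType d) (phi : T -> R) c : measurable_fun setT phi ->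
    measurable [set x | phi x < c].
  move=> mphi; rewrite (_ : [set _ | _] = phi @^-1` `]-oo, c[).
    by rewrite -[X in measurable X]setTI; exact: mphi.
  by apply/seteqP; split => v /=; rewrite in_itv.
have mgt d (T : measurableType d) (phi : T -> R) c : measurable_fun setT phi ->
    measurable [set x | c < phi x].
  move=> mphi; rewrite (_ : [set _ | _] = phi @^-1` `]c, +oo[).
    by rewrite -[X in measurable X]setTI; exact: mphi.
  by apply/seteqP; split => v /=; rewrite in_itv /= andbT.
have m1' : measurable_fun setT (fun x : T1 * T2 => phi1 x.1).
  exact: measurableT_comp.
have m2' : measurable_fun setT (fun x : T1 * T2 => phi2 x.2).
  exact: measurableT_comp.
pose Slt r := S `&` [set x | phi2 x.2 < r].
pose Sgt r := S `&` [set x | r < phi2 x.2].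
have mSlt r : measurable (Slt r) by apply: measurableI => //; exact: mlt.
have mSgt r : measurable (Sgt r) by apply: measurableI => //; exact: mgt.
pose A r := [set x | (0 < m2 (xsection (Slt r) x))%E] `&`
            [set x | (0 < m2 (xsection (Sgt r) x))%E].
have mpos (Q : set (T1 * T2)) : measurable Q -> measurable [set x | (0 < m2 (xsection Q x))%E].
  move=> mQ; rewrite -[X in measurable X]setTI.
  apply: emeasurable_fun_o_infty => //.
  by have := @measurable_fun_xsection _ _ _ _ _ m2 _ mQ.
have mA r : measurable (A r) by apply: measurableI; exact: mpos.
have [k Ak] : exists k, (0 < m1 (A (rational k)))%E.
  apply: contrapT => /forallNP noA.
  have A0 k : m1 (A (rational k)) = 0%E.
    apply/eqP; rewrite eq_le measure_ge0 andbT leNgt; apply/negP; exact: noA.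
  have negA : m1.-negligible (\bigcup_k A (rational k)).
    by apply: negligible_bigcup => k; exact/(negligibleP m1 (mA _))/A0.
  move: S0; rewrite /product_measure1 (_ : (\int[m1]_x _)%E = 0%E) ?ltxx//.
  transitivity (\int[m1]_x cst 0%E x)%E; last exact: integral0.
  apply: ae_eq_integral => //.
    by have := @measurable_fun_xsection _ _ _ _ _ m2 _ mS.
  apply: negligibleS negA => x /= /not_implyP[_ /eqP xS].
  have {}xS : (0 < m2 (xsection S x))%E by rewrite lt_neqAle measure_ge0 andbT eq_sym.
  have [k [h1 h2]] := split_positive mphi2 (measurable_xsection x mS) fib2 xS.
  exists k => //; split => /=.
    rewrite (_ : xsection _ _ = xsection S x `&` [set x | phi2 x < rational k])//.
    by apply/seteqP; split => y; rewrite /xsection /= !inE.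
  rewrite (_ : xsection _ _ = xsection S x `&` [set x | rational k < phi2 x])//.
  by apply/seteqP; split => y; rewrite /xsection /= !inE.
have [l [h1 h2]] := split_positive mphi1 (mA _) fib1 Ak.
set c := ratr _ in h1 h2; set r := rational k in h1 h2.
have xsQ (Q B : set (T1 * T2)) x : xsection B x = xsection Q x ->
    (0 < m2 (xsection Q x))%E -> (0 < m2 (xsection B x))%E by move=> ->.
exists c, r; split.
- apply: product_measure_gt0 h1 _.
  + by apply: measurableI => //; apply: measurableI; [exact: mlt|exact: mlt].
  + by apply: measurableI => //; exact: mlt.
  + move=> x [[Ax _] /= xc]; apply: xsQ Ax.
    by apply/seteqP; split => y; rewrite /xsection /= !inE => -[? /=]; [case|].
- apply: product_measure_gt0 h1 _.
  + by apply: measurableI => //; apply: measurableI; [exact: mlt|exact: mgt].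
  + by apply: measurableI => //; exact: mlt.
  + move=> x [[_ Ax] /= xc]; apply: xsQ Ax.
    by apply/seteqP; split => y; rewrite /xsection /= !inE => -[? /=]; [case|].
- apply: product_measure_gt0 h2 _.
  + by apply: measurableI => //; apply: measurableI; [exact: mgt|exact: mlt].
  + by apply: measurableI => //; exact: mgt.
  + move=> x [[Ax _] /= xc]; apply: xsQ Ax.
    by apply/seteqP; split => y; rewrite /xsection /= !inE => -[? /=]; [case|].
- apply: product_measure_gt0 h2 _.
  + by apply: measurableI => //; apply: measurableI; [exact: mgt|exact: mgt].
  + by apply: measurableI => //; exact: mgt.
  + move=> x [[_ Ax] /= xc]; apply: xsQ Ax.
    by apply/seteqP; split => y; rewrite /xsection /= !inE => -[? /=]; [case|].
Qed.

End quadrants.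

Lemma lebesgue_rV2_quadrants {R : realType} (S : set 'rV[R]_2) :
  measurable S -> (0 < lebesgue_rV 2 S)%E ->
  exists c r : R,
  [/\ (0 < lebesgue_rV 2 (S `&` [set v | (v 0 0 < c /\ v 0 1 < r)%R]))%E,
      (0 < lebesgue_rV 2 (S `&` [set v | (v 0 0 < c /\ r < v 0 1)%R]))%E,
      (0 < lebesgue_rV 2 (S `&` [set v | (c < v 0 0 /\ v 0 1 < r)%R]))%E &
      (0 < lebesgue_rV 2 (S `&` [set v | (c < v 0 0 /\ r < v 0 1)%R]))%E].
Proof.
move=> mS S0.
pose L1 : {sigma_finite_measure set (measurableTypeR R) -> \bar R} :=
  lebesgue_measure.
pose S' := @cons_rV R 1 @^-1` S.
have mS' : measurable S'.
  by rewrite -[X in measurable X]setTI; apply: measurable_cons_rV.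
have mid : measurable_fun setT (fun x : measurableTypeR R => x : R) by [].
have fib1 c : L1 ((fun x : measurableTypeR R => x : R) @^-1` [set c]) = 0%E.
  exact: lebesgue_measure_set1.
have fib2 c : lebesgue_rV 1 ((fun v : 'rV[R]_1 => v ord0 ord0) @^-1` [set c]) = 0%E.
  exact: lebesgue_rV_hyperplane.
have [c [r [h1 h2 h3 h4]]] := quadrants_positive (m1 := L1) (m2 := lebesgue_rV 1)
  mid (@measurable_mx_entry _ _ _ _ ord0 ord0) fib1 fib2 mS' S0.
have E (Q : R -> R -> Prop) :
  lebesgue_rV 2 (S `&` [set v | Q (v 0 0) (v 0 1)]) =
  (L1 \x lebesgue_rV 1)%E (S' `&` [set x : measurableTypeR R * 'rV[R]_1 | Q x.1 (x.2 ord0 ord0)]).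
  rewrite /= /pushforward; congr (product_measure1 _ _ _).
  apply/seteqP; split => -[x v] /= [Sx].
    rewrite cons_rV0 (_ : 1 = lift ord0 ord0) ?cons_rVS//; exact/val_inj.
  move=> ?; split => //.
  rewrite cons_rV0 (_ : 1 = lift ord0 ord0) ?cons_rVS//; exact/val_inj.
have E' (Q : R -> R -> Prop) : (0 < (L1 \x lebesgue_rV 1) (S' `&`
      [set x : measurableTypeR R * 'rV[R]_1 | Q x.1 (x.2 ord0 ord0)]))%E ->
    (0 < lebesgue_rV 2 (S `&` [set v : 'rV[R]_2 | Q (v 0 0) (v 0 1)]%R))%E.
  by rewrite -E.
exists c, r; split.
- exact: (E' (fun x y => x < c /\ y < r) h1).
- exact: (E' (fun x y => x < c /\ r < y) h2).
- exact: (E' (fun x y => c < x /\ y < r) h3).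
- exact: (E' (fun x y => c < x /\ r < y) h4).
Qed.

Section pairs.
Context {R : realType}.
Notation L2 := (@lebesgue_rV R 2).
Variable q : 'rV[R]_2 -> R.
Hypothesis mq : measurable_fun setT q.
Hypothesis q0 : forall x, 0 <= q x.
Hypothesis q1 : (\int[L2]_x (q x)%:E = 1)%E.

Let F (x : 'rV[R]_2 * 'rV[R]_2) := q x.1 * q x.2.

Let F0 x : 0 <= F x. Proof. exact: mulr_ge0. Qed.

Let mF : measurable_fun setT F.
Proof. by apply: measurable_funM; exact: measurableT_comp. Qed.

Let F1 : (\int[L2 \x L2]_x (F x)%:E = 1)%E.
Proof.
rewrite fubini_tonelli1//; last exact: measurable_EFin.
rewrite -[RHS]q1; apply: eq_integral => x _; rewrite /fubini_F /F /=.
by rewrite ge0_integral_EFinZl// q1 mule1.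
Qed.

Let iF : (L2 \x L2)%E.-integrable setT (EFin \o F).
Proof.
apply/integrableP; split; first exact: measurable_EFin.
under eq_integral do rewrite /= ger0_norm//.
by rewrite F1 ltry.
Qed.

Definition pair_prob (E : set ('rV[R]_2 * 'rV[R]_2)) : R :=
  \int[(L2 \x L2)%E]_(x in E) (q x.1 * q x.2).

Let pair_probE E : pair_prob E = \int[(L2 \x L2)%E]_x (F \_ E) x.
Proof. by rewrite /pair_prob Rintegral_mkcond. Qed.

Let iFE E : measurable E -> (L2 \x L2)%E.-integrable setT (EFin \o (F \_ E)).
Proof.
move=> mE; rewrite -restrict_EFin; apply/(integrable_mkcond _ mE).
by apply: integrableS iF.
Qed.

Lemma measurable_concordance :
  measurable_fun setT (fun x : 'rV[R]_2 * 'rV[R]_2 => concordance x.1 x.2).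
Proof.
apply: measurable_funM; apply: measurable_funB;
  by apply: (measurableT_comp (measurable_mx_entry _ _)).
Qed.

Lemma pair_probT : pair_prob setT = 1.
Proof. by rewrite /pair_prob /Rintegral F1. Qed.

Lemma pair_prob_swap E : measurable E ->
  pair_prob [set x | E (x.2, x.1)] = pair_prob E.
Proof.
move=> mE; rewrite !pair_probE /Rintegral; congr fine.
have mFE : measurable_fun setT (fun x => ((F \_ E) x)%:E).
  by have /integrableP[] := iFE mE.
have FE0 x : (0 <= ((F \_ E) x)%:E)%E.
  by rewrite lee_fin patchE; case: ifP.
have sw x : (F \_ [set x | E (x.2, x.1)]) x = (F \_ E) (x.2, x.1).
  rewrite !patchE (_ : (x \in _) = ((x.2, x.1) \in E)).
    by rewrite /F /= mulrC.
  by apply/idP/idP; rewrite !inE.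
rewrite [RHS]fubini_tonelli2// [LHS]fubini_tonelli1.
- apply: eq_integral => x _; apply: eq_integral => y _; congr EFin.
  by rewrite sw.
- rewrite (_ : (fun _ => _) = (fun x => ((F \_ E) x)%:E) \o
      (fun x => (x.2, x.1))); last by apply/funext => -[x y] /=; rewrite sw.
  by apply: (measurableT_comp mFE); exact: measurable_fun_pair.
- by move=> x; rewrite lee_fin patchE; case: ifP.
Qed.


Let pair_probU A B : measurable A -> measurable B -> A `&` B = set0 ->
  pair_prob (A `|` B) = pair_prob A + pair_prob B.
Proof.
move=> mA mB AB; rewrite !pair_probE -RintegralD//; [|exact: iFE|exact: iFE].
apply: eq_Rintegral => x _; rewrite !patchE !in_setU.
case: (boolP (x \in A)) => xA /=; last by rewrite add0r.
case: (boolP (x \in B)) => xB /=; last by rewrite addr0.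
have : (A `&` B) x by split; rewrite -inE.
by rewrite AB.
Qed.

Let conc := [set x : 'rV[R]_2 * 'rV[R]_2 | 0 < concordance x.1 x.2].
Let disc := [set x : 'rV[R]_2 * 'rV[R]_2 | concordance x.1 x.2 < 0].

Let mconc : measurable conc.
Proof.
rewrite (_ : conc = (fun x : 'rV[R]_2 * 'rV[R]_2 => concordance x.1 x.2) @^-1` `]0, +oo[).
  by rewrite -[X in measurable X]setTI; apply: measurable_concordance.
by apply/seteqP; split => x; rewrite /conc /= in_itv /= andbT.
Qed.

Let mdisc : measurable disc.
Proof.
rewrite (_ : disc = (fun x : 'rV[R]_2 * 'rV[R]_2 => concordance x.1 x.2) @^-1` `]-oo, 0[).
  by rewrite -[X in measurable X]setTI; apply: measurable_concordance.
by apply/seteqP; split => x; rewrite /disc /= in_itv.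
Qed.

Let coord_lt (i : 'I_2) := [set x : 'rV[R]_2 * 'rV[R]_2 | x.1 0 i < x.2 0 i].
Let coord_gt (i : 'I_2) := [set x : 'rV[R]_2 * 'rV[R]_2 | x.2 0 i < x.1 0 i].

Let mcoord1 (i : 'I_2) :
  measurable_fun setT (fun x : 'rV[R]_2 * 'rV[R]_2 => x.1 0 i).
Proof. by apply: (measurableT_comp (measurable_mx_entry _ _)). Qed.

Let mcoord2 (i : 'I_2) :
  measurable_fun setT (fun x : 'rV[R]_2 * 'rV[R]_2 => x.2 0 i).
Proof. by apply: (measurableT_comp (measurable_mx_entry _ _)). Qed.

Let mcoord_lt i : measurable (coord_lt i).
Proof.
rewrite (_ : coord_lt i = (fun x : 'rV[R]_2 * 'rV[R]_2 => x.1 0 i < x.2 0 i) @^-1` [set true]).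
  by rewrite -[X in measurable X]setTI; apply: measurable_fun_ltr.
by apply/seteqP; split => x.
Qed.

Let mcoord_gt i : measurable (coord_gt i).
Proof.
rewrite (_ : coord_gt i = (fun x : 'rV[R]_2 * 'rV[R]_2 => x.2 0 i < x.1 0 i) @^-1` [set true]).
  by rewrite -[X in measurable X]setTI; apply: measurable_fun_ltr.
by apply/seteqP; split => x.
Qed.

Let ties := ~` conc `&` ~` disc.

Let mties : measurable ties.
Proof. by apply: measurableI; exact: measurableC. Qed.

(** A tie forces equality in one coordinate, and every section of that event is a hyperplane. *)
Let ties0 : pair_prob ties = 0.
Proof.
have tie_null (i : 'I_2) : (L2 \x L2)%E (~` coord_lt i `&` ~` coord_gt i) = 0%E.
  rewrite /product_measure1 -[RHS](integral0 L2 setT).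
  apply: eq_integral => x _.
  suff E : xsection (~` coord_lt i `&` ~` coord_gt i) x =
      [set v : 'rV[R]_2 | v ord0 i = x ord0 i].
    by rewrite [LHS]/= E; exact: lebesgue_rV_hyperplane.
  apply/seteqP; split => v; rewrite /xsection /= inE.
    move=> -[/negP h1 /negP h2]; apply/eqP; rewrite eq_le.
    by move: h1 h2; rewrite /= -!leNgt => -> ->.
  by move=> /= h; split; apply/negP; rewrite /coord_lt /coord_gt /= (h : v 0 i = x 0 i) ltxx.
have mt i : measurable (~` coord_lt i `&` ~` coord_gt i).
  by apply: measurableI; exact: measurableC.
have ties_null : (L2 \x L2)%E ties = 0%E.
  apply/(negligibleP (L2 \x L2)%E mties).
  apply: (negligibleS _ (negligibleU
    ((negligibleP (L2 \x L2)%E (mt 0)).2 (tie_null 0))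
    ((negligibleP (L2 \x L2)%E (mt 1)).2 (tie_null 1)))).
  move=> x [/negP h1 /negP h2].
  have /eqP : concordance x.1 x.2 = 0.
    by apply/eqP; rewrite eq_le; move: h1 h2; rewrite /conc /disc /= -!leNgt => -> ->.
  by rewrite mulf_eq0 !subr_eq0 => /orP[]/eqP h; [left|right];
    split; apply/negP; rewrite /coord_lt /coord_gt /= h ltxx.
rewrite /pair_prob /Rintegral (_ : (\int[_]_(_ in _) _)%E = 0%E)//.
by rewrite null_set_integral//; apply: measurable_funTS; exact: measurable_EFin.
Qed.

Lemma pair_prob_conc_disc : pair_prob conc + pair_prob disc = 1.
Proof.
have cd0 : conc `&` disc = set0.
  by apply/seteqP; split => // x [/= h1 h2]; have := lt_trans h1 h2; rewrite ltxx.
rewrite -pair_probU// -pair_probT -[LHS]addr0 -ties0 -pair_probU//.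
- congr pair_prob; apply/seteqP; split => // x _.
  have [?|nc] := pselect (conc x); first by left; left.
  by have [?|nd] := pselect (disc x); [left; right|right; split].
- exact: measurableU.
- by apply/seteqP; split => // x [[c [nc nd]|c [nc nd]]].
Qed.

(** Swapping the two members of the pair exchanges the two orders in which it can be concordant. *)
Lemma pair_prob_conc :
  pair_prob conc = 2 * pair_prob (coord_lt 0 `&` coord_lt 1).
Proof.
have mA : measurable (coord_lt 0 `&` coord_lt 1) by exact: measurableI.
have mB : measurable (coord_gt 0 `&` coord_gt 1) by exact: measurableI.
rewrite mulr_natl mulr2n -[X in X + _]pair_prob_swap// -pair_probU//.
- congr pair_prob; apply/seteqP; split => x; rewrite /conc /concordance /=.
    have [h|h|->] := ltgtP (x.1 0 0) (x.2 0 0); last by rewrite subrr mul0r ltxx.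
      by rewrite nmulr_rgt0 subr_lt0// => h'; right; split.
    by rewrite pmulr_rgt0 subr_gt0// => h'; left; split.
  move=> [[h h']|[h h']]; first by rewrite mulr_gt0// subr_gt0.
  by rewrite -mulrNN mulr_gt0// opprB subr_gt0.
- by apply/seteqP; split => // x [[h _] [h' _]]; have := lt_trans h h'; rewrite ltxx.
Qed.

Lemma pair_prob_disc :
  pair_prob disc = 2 * pair_prob (coord_lt 0 `&` coord_gt 1).
Proof.
have mA : measurable (coord_lt 0 `&` coord_gt 1) by exact: measurableI.
have mB : measurable (coord_gt 0 `&` coord_lt 1) by exact: measurableI.
rewrite mulr_natl mulr2n -[X in X + _]pair_prob_swap// -pair_probU//.
- congr pair_prob; apply/seteqP; split => x; rewrite /disc /concordance /=.
    have [h|h|->] := ltgtP (x.1 0 0) (x.2 0 0); last by rewrite subrr mul0r ltxx.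
      by rewrite nmulr_rlt0 ?subr_lt0// subr_gt0 => h'; right; split.
    by rewrite pmulr_rlt0 ?subr_gt0// subr_lt0 => h'; left; split.
  move=> [[h h']|[h h']].
    by rewrite pmulr_rlt0 ?subr_gt0// subr_lt0.
  by rewrite nmulr_rlt0 ?subr_lt0// subr_gt0.
- by apply/seteqP; split => // x [[h _] [h' _]]; have := lt_trans h h'; rewrite ltxx.
Qed.

(** The three functions differ pointwise and agree only in the mean. Each of the concordance and
    discordance probabilities is twice that of one order, and they add up to 1; thus [4 P(<,<) - 1 =
    2 P(conc) - 1 = P(conc) - P(disc)], and likewise for [g3] with [P(disc)]. *)
Lemma integral_g_choice (g : 'rV[R]_2 -> 'rV[R]_2 -> R) :
  g = @g1 R \/ g = @g2 R \/ g = @g3 R ->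
  \int[(L2 \x L2)%E]_x (g x.1 x.2 * (q x.1 * q x.2)) =
  pair_prob conc - pair_prob disc.
Proof.
have J1 : \int[(L2 \x L2)%E]_x F x = 1 by exact: pair_probT.
have S := pair_prob_conc_disc.
have mlt01 : measurable (coord_lt 0 `&` coord_lt 1) by exact: measurableI.
have mlg01 : measurable (coord_lt 0 `&` coord_gt 1) by exact: measurableI.
(* A restriction [F \_ E] takes the value [point] off [E], which is 0 for reals. *)
have pt : point = 0 :> R by [].
have memlt x : (x \in coord_lt 0 `&` coord_lt 1) =
    (x.1 0 0 < x.2 0 0) && (x.1 0 1 < x.2 0 1).
  by apply/idP/andP; rewrite inE.
have memlg x : (x \in coord_lt 0 `&` coord_gt 1) =
    (x.1 0 0 < x.2 0 0) && (x.2 0 1 < x.1 0 1).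
  by apply/idP/andP; rewrite inE.
have memc x : (x \in conc) = (0 < concordance x.1 x.2).
  by apply/idP/idP; rewrite inE.
have memd x : (x \in disc) = (concordance x.1 x.2 < 0).
  by apply/idP/idP; rewrite inE.
case=> [->|[->|->]].
- transitivity (4 * pair_prob (coord_lt 0 `&` coord_lt 1) - 1).
    rewrite -[X in _ - X]J1 pair_probE -RintegralZl//; last exact: iFE.
    rewrite -RintegralB//; last exact/integrable_EFinZl/iFE.
    apply: eq_Rintegral => x _; rewrite patchE /g1 -/(F x).
    by rewrite memlt pt; case: (_ && _) => /=; ring.
  by have := pair_prob_conc; lra.
- rewrite !pair_probE -RintegralB//; [|exact: iFE|exact: iFE].
  apply: eq_Rintegral => x _; rewrite !patchE /g2 -/(F x) memc memd pt.
  by case: (0 < _); case: (_ < 0) => /=; ring.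
- transitivity (1 - 4 * pair_prob (coord_lt 0 `&` coord_gt 1)).
    rewrite -[X in X - _]J1 pair_probE -RintegralZl//; last exact: iFE.
    rewrite -RintegralB//; last exact/integrable_EFinZl/iFE.
    apply: eq_Rintegral => x _; rewrite patchE /g3 -/(F x).
    by rewrite memlg pt; case: (_ && _) => /=; ring.
  by have := pair_prob_disc; lra.
Qed.

Let pair_prob_gt0 (A B : set 'rV[R]_2) E : measurable A -> measurable B ->
  measurable E -> (forall a b, A a -> B b -> E (a, b)) ->
  (0 < L2 (A `&` [set x | (0 < q x)%R]))%E ->
  (0 < L2 (B `&` [set x | (0 < q x)%R]))%E ->
  0 < pair_prob E.
Proof.
move=> mA mB mE ABE A0 B0.
have mpos : measurable [set x | 0 < q x].
  rewrite (_ : [set _ | _] = q @^-1` `]0, +oo[).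
    by rewrite -[X in measurable X]setTI; exact: mq.
  by apply/seteqP; split => x; rewrite /= in_itv /= andbT.
have mA' := measurableI _ _ mA mpos; have mB' := measurableI _ _ mB mpos.
have AB0 : (0 < (L2 \x L2) ((A `&` [set x | 0 < q x]%R) `*` (B `&` [set x | 0 < q x]%R)))%E.
  by rewrite product_measure1E; [exact: mule_gt0 A0 B0|exact: mA'|exact: mB'].
have : (0 < \int[L2 \x L2]_(x in E) (F x)%:E)%E.
  apply: (integral_gt0 (B := (A `&` [set x | 0 < q x]) `*` (B `&` [set x | 0 < q x]))) => //.
  - by apply: measurableX; exact: measurableI.
  - by move=> [a b] /= [[Aa _] [Bb _]]; exact: ABE.
  - by apply: measurable_funTS; exact: measurable_EFin.
  - by move=> x _; rewrite lee_fin.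
  - by move=> [a b] /= [[_ ?] [_ ?]]; rewrite lte_fin mulr_gt0.
have : (\int[L2 \x L2]_(x in E) (F x)%:E < +oo)%E.
  by apply: integrable_lty => //; apply: integrableS iF.
by rewrite /pair_prob /Rintegral; case: (integral _ _ _) => //= r _; rewrite lte_fin.
Qed.

(* A density on the plane charges all four quadrants at some point, so it is
   neither comonotone nor countermonotone. *)
Lemma pair_prob_conc_disc_gt0 : 0 < pair_prob conc /\ 0 < pair_prob disc.
Proof.
have mpos : measurable [set x | 0 < q x].
  rewrite (_ : [set _ | _] = q @^-1` `]0, +oo[).
    by rewrite -[X in measurable X]setTI; exact: mq.
  by apply/seteqP; split => x; rewrite /= in_itv /= andbT.
have S0 : (0 < L2 [set x | (0 < q x)%R])%E.
  rewrite lt_neqAle measure_ge0 andbT eq_sym; apply/eqP => S0.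
  suff : (\int[L2]_x (q x)%:E = 0)%E by rewrite q1 => /eqP; rewrite eqe oner_eq0.
  transitivity (\int[L2]_x cst 0%E x)%E; last exact: integral0.
  apply: ae_eq_integral => //; first exact: measurable_EFin.
  apply: (negligibleS _ ((negligibleP L2 mpos).2 S0)) => x /= /not_implyP[_ qx].
  by rewrite lt_neqAle q0 andbT eq_sym; apply/eqP => h; apply: qx; rewrite h.
have [c [r [h1 h2 h3 h4]]] := lebesgue_rV2_quadrants mpos S0.
have mQ (a b : bool) : measurable [set v : 'rV[R]_2 |
    (if a then v 0 0 < c else c < v 0 0) /\ (if b then v 0 1 < r else r < v 0 1)].
  by apply: measurableI; [case: a|case: b];
    by [exact: measurable_coord_lt|exact: measurable_coord_gt].
rewrite setIC in h1; rewrite setIC in h2; rewrite setIC in h3; rewrite setIC in h4.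
split.
- apply: (pair_prob_gt0 (mQ true true) (mQ false false) mconc _ h1 h4).
  move=> a b [ac ar] [cb rb]; rewrite /conc /= /concordance -mulrNN !opprB.
  by rewrite mulr_gt0// subr_gt0 (lt_trans ac, lt_trans ar).
- apply: (pair_prob_gt0 (mQ true false) (mQ false true) mdisc _ h2 h3).
  move=> a b [ac ar] [cb rb]; rewrite /disc /= /concordance.
  by rewrite nmulr_rlt0 ?subr_lt0 ?subr_gt0; [apply: lt_trans ar|apply: lt_trans cb].
Qed.

End pairs.

(** * A crude Taylor bound *)

Lemma big_tuple_cons {R : nmodType} (I : finType) n (F : seq I -> R) :
  \sum_(t : n.+1.-tuple I) F t = \sum_(i : I) \sum_(s : n.-tuple I) F (i :: s).
Proof.
rewrite pair_big /=.
rewrite (reindex (fun p : I * n.-tuple I => [tuple of p.1 :: p.2])) //=.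
exists (fun t => (thead t, [tuple of behead t])) => [[i s] _|t _] /=.
  by rewrite theadE; congr (_, _); exact/val_inj.
by rewrite [RHS]tuple_eta; exact/val_inj.
Qed.

Lemma big_tuple0 {R : nmodType} (I : finType) (F : seq I -> R) :
  \sum_(t : 0.-tuple I) F t = F [::].
Proof.
by rewrite (big_pred1 [tuple])// => t /=; apply/esym/eqP; exact: tuple0.
Qed.

Section taylor.
Context {R : realType}.

(** [phi j] plays the j-th derivative. One use of the mean value theorem per order gives Taylor's
    bound with the factorials dropped. *)
Lemma taylor_bound1 n (phi : nat -> R -> R) (B h : R) :
  (forall j (t : R), (j < n)%N -> is_derive t (1 : R) (phi j) (phi j.+1 t)) ->
  (forall t, 0 <= t <= h -> `|phi n t| <= B) -> 0 <= h ->
  `|phi 0%N h| <= \sum_(j < n) `|phi j 0| * h ^+ j + h ^+ n * B.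
Proof.
elim: n phi h => [|n IH] phi h dphi phiB h0.
  by rewrite big_ord0 add0r expr0 mul1r phiB// h0 lexx.
have B0 : 0 <= B by rewrite (le_trans _ (phiB 0 _))// lexx.
pose C := \sum_(j < n) `|phi j.+1 0| * h ^+ j + h ^+ n * B.
have C0 : 0 <= C.
  by rewrite addr_ge0 ?mulr_ge0 ?exprn_ge0// sumr_ge0// => j _; rewrite mulr_ge0// exprn_ge0.
have phi1 t : 0 <= t <= h -> `|phi 1%N t| <= C.
  move=> /andP[t0 th].
  have : `|phi 1%N t| <= \sum_(j < n) `|phi j.+1 0| * t ^+ j + t ^+ n * B.
    apply: (IH (fun j => phi j.+1)) => // [j s jn|s /andP[s0 st]]; first exact: dphi.
    by apply: phiB; rewrite s0 (le_trans st).
  move=> /le_trans; apply; rewrite /C; apply: lerD.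
    by apply: ler_sum => j _; rewrite ler_wpM2l// lerXn2r// nnegrE.
  by rewrite ler_wpM2r// lerXn2r// nnegrE.
have [|c] := @MVT_segment _ (phi 0%N) (phi 1%N) 0 h h0 (fun t _ => dphi 0%N t isT).
  apply: derivable_within_continuous => t _.
  by have [] := dphi 0%N t isT.
rewrite in_itv /= subr0 => c0h phiE.
have : `|phi 0%N h| <= `|phi 0%N 0| + h * C.
  rewrite -[phi 0%N h](subrK (phi 0%N 0)) addrC (le_trans (ler_normD _ _))// lerD2l.
  by rewrite phiE normrM (ger0_norm h0) mulrC ler_wpM2l// phi1.
move=> /le_trans; apply; rewrite big_ord_recl expr0 mulr1 -addrA lerD2l.
rewrite mulrDr exprS mulrA lerD2r mulr_sumr; apply: ler_sum => j _.
by rewrite exprS mulrCA.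
Qed.

End taylor.

Section multivariate_taylor.
Context {R : realType} {p : nat}.
Implicit Types (f : 'rV[R]_p -> R) (z u : 'rV[R]_p).

Lemma times_differentiable_partials k f z (s : seq 'I_p) :
  times_differentiable k f z -> (size s < k)%N -> differentiable (partials s f) z.
Proof.
elim: k z => // k IH z [near_z diff_z]; rewrite ltnS leq_eqVlt => /predU1P[sk|sk].
  by have := diff_z (Tuple (introT eqP sk)).
by apply: IH => //; exact: nbhs_singleton near_z.
Qed.

Lemma is_derive_line f z u (t : R) : differentiable f (z + t *: u) ->
  is_derive t (1 : R) (fun t : R => f (z + t *: u)) ('D_u f (z + t *: u)).
Proof.
move=> df.
have E : (fun h : R => h^-1 *: ((f \o shift (z + t *: u)) (h *: u) - f (z + t *: u))) =
  (fun h : R => h^-1 *: (((fun t : R => f (z + t *: u)) \o shift t) (h *: (1 : R)) -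
     f (z + t *: u))).
  apply/funext => h /=; congr (_ *: (f _ - _)).
  by rewrite [h%:A]mulr1 scalerDl addrCA.
have dfu : derivable f (z + t *: u) u by exact: diff_derivable.
apply: DeriveDef; first by rewrite /derivable -E.
by rewrite /derive -E.
Qed.

Lemma derive_partials f z u : differentiable f z ->
  'D_u f z = \sum_i u 0 i * 'D_(delta_mx 0 i) f z.
Proof.
move=> df; rewrite deriveE// [in LHS](row_sum_delta u) linear_sum.
by apply: eq_bigr => i _; rewrite linearZ /= -deriveE.
Qed.

(** The j-th derivative of [t -> f (z + t u)] is a sum over all index tuples, so no multinomial
    coefficients occur. Lower powers of [h] are bounded by 1; only the remainder must keep its own,
    which makes it vanish with [h]. *)
Lemma taylor_bound f z u h alpha B :
  (forall y, times_differentiable alpha f y) ->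
  (forall t, 0 <= t <= h ->
    `|\sum_(iota : alpha.-tuple 'I_p) monomial iota u * partials iota f (z + t *: u)|
      <= B) ->
  0 <= h <= 1 ->
  `|f (z + h *: u)| <=
  \sum_(j < alpha) \sum_(iota : j.-tuple 'I_p) `|partials iota f z| * `|monomial iota u| +
  h ^+ alpha * B.
Proof.
move=> df fB /andP[h0 h1].
pose phi j t := \sum_(iota : j.-tuple 'I_p) monomial iota u * partials iota f (z + t *: u).
have phi0 t : phi 0%N t = f (z + t *: u).
  by rewrite /phi (big_tuple0 (fun s => monomial s u * partials s f (z + t *: u))) /monomial big_nil mul1r.
have dphi j (t : R) : (j < alpha)%N -> is_derive t (1 : R) (phi j) (phi j.+1 t).
  move=> ja; rewrite /phi (big_tuple_cons _ (fun s => monomial s u * partials s f (z + t *: u))).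
  rewrite exchange_big /=.
  have -> : (fun t : R => \sum_(iota : j.-tuple 'I_p) monomial iota u * partials iota f (z + t *: u)) =
     \sum_(iota : j.-tuple 'I_p) (fun t : R => monomial iota u * partials iota f (z + t *: u)).
    by apply/funext => ?; rewrite fct_sumE.
  elim/big_ind2 : _ => [|x dx y dy hx hy|iota _]; [exact: is_derive_cst|exact: is_deriveD|].
  have dpi : differentiable (partials iota f) (z + t *: u).
    by apply: times_differentiable_partials (df _) _; rewrite size_tuple.
  have -> : \sum_i monomial (i :: iota) u * partials (i :: iota) f (z + t *: u) =
      monomial iota u *: 'D_u (partials iota f) (z + t *: u).
    rewrite derive_partials// scaler_sumr; apply: eq_bigr => i _ /=.
    by rewrite /monomial big_cons /GRing.scale /= mulrCA mulrA.
  have := is_derive_line dpi; exact: is_deriveZ.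
rewrite -phi0 (le_trans (taylor_bound1 dphi fB h0))// lerD2r.
apply: ler_sum => j _; rewrite (@le_trans _ _ `|phi j 0|)//.
  by rewrite ler_piMr// exprn_ile1.
rewrite /phi (le_trans (ler_norm_sum _ _ _))//; apply: ler_sum => iota _.
by rewrite normrM mulrC scale0r addr0.
Qed.

End multivariate_taylor.

(** * Kernels as approximate identities *)

Section nonmeasurable_integral.
Context {d : measure_display} {T : measurableType d} {R : realType}.
Variable mu : {measure set T -> \bar R}.

(* [integral] is a lower integral, hence monotone on non-measurable functions. *)
Lemma ge0_le_integral_nonmeasurable (f1 f2 : T -> \bar R) :
  (forall x, (0 <= f1 x)%E) -> (forall x, (f1 x <= f2 x)%E) ->
  (\int[mu]_x f1 x <= \int[mu]_x f2 x)%E.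
Proof.
move=> f10 f12.
have f20 x : (0 <= f2 x)%E by rewrite (le_trans (f10 x)).
rewrite !ge0_integralTE//; apply: le_ereal_sup => _ [h /= hf1 <-].
by exists h => // x; exact: le_trans (hf1 x) _.
Qed.

End nonmeasurable_integral.

Lemma measurable_normr_gt {R : realType} n (M : R) : 0 <= M ->
  measurable [set u : 'rV[R]_n | M < `|u|].
Proof.
move=> M0; rewrite (_ : [set _ | _] =
  \bigcup_(i in [set: 'I_n]) ((fun u : 'rV[R]_n => `|u ord0 i|) @^-1` `]M, +oo[)).
  apply: fin_bigcup_measurable => // i _; rewrite -[X in measurable X]setTI.
  have mc : measurable_fun setT (fun u : 'rV[R]_n => `|u ord0 i|).
    by apply: measurableT_comp => //; exact: measurable_mx_entry.
  exact: mc.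
apply/seteqP; split => u /=; last first.
  by move=> [i _]; rewrite /= in_itv /= andbT => /lt_le_trans; apply; exact: normr_entry_le.
move=> Mu; apply: contrapT => h.
have : `|u| <= M.
  apply: mx_normr_le => // i j; rewrite (ord1 i) leNgt; apply/negP => h'.
  by apply: h; exists j => //=; rewrite in_itv /= andbT.
by rewrite leNgt Mu.
Qed.

Lemma tail_integral_small {R : realType} n (mu : {measure set 'rV[R]_n -> \bar R})
    (W : 'rV[R]_n -> R) (eps : R) :
  mu.-integrable setT (EFin \o W) -> (forall u, 0 <= W u) -> 0 < eps ->
  exists2 M : R, 0 <= M &
    (\int[mu]_u ((W \_ [set u | (M < `|u|)%R]) u)%:E <= eps%:E)%E.
Proof.
move=> iW W0 eps0.
have mW : measurable_fun setT W by have /integrableP[/measurable_EFinP] := iW.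
have mWn k : measurable_fun setT (W \_ [set u : 'rV[R]_n | k%:R < `|u|]).
  apply/(measurable_restrictT _ (@measurable_normr_gt R n k%:R _)) => //.
  exact: measurable_funTS.
have [|||||_ _] := @dominated_convergence _ _ _ mu setT measurableT
  (fun k u => ((W \_ [set u | k%:R < `|u|]) u)%:E) (cst 0%E) (EFin \o W).
- by move=> k; exact: measurable_EFin.
- exact: measurable_cst.
- apply: nearW => u _; apply: cvg_near_cst.
  near=> k; rewrite patchE ifF//; apply/negP; rewrite inE /=; apply/negP.
  by rewrite -leNgt; near: k; exact: nbhs_infty_ger.
- exact: iW.
- apply: nearW => u k _ /=; rewrite lee_fin patchE; case: ifP => _.
    by rewrite ger0_norm.
  by rewrite normr0.
rewrite integral0 => /fine_cvgP[Hfin /cvgrPdist_lt/(_ _ eps0) Hlt].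
have [N1 _ hN1] := Hfin; have [N2 _ hN2] := Hlt.
pose k := maxn N1 N2.
have kfin := hN1 k (leq_maxl _ _); have klt := hN2 k (leq_maxr _ _).
exists k%:R => //.
move: klt; rewrite /= sub0r normrN => klt.
by rewrite -[X in (X <= _)%E](fineK kfin) lee_fin (le_trans (ler_norm _))// ltW.
Unshelve. all: by end_near. Qed.

Lemma continuous_bounded_on_compact {R : realType} (T : topologicalType)
    (Z : set T) (g : T -> R) : compact Z -> continuous g ->
  exists D : R, forall z, Z z -> `|g z| <= D.
Proof.
move=> cZ cg.
have : compact (g @` Z) by apply: continuous_compact => //; exact: continuous_subspaceT.
move=> /compact_bounded[D [_ hD]]; exists (D + 1) => z Zz.
by apply: (hD (D + 1)); [rewrite ltrDl|exists z].
Qed.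

Section approximate_identity.
Context {R : realType} {p : nat}.
Variables (f : 'rV[R]_2 * 'rV[R]_p -> R) (K : 'rV[R]_p -> R) (alpha : nat)
  (Z : set 'rV[R]_p).
Notation L2 := (@lebesgue_rV R 2).
Notation Lp := (@lebesgue_rV R p).
Notation fZ := (marginal_density f).
Hypothesis mf : measurable_fun setT f.
Hypothesis f0 : forall x, 0 <= f x.
Hypothesis f1 : (\int[L2 \x Lp]_x (f x)%:E = 1)%E.
Hypothesis cZ : compact Z.
Hypothesis A1 : kernel_of_order alpha K.
Hypothesis A2 : smooth_marginal alpha K Z f.
Hypothesis A3 : bounded_marginal Z f.
Hypothesis alpha_gt1 : (1 < alpha)%N.
Hypothesis cf : forall z, Z z ->
  {ae L2, forall x, {for z, continuous (fun y => f (x, y))}}.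

Let F (y : 'rV[R]_p) (x : 'rV[R]_2) := f (x, y).

Let mF y : measurable_fun setT (F y).
Proof. by apply: (measurableT_comp mf); exact: measurable_fun_pair. Qed.

Let F0 y x : 0 <= F y x. Proof. exact: f0. Qed.

Let Finf y := (\int[L2]_x (F y x)%:E)%E.

Let mFinf : measurable_fun setT Finf.
Proof.
apply: (@measurable_fun_fubini_tonelli_G _ _ _ _ _ L2 (EFin \o f)) => //.
exact: measurable_EFin.
Qed.

Let Finf0 y : (0 <= Finf y)%E.
Proof. by apply: integral_ge0 => x _; rewrite lee_fin. Qed.

Let fZE y : fZ y = fine (Finf y). Proof. by []. Qed.

Lemma marginal_density_ge0 y : 0 <= fZ y.
Proof. by rewrite fZE fine_ge0. Qed.

Lemma measurable_marginal_density : measurable_fun setT fZ.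
Proof. exact: (measurableT_comp (fine_measurable measurableT) mFinf). Qed.

(** [fZ] is 0 wherever the slice integral is infinite; total mass 1 makes these points a null
    set. *)
Lemma ae_marginal_density : {ae Lp, forall y, (Finf y = (fZ y)%:E)%E}.
Proof.
have iFinf : Lp.-integrable setT Finf.
  apply/integrableP; split => //.
  under eq_integral do rewrite gee0_abs//.
  rewrite -[X in (X < _)%E](@fubini_tonelli2 _ _ _ _ _ L2 Lp (EFin \o f)).
  - by rewrite f1 ltry.
  - exact: measurable_EFin.
  - by move=> x; rewrite lee_fin.
apply: filterS (integrable_ae measurableT iFinf) => y /(_ Logic.I) fin.
by rewrite fZE fineK.
Qed.

(** By change of variables, [h^p] times the measure of the preimage is that of the null set. *)
Lemma ae_affine (z : 'rV[R]_p) (h : R) (Q : 'rV[R]_p -> Prop) : 0 < h ->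
  {ae Lp, forall y, Q y} -> {ae Lp, forall u, Q (z + h *: u)}.
Proof.
move=> h0 [N [mN N0 QN]].
pose N' := (fun u : 'rV[R]_p => z + h *: u) @^-1` N.
have mN' : measurable N'.
  by rewrite -[X in measurable X]setTI; apply: measurable_mx_affine.
exists N'; split => //; last by move=> u /= Qu; apply: QN.
have I1 : (\int[Lp]_y (\1_N y)%:E = 0)%E by rewrite integral_indic// setIT.
have I2 : (\int[Lp]_u (\1_N (z + h *: u))%:E = Lp N')%E.
  by rewrite -[N']setIT -integral_indic.
have := @ge0_integral_affine R p z h (fun y => (\1_N y)%:E) h0.
rewrite I1 I2 => H.
have m1 : measurable_fun setT (fun y : 'rV[R]_p => (\1_N y : R)%:E).
  exact: measurable_EFin.
have n1 x : (0 <= (\1_N x : R)%:E)%E by rewrite lee_fin.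
have /esym/eqP := H m1 n1; rewrite mule_eq0 => /orP[|/eqP//].
by rewrite eqe expf_eq0 (gt_eqF h0) andbF.
Qed.

Let Fint_continuous z : {for z, continuous (fun y => \int[L2]_x F y x)}.
Proof.
have [[df _] _] := A2.
have : differentiable (partials [::] fZ) z.
  by apply: times_differentiable_partials (df z) _; rewrite (ltn_trans _ alpha_gt1).
exact: differentiable_continuous.
Qed.

Let Z_pos z : Z z -> 0 < \int[L2]_x F z x.
Proof.
have [fmin [fmax [fmin0 _ hf]]] := A3 => Zz.
by have /andP[h _] := hf z Zz; exact: lt_le_trans h.
Qed.

Lemma l1_dist_unif (eps : R) : 0 < eps ->
  exists2 delta : R, 0 < delta & forall z a, Z z -> `|a - z| < delta ->
    (l1_dist L2 F a z < eps%:E)%E.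
Proof.
by move=> eps0; exact: l1_dist_unif_continuous.
Qed.

Lemma measurable_l1_dist z : measurable_fun setT (fun y => l1_dist L2 F y z).
Proof.
apply: (@measurable_fun_fubini_tonelli_G _ _ _ _ _ L2
  (fun xy : 'rV[R]_2 * 'rV[R]_p => `|f (xy.1, xy.2) - f (xy.1, z)|%:E)) => //.
apply: measurable_EFin; apply: measurableT_comp => //; apply: measurable_funB.
  by apply: (measurableT_comp mf); exact: measurable_fun_pair.
by apply: (measurableT_comp mf); exact: measurable_fun_pair.
Qed.

Lemma partials_bounded : exists2 D : R, 0 <= D &
  forall z j (iota : j.-tuple 'I_p), Z z -> (j < alpha)%N ->
    `|partials iota fZ z| <= D.
Proof.
have [[df _] _] := A2.
have bj j : exists D : R, (j < alpha)%N -> forall z (iota : j.-tuple 'I_p), Z z ->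
    `|partials iota fZ z| <= D.
  have [ja|] := boolP (j < alpha)%N; last by exists 0.
  have bi (iota : j.-tuple 'I_p) : exists D : R, forall z, Z z -> `|partials iota fZ z| <= D.
    apply: continuous_bounded_on_compact => // z.
    apply: differentiable_continuous.
    by apply: times_differentiable_partials (df z) _; rewrite size_tuple.
  have [D hD] := choice bi.
  exists (\sum_iota `|D iota|) => _ z iota Zz.
  rewrite (le_trans (hD iota z Zz))// (le_trans (ler_norm _))//.
  by rewrite (bigD1 iota)//= lerDl sumr_ge0.
have [D hD] := choice bj.
exists (\sum_(j < alpha) `|D j|); first exact: sumr_ge0.
move=> z j iota Zz ja; rewrite (le_trans (hD j ja z iota Zz))// (le_trans (ler_norm _))//.
by rewrite (bigD1 (Ordinal ja))//= lerDl sumr_ge0.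
Qed.

Let mK : measurable_fun setT K.
Proof. by case: A1 => _ _ /integrableP[/measurable_EFinP]. Qed.

Let iK : Lp.-integrable setT (EFin \o (fun u => `|K u|)).
Proof. by case: A1 => _ _ iK _ _; exact: integrable_norm. Qed.

Lemma measurable_monomial (s : seq 'I_p) :
  measurable_fun setT (fun u : 'rV[R]_p => monomial s u).
Proof. by apply: measurable_prod => i _; exact: measurable_mx_entry. Qed.

Let monomials (u : 'rV[R]_p) : R :=
  \sum_(j < alpha) \sum_(iota : j.-tuple 'I_p) `|monomial iota u|.

Let monomials0 u : 0 <= monomials u.
Proof. by apply: sumr_ge0 => j _; exact: sumr_ge0. Qed.

Let integrable_kernel_monomials (c D : R) :
  Lp.-integrable setT (EFin \o (fun u => `|K u| * (c + D * monomials u))).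
Proof.
have -> : (fun u => `|K u| * (c + D * monomials u)) =
  (fun u => c * `|K u| + D * (\sum_(j < alpha) \sum_(iota : j.-tuple 'I_p)
     `|K u * monomial iota u|)).
  apply/funext => u; rewrite mulrDr mulrC; congr (_ + _).
  rewrite mulrCA; congr (_ * _); rewrite mulr_sumr; apply: eq_bigr => j _.
  by rewrite mulr_sumr; apply: eq_bigr => iota _; rewrite normrM.
apply: integrable_EFinD; first exact: integrable_EFinZl.
apply: integrable_EFinZl; apply: integrable_EFin_sum => j.
apply: integrable_EFin_sum => iota; apply: integrable_norm.
(* The moment condition starts at order 1; at order 0 the monomial is 1 and [K] alone remains. *)
case: A1 => _ _ iK' _ hm; have [j0|j0] := posnP j.
  rewrite (_ : EFin \o _ = EFin \o K)//; apply/funext => u /=.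
  have -> : tval iota = [::] by apply: size0nil; rewrite size_tuple.
  by rewrite /monomial big_nil mulr1.
by have [] := hm j iota; rewrite ?j0 ?ltn_ord.
Qed.

Let sup_derivatives z u : \bar R :=
  (\sum_(iota : alpha.-tuple 'I_p) (`|monomial iota u|%:E *
     ereal_sup [set `|partials iota fZ (z + t *: u)|%:E | t in `[0%R, 1%R]]))%E.

(** The factor [|K u|] stays on both sides because the supremum may be infinite. Where [K u = 0]
    both sides vanish, as 0 times infinity is 0; elsewhere an infinite supremum makes the right side
    infinite, and a finite one controls the whole segment since [h <= 1]. *)
Let marginal_taylor_le (D : R) z u h : 0 <= D ->
  (forall j (iota : j.-tuple 'I_p), (j < alpha)%N -> `|partials iota fZ z| <= D) ->
  0 < h <= 1 ->
  ((`|K u| * (fZ (z + h *: u) - D * monomials u))%:E <=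
     (h ^+ alpha)%:E * (`|K u|%:E * sup_derivatives z u))%E.
Proof.
move=> D0 hD /andP[h0 h1].
have h0' : 0 <= h by exact: ltW.
have sup0 iota : (0 <= ereal_sup [set `|partials iota fZ (z + t *: u)|%:E | t in `[0%R, 1%R]])%E.
  apply: (@le_trans _ _ `|partials iota fZ (z + 0 *: u)|%:E); first by rewrite lee_fin.
  by apply: ereal_sup_ubound; exists 0 => //=; rewrite in_itv /= lexx ler01.
have S0 : (0 <= sup_derivatives z u)%E.
  by apply: sume_ge0 => iota _; rewrite mule_ge0// lee_fin.
have [K0|K0] := eqVneq (K u) 0; first by rewrite K0 normr0 mul0r mul0e mule0.
have Kpos : 0 < `|K u| by rewrite normr_gt0.
have [Sfin|/negPf Sinf] := boolP (sup_derivatives z u \is a fin_num); last first.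
  have -> : sup_derivatives z u = +oo%E.
    by move: Sinf; rewrite ge0_fin_numE// => /negbT; rewrite -leNgt leye_eq => /eqP.
  by rewrite gt0_muley ?lte_fin// gt0_muley ?lte_fin ?exprn_gt0// leey.
rewrite -(fineK Sfin) -!EFinM lee_fin mulrCA ler_pM2l// lerBlDr [leRHS]addrC.
have df : forall y, times_differentiable alpha fZ y by case: A2 => -[].
have tB (t : R) : 0 <= t <= h ->
    `|\sum_(iota : alpha.-tuple 'I_p) monomial iota u * partials iota fZ (z + t *: u)| <=
    fine (sup_derivatives z u).
  move=> /andP[t0 th]; rewrite -lee_fin fineK//.
  apply: (@le_trans _ _ (\sum_(iota : alpha.-tuple 'I_p)
      (`|monomial iota u| * `|partials iota fZ (z + t *: u)|)%:E)%E).
    rewrite sumEFin lee_fin (le_trans (ler_norm_sum _ _ _))//.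
    by apply: ler_sum => iota _; rewrite normrM.
  apply: lee_sum => iota _; rewrite EFinM lee_wpmul2l ?lee_fin//.
  by apply: ereal_sup_ubound; exists t => //=; rewrite in_itv /= t0 (le_trans th).
have h01 : 0 <= h <= 1 by rewrite h0'.
rewrite (le_trans (ler_norm _))// (le_trans (taylor_bound df tB h01))// lerD2r.
rewrite mulr_sumr; apply: ler_sum => j _; rewrite mulr_sumr.
by apply: ler_sum => iota _; rewrite ler_wpM2r// hD.
Qed.

(** The weighted part of the density in excess of its Taylor polynomial: a measurable stand-in for
    the suprema of (A2), whose measurability is not known. *)
Let taylor_rest (D : R) z h u : R :=
  Num.max (`|K u| * (fZ (z + h *: u) - D * monomials u)) 0.

Let mfZ_line z h : measurable_fun setT (fun u : 'rV[R]_p => fZ (z + h *: u)).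
Proof.
by apply: (measurableT_comp measurable_marginal_density); exact: measurable_mx_affine.
Qed.

Let mabsK : measurable_fun setT (fun u => `|K u|).
Proof. exact: measurableT_comp. Qed.

Let mmonomials : measurable_fun setT monomials.
Proof.
apply: measurable_sum => j; apply: measurable_sum => iota.
by apply: measurableT_comp => //; exact: measurable_monomial.
Qed.

Let mtaylor_rest D z h : measurable_fun setT (taylor_rest D z h).
Proof.
apply: measurable_maxr => //; apply: measurable_funM => //.
by apply: measurable_funB => //; exact: measurable_funM.
Qed.

Let integral_taylor_rest (C D : R) z h : 0 <= D ->
  (forall j (iota : j.-tuple 'I_p), (j < alpha)%N -> `|partials iota fZ z| <= D) ->
  (\int[Lp]_u (`|K u|%:E * sup_derivatives z u) <= C%:E)%E ->
  0 < h <= 1 ->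
  (\int[Lp]_u (taylor_rest D z h u)%:E <= (h ^+ alpha * C)%:E)%E.
Proof.
move=> D0 hD SC h01; have /andP[h0 h1] := h01.
have ha0 : 0 < h ^+ alpha by rewrite exprn_gt0.
have r0 u : 0 <= taylor_rest D z h u by rewrite /taylor_rest le_max lexx orbT.
have -> : (\int[Lp]_u (taylor_rest D z h u)%:E =
    (h ^+ alpha)%:E * \int[Lp]_u ((h ^+ alpha)^-1 * taylor_rest D z h u)%:E)%E.
  rewrite -ge0_integral_EFinZl//.
  - by apply: eq_integral => u _; rewrite mulrA divff ?mul1r// gt_eqF.
  - exact: ltW.
  - exact: measurable_funM.
  - by move=> u; rewrite mulr_ge0// invr_ge0 ltW.
rewrite EFinM lee_pmul2l// ?lte_fin//; apply: le_trans SC.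
(* The integrand on the right contains these suprema, so only monotonicity of the lower integral is
   available. *)
apply: ge0_le_integral_nonmeasurable => u.
  by rewrite lee_fin mulr_ge0// invr_ge0 ltW.
have KS0 : (0 <= `|K u|%:E * sup_derivatives z u)%E.
  rewrite mule_ge0 ?lee_fin//; apply: sume_ge0 => iota _.
  rewrite mule_ge0 ?lee_fin//.
  apply: (@le_trans _ _ `|partials iota fZ (z + 0 *: u)|%:E); first by rewrite lee_fin.
  by apply: ereal_sup_ubound; exists 0 => //=; rewrite in_itv /= lexx ler01.
rewrite -(@lee_pmul2l _ (h ^+ alpha)%:E)// ?lte_fin//.
rewrite -EFinM mulrA divff ?gt_eqF// mul1r /taylor_rest.
rewrite /Num.max; case: ifP => _; last exact: marginal_taylor_le.
by rewrite mule_ge0// lee_fin ltW.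
Qed.

(** For [|u| <= Mt] the shift [h u] is small and the L^1 distance is uniformly small. For larger [u]
    it is at most [fZ (z + h u) + fZ z]: the Taylor polynomial and [fmax] go into the integrable
    tail of [W], the excess into [taylor_rest], which is of order [h^alpha]. *)
Lemma kernel_l1_small (eps : R) : 0 < eps ->
  exists2 delta : R, 0 < delta & forall h z, 0 < h < delta -> Z z ->
    (\int[Lp]_u (`|K u|%:E * l1_dist L2 F (z + h *: u)%R z) <= eps%:E)%E.
Proof.
move=> eps0.
have [fmin [fmax [fmin0 fmax0 hf]]] := A3.
have [D D0 hD] := partials_bounded.
have [_ [C C0 hC]] := A2.
pose IK := \int[Lp]_u `|K u|.
have IK0 : 0 <= IK by exact: Rintegral_ge0.
(* Makes [eps1] times the integral of [|K|] at most [eps / 4]; the 1 avoids a zero denominator. *)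
pose eps1 := eps / (4 * (IK + 1)).
have eps10 : 0 < eps1 by rewrite divr_gt0// mulr_gt0// ltr_wpDl.
have [d1 d10 hd1] := l1_dist_unif eps10.
pose W u := `|K u| * (fmax + D * monomials u).
have iW : Lp.-integrable setT (EFin \o W) by exact: integrable_kernel_monomials.
have W0 u : 0 <= W u.
  by apply: mulr_ge0 => //; apply: addr_ge0; [exact: ltW|exact: mulr_ge0].
have eps4 : 0 < eps / 4 by rewrite divr_gt0.
have [Mt Mt0 hM] := tail_integral_small iW W0 eps4.
(* The entries give, in order, the validity of the Taylor bound, [|h u| < d1] for [|u| <= Mt], and
   [h^alpha C <= h C <= eps / 4]. *)
exists (Num.min 1 (Num.min (d1 / (Mt + 1)) (eps / 4 / C))).
  by rewrite !lt_min ltr01 !divr_gt0//= ltr_wpDl.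
move=> h z /andP[h0]; rewrite !lt_min => /and3P[h1 hd hCe] Zz.
have h01 : 0 < h <= 1 by rewrite h0 ltW.
have /andP[_ fzmax] := hf z Zz.
have FzE : (\int[L2]_x (F z x)%:E = (fZ z)%:E)%E.
  by apply: integral_EFin_fine; apply: integrable_of_fine => //; exact: Z_pos.
pose tail : 'rV[R]_p -> R := W \_ [set u | Mt < `|u|].
have mW : measurable_fun setT W by have /integrableP[/measurable_EFinP] := iW.
have mtail : measurable_fun setT tail.
  apply/(measurable_restrictT _ (@measurable_normr_gt R p Mt Mt0)).
  exact: measurable_funTS.
have tail0 u : 0 <= tail u by rewrite /tail patchE; case: ifP.
have r0 u : 0 <= taylor_rest D z h u by rewrite /taylor_rest le_max lexx orbT.
have dom : {ae Lp, forall u, setT u -> (`|K u|%:E * l1_dist L2 F (z + h *: u)%R z <=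
    (eps1 * `|K u| + tail u + taylor_rest D z h u)%R%:E)%E}.
  apply: filterS (ae_affine z h0 ae_marginal_density) => u fzu _.
  have [uM|Mu] := leP `|u| Mt.
    apply: (@le_trans _ _ (eps1 * `|K u|)%:E); last first.
      by rewrite lee_fin -addrA lerDl addr_ge0.
    rewrite mulrC EFinM lee_wpmul2l ?lee_fin//; apply/ltW/hd1 => //.
    rewrite addrAC subrr add0r normrZ gtr0_norm//.
    rewrite (@le_lt_trans _ _ (h * (Mt + 1)))//; last by rewrite -ltr_pdivlMr// ltr_wpDl.
    by rewrite ler_pM2l// (le_trans uM)// lerDl.
  apply: (@le_trans _ _ (`|K u| * (fZ (z + h *: u) + fZ z))%:E).
    rewrite EFinM lee_wpmul2l ?lee_fin// EFinD -fzu -FzE /l1_dist -ge0_integralD//.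
    - apply: ge0_le_integral => //.
      + by apply: measurable_EFin; exact: measurable_l1_integrand.
      + by apply: emeasurable_funD; exact: measurable_EFin.
      + move=> x _; rewrite -EFinD lee_fin (le_trans (ler_normB _ _))//.
        by rewrite !ger0_norm.
    - by move=> x _; rewrite lee_fin.
    - exact: measurable_EFin.
    - by move=> x _; rewrite lee_fin.
    - exact: measurable_EFin.
  rewrite lee_fin /tail patchE mem_set//.
  apply: (@le_trans _ _ (W u + `|K u| * (fZ (z + h *: u) - D * monomials u))).
    rewrite /W -mulrDr ler_wpM2l//; lra.
  have e1K : 0 <= eps1 * `|K u| by rewrite mulr_ge0// ltW.
  have rV : `|K u| * (fZ (z + h *: u) - D * monomials u) <= taylor_rest D z h u.
    by rewrite /taylor_rest le_max lexx.
  lra.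
apply: (@le_trans _ _ (\int[Lp]_u (eps1 * `|K u| + tail u + taylor_rest D z h u)%R%:E)%E).
  apply: ae_ge0_le_integral => //.
  - by move=> u _; rewrite mule_ge0 ?lee_fin//; apply: integral_ge0 => x _; rewrite lee_fin.
  - apply: emeasurable_funM; first exact: measurable_EFin.
    by apply: (measurableT_comp (measurable_l1_dist z)); exact: measurable_mx_affine.
  - by move=> u _; rewrite lee_fin !addr_ge0// mulr_ge0// ltW.
  - by apply: measurable_EFin; apply: measurable_funD => //; apply: measurable_funD => //; exact: measurable_funM.
under eq_integral do rewrite !EFinD.
rewrite ge0_integralD//; first last.
- exact: measurable_EFin.
- by move=> u _; rewrite lee_fin.
- by apply: emeasurable_funD; [apply: measurable_EFin; exact: measurable_funM|exact: measurable_EFin].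
- by move=> u _; rewrite adde_ge0 ?lee_fin// mulr_ge0// ltW.
rewrite ge0_integralD//; first last.
- exact: measurable_EFin.
- by move=> u _; rewrite lee_fin.
- by apply: measurable_EFin; exact: measurable_funM.
- by move=> u _; rewrite lee_fin mulr_ge0// ltW.
rewrite ge0_integral_EFinZl ?(ltW eps10)// integral_EFin_fine//.
have hr := integral_taylor_rest D0 (fun j iota => hD z j iota Zz) (hC z Zz) h01.
apply: (le_trans (leeD (leeD (lexx _) hM) hr)).
rewrite -EFinM -!EFinD lee_fin.
have i1 : eps1 * IK <= eps / 4.
  have IK1 : 0 < IK + 1 by rewrite ltr_wpDl.
  have -> : eps1 * IK = eps / 4 * (IK / (IK + 1)).
    by rewrite /eps1; field; rewrite gt_eqF.
  by rewrite ler_piMr ?(ltW eps4)// ler_pdivrMr// mul1r lerDl.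
have i2 : h ^+ alpha * C <= eps / 4.
  apply: (@le_trans _ _ (h * C)); last by rewrite -ler_pdivlMr// ltW.
  rewrite ler_pM2r// -(prednK (ltn_trans (isT : (0 < 1)%N) alpha_gt1)) exprS.
  by rewrite ler_piMr ?(ltW h0)// exprn_ile1 ?(ltW h0) ?(ltW h1).
rewrite -/IK; lra.
Qed.

End approximate_identity.

(** * Densities and tensor products *)

Section density.
Context {d : measure_display} {T : measurableType d} {R : realType}.
Variables mu nu : {measure set T -> \bar R}.
Variable f : T -> R.
Hypothesis mf : measurable_fun setT f.
Hypothesis f0 : forall x, 0 <= f x.

Import HBNNSimple.

Lemma ge0_integral_density (phi : T -> \bar R) :
  (forall A, measurable A -> nu A = (\int[mu]_(x in A) (f x)%:E)%E) ->
  measurable_fun setT phi -> (forall x, (0 <= phi x)%E) ->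
  (\int[nu]_x phi x = \int[mu]_x (phi x * (f x)%:E))%E.
Proof.
move=> nuE mphi phi0.
pose phi_ := nnsfun_approx measurableT mphi.
have cvphi x : (phi_ n x)%:E @[n --> \oo] --> phi x.
  exact: cvg_nnsfun_approx.
have nd x m n : (m <= n)%N -> phi_ m x <= phi_ n x.
  by move=> mn; exact/lefP/nd_nnsfun_approx.
have -> : (\int[nu]_x phi x = limn (fun n => \int[nu]_x (phi_ n x)%:E))%E.
  rewrite -monotone_convergence//.
  - by apply: eq_integral => x _; apply/esym/cvg_lim => //.
  - by move=> n; exact: measurable_EFin.
  - by move=> n x _; rewrite lee_fin.
  - by move=> x _ m n mn; rewrite lee_fin nd.
have -> : (\int[mu]_x (phi x * (f x)%:E) =
    limn (fun n => \int[mu]_x ((phi_ n x)%:E * (f x)%:E)))%E.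
  rewrite -monotone_convergence//.
  - apply: eq_integral => x _; apply/esym/cvg_lim => //.
    by apply: cvgeZr => //.
  - by move=> n; apply: emeasurable_funM; exact: measurable_EFin.
  - by move=> n x _; rewrite -EFinM lee_fin mulr_ge0.
  - by move=> x _ m n mn; rewrite -!EFinM lee_fin ler_wpM2r// nd.
congr (limn _); apply/funext => n.
have mE r : measurable (phi_ n @^-1` [set r]) by exact: measurable_sfunP.
have m1 r : measurable_fun setT (fun x => (r * \1_(phi_ n @^-1` [set r]) x)%:E).
  by apply: measurable_EFin; exact: measurable_funM.
transitivity (\int[nu]_x (\sum_(r \in range (phi_ n))
    (r * \1_(phi_ n @^-1` [set r]) x)%:E))%E.
  by apply: eq_integral => x _; rewrite fimfunE -fsumEFin.
rewrite ge0_integral_fsum//; last by move=> r x _; exact: nnfun_muleindic_ge0.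
transitivity (\int[mu]_x (\sum_(r \in range (phi_ n))
    ((r * \1_(phi_ n @^-1` [set r]) x)%:E * (f x)%:E)))%E; last first.
  apply: eq_integral => x _; rewrite -ge0_mule_fsuml => [|r].
    by rewrite fsumEFin// -fimfunE.
  exact: nnfun_muleindic_ge0.
rewrite ge0_integral_fsum//; last 2 first.
- by move=> r; apply: emeasurable_funM => //; exact: measurable_EFin.
- by move=> r x _; rewrite mule_ge0 ?lee_fin ?f0// -lee_fin nnfun_muleindic_ge0.
apply: eq_fsbigr => r rphi.
under eq_integral do rewrite EFinM.
rewrite integralZl_indic_nnsfun// integral_indic// setIT nuE//.
rewrite [in LHS]integral_mkcond.
have r0 : 0 <= r by move: rphi; rewrite inE => -[x _ <-].
rewrite -ge0_integralZl//.
- apply: eq_integral => x _; rewrite EFinM -muleA; congr (_ * _)%E.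
  by rewrite epatch_indic muleC.
- apply/(measurable_restrictT _ (mE r)).
  by apply: measurable_funTS; exact: measurable_EFin.
- by move=> x _; rewrite patchE; case: ifP => // _; rewrite lee_fin.
Qed.

Lemma integral_density (phi : T -> R) :
  (forall A, measurable A -> nu A = (\int[mu]_(x in A) (f x)%:E)%E) ->
  measurable_fun setT phi ->
  (\int[nu]_x (phi x)%:E = \int[mu]_x (phi x * f x)%:E)%E.
Proof.
move=> nuE mphi; rewrite integralE [RHS]integralE.
have mE : measurable_fun setT (EFin \o phi) by exact: measurable_EFin.
rewrite !ge0_integral_density//; [|exact: measurable_funeneg|exact: measurable_funepos].
congr (_ - _)%E; apply: eq_integral => x _.
  rewrite !funeposE -!EFin_max -EFinM; congr _%:E.
  by rewrite maxr_pMl// mul0r.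
rewrite !funenegE -!EFinN -!EFin_max -EFinM; congr _%:E.
by rewrite maxr_pMl// mul0r mulNr.
Qed.

End density.

Section density_pair.
Context {d : measure_display} {T : measurableType d} {R : realType}.
Variable mu : {sigma_finite_measure set T -> \bar R}.
Variable nu : probability T R.
Variable f : T -> R.
Hypothesis mf : measurable_fun setT f.
Hypothesis f0 : forall x, 0 <= f x.
Hypothesis nuE : forall A, measurable A -> nu A = (\int[mu]_(x in A) (f x)%:E)%E.

Lemma product_density A : measurable A ->
  (nu \x nu)%E A = (\int[(mu \x mu)%E]_(x in A) (f x.1 * f x.2)%:E)%E.
Proof.
move=> mA.
have mff : measurable_fun setT (fun x : T * T => (f x.1 * f x.2)%:E).
  by apply: measurable_EFin; apply: measurable_funM; exact: measurableT_comp.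
have -> : (nu \x nu)%E A = (\int[(nu \x nu)%E]_x (\1_A x)%:E)%E.
  by rewrite integral_indic// setIT.
have m1 : measurable_fun setT (fun x : T * T => (\1_A x)%:E : \bar R).
  by apply: measurable_EFin.
rewrite fubini_tonelli1//.
rewrite [RHS]integral_mkcond.
rewrite [RHS]fubini_tonelli1//; last 2 first.
- by apply/(measurable_restrictT _ mA); exact: measurable_funTS.
- by move=> x; rewrite patchE; case: ifP => // _; rewrite lee_fin mulr_ge0.
rewrite /fubini_F.
rewrite (ge0_integral_density mf f0 nuE); last 2 first.
- apply: (@measurable_fun_fubini_tonelli_F _ _ T T R nu (fun x => (\1_A x)%:E) m1).
  by move=> x; rewrite lee_fin.
- by move=> x; apply: integral_ge0 => y _; rewrite lee_fin.
apply: eq_integral => x _; rewrite (ge0_integral_density mf f0 nuE); last 2 first.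
- by apply: measurable_EFin; apply: measurableT_comp => //.
- by move=> y; rewrite lee_fin.
rewrite muleC -ge0_integralZl//.
- apply: eq_integral => y _; rewrite patchE indicE; case: ifP => _ /=.
    by rewrite mul1e EFinM.
  by rewrite mul0e mule0.
- apply: emeasurable_funM; last exact: measurable_EFin.
  by apply: measurable_EFin; apply: measurableT_comp => //.
- by move=> y _; rewrite mule_ge0 ?lee_fin.
- by rewrite lee_fin.
Qed.

End density_pair.

Section tensor.
Context {d1 d2 : measure_display} {T1 : measurableType d1}
  {T2 : measurableType d2} {R : realType}.
Variable mu : {sigma_finite_measure set T1 -> \bar R}.
Variable la : {sigma_finite_measure set T2 -> \bar R}.
Variables (phi : T1 -> R) (k : T2 -> R).
Hypothesis iphi : mu.-integrable setT (EFin \o phi).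
Hypothesis ik : la.-integrable setT (EFin \o k).

Lemma measurable_tensor :
  measurable_fun setT (fun w : T1 * T2 => (phi w.1 * k w.2)%:E).
Proof.
apply: measurable_EFin; apply: measurable_funM.
  by apply: (measurableT_comp (f := phi)) => //; apply/measurable_EFinP; exact: measurable_int iphi.
by apply: (measurableT_comp (f := k)) => //; apply/measurable_EFinP; exact: measurable_int ik.
Qed.

Lemma integrable_tensor :
  (mu \x la)%E.-integrable setT (fun w : T1 * T2 => (phi w.1 * k w.2)%:E).
Proof.
have mt := measurable_tensor.
have /integrableP[mphi phioo] := iphi; have /integrableP[mk koo] := ik.
have mabs d (T : measurableType d) (f : T -> R) : measurable_fun setT (EFin \o f) ->
    measurable_fun setT (fun x => `|f x|%:E).
  by move=> mf; apply: measurable_EFin; apply: measurableT_comp => //; exact/measurable_EFinP.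
have kfin : (\int[la]_y `|k y|%:E)%E \is a fin_num.
  by rewrite ge0_fin_numE// integral_ge0// => y _; rewrite lee_fin.
apply/integrableP; split => //.
rewrite fubini_tonelli1//; last first.
  by apply: measurableT_comp mt => //; exact: abse_measurable.
rewrite /fubini_F /=.
under eq_integral => x _.
  under eq_integral do rewrite normrM EFinM.
  rewrite ge0_integralZl//; [|exact: mabs].
  over.
rewrite /= -(fineK kfin) ge0_integralZr//.
- by rewrite muleC lte_mul_pinfty// lee_fin fine_ge0// integral_ge0// => y _; rewrite lee_fin.
- exact: mabs.
- by rewrite lee_fin fine_ge0// integral_ge0// => y _; rewrite lee_fin.
Qed.

Lemma integral_tensor :
  (\int[(mu \x la)%E]_w (phi w.1 * k w.2)) = (\int[mu]_x phi x) * (\int[la]_y k y).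
Proof.
rewrite {1}/Rintegral -integral12_prod_meas1; last exact: integrable_tensor.
have mE x : (fubini_F la (fun w => (phi w.1 * k w.2)%:E) x =
    (phi x * \int[la]_y k y)%:E)%E.
  rewrite /fubini_F /= (integral_EFin_fine (integrable_EFinZl (phi x) ik)).
  by rewrite RintegralZl.
under eq_integral do rewrite mE mulrC.
by rewrite -[LHS]/(Rintegral _ _ _) RintegralZl// mulrC.
Qed.

End tensor.

Section tensor_difference.
Context {d : measure_display} {T : measurableType d} {R : realType}.
Variable m : {sigma_finite_measure set T -> \bar R}.
Variables (G : T * T -> R) (C : R).
Hypothesis mG : measurable_fun setT G.
Hypothesis GC : forall x, `|G x| <= C.

Lemma integrable_tensor_mul (a b : T -> R) :
  m.-integrable setT (EFin \o a) -> m.-integrable setT (EFin \o b) ->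
  (m \x m)%E.-integrable setT (EFin \o (fun x => G x * (a x.1 * b x.2))).
Proof.
move=> ia ib; have iab := integrable_tensor ia ib.
apply: (le_integrable measurableT _ _ (integrable_EFinZl C iab)).
  apply: measurable_EFin; apply: measurable_funM => //.
  by apply/measurable_EFinP; exact: measurable_int iab.
move=> x _; rewrite /= lee_fin !normrM ler_wpM2r//.
by rewrite (le_trans (GC x))// ler_norm.
Qed.

(** [a(x1) a(x2) - b(x1) b(x2) = (a - b)(x1) a(x2) + b(x1) (a - b)(x2)], and integrals of tensor
    products factor. *)
Lemma tensor_difference (a b : T -> R) :
  m.-integrable setT (EFin \o a) -> m.-integrable setT (EFin \o b) ->
  `|\int[(m \x m)%E]_x (G x * (a x.1 * a x.2)) -
    \int[(m \x m)%E]_x (G x * (b x.1 * b x.2))| <=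
  C * ((\int[m]_x `|a x - b x|) * (\int[m]_x `|a x| + \int[m]_x `|b x|)).
Proof.
move=> ia ib.
have iN (u : T -> R) : m.-integrable setT (EFin \o u) ->
    m.-integrable setT (EFin \o (fun x => `|u x|)).
  by move=> iu; exact: integrable_norm iu.
have iab := iN _ (integrable_EFinB ia ib).
rewrite mulrDr -(integral_tensor iab (iN _ ia)).
rewrite [X in C * (_ + X)]mulrC -(integral_tensor (iN _ ib) iab).
rewrite -RintegralB//; [|exact: integrable_tensor_mul|exact: integrable_tensor_mul].
have i1 := integrable_tensor iab (iN _ ia).
have i2 := integrable_tensor (iN _ ib) iab.
rewrite -RintegralD// -RintegralZl//; last exact: (integrable_EFinD i1 i2).
have iB := integrable_EFinB (integrable_tensor_mul ia ia) (integrable_tensor_mul ib ib).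
apply: (le_trans (le_normr_integral measurableT iB)).
apply: le_Rintegral => //.
- exact: (integrable_norm iB).
- exact: (integrable_EFinZl C (integrable_EFinD i1 i2)).
move=> x _; rewrite -mulrBr normrM.
apply: ler_pM => //.
have -> : a x.1 * a x.2 - b x.1 * b x.2 =
   (a x.1 - b x.1) * a x.2 + b x.1 * (a x.2 - b x.2) by ring.
by rewrite (le_trans (ler_normD _ _))// !normrM.
Qed.

End tensor_difference.

(** * Mean and second moment of kernel statistics *)

Section scaled_kernel.
Context {R : realType} {p : nat}.
Notation Lp := (@lebesgue_rV R p).
Variables (K : 'rV[R]_p -> R) (h : R) (z : 'rV[R]_p).
Hypothesis h0 : 0 < h.
Hypothesis iK : Lp.-integrable setT (EFin \o K).

Let kz (y : 'rV[R]_p) := scaled_kernel K h (y - z).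

Let mK : measurable_fun setT K.
Proof. by apply/measurable_EFinP; exact: measurable_int iK. Qed.

Lemma measurable_scaled_kernel : measurable_fun setT kz.
Proof.
apply: measurable_funM => //; apply: (measurableT_comp mK).
rewrite (_ : (fun _ => _) = (fun y : 'rV[R]_p => - (h^-1 *: z) + h^-1 *: y)%R).
  exact: measurable_mx_affine.
by apply/funext => y; rewrite scalerBr addrC.
Qed.

Let kz_affine u : kz (z + h *: u) = h ^- p * K u.
Proof.
by rewrite /kz /scaled_kernel addrC addKr scalerA mulVf ?scale1r// gt_eqF.
Qed.

Let hp0 : 0 <= h ^- p. Proof. by rewrite invr_ge0 exprn_ge0// ltW. Qed.

(** Positive homogeneity of [phi] lets the factor [h^-p] of the kernel out, where it cancels the
    Jacobian [h^p]. *)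
Lemma ge0_integral_scaled_kernel (phi : R -> R) (psi : 'rV[R]_p -> \bar R) :
  measurable_fun setT phi -> (forall r, 0 <= phi r) ->
  (forall c r, 0 <= c -> phi (c * r) = c * phi r) ->
  measurable_fun setT psi -> (forall y, (0 <= psi y)%E) ->
  (\int[Lp]_y ((phi (kz y))%:E * psi y) =
   \int[Lp]_u ((phi (K u))%:E * psi (z + h *: u)%R))%E.
Proof.
move=> mphi phi0 phiZ mpsi psi0.
rewrite (ge0_integral_affine z h0); last 2 first.
- apply: emeasurable_funM => //; apply: measurable_EFin.
  by apply: (measurableT_comp mphi); exact: measurable_scaled_kernel.
- by move=> y; rewrite mule_ge0// lee_fin.
rewrite -ge0_integralZl//.
- apply: eq_integral => u _; rewrite kz_affine phiZ// EFinM muleA muleA -EFinM.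
  by rewrite divff ?mul1r// expf_neq0// gt_eqF.
- apply: emeasurable_funM.
    apply: measurable_EFin; apply: (measurableT_comp mphi).
    by apply: (measurableT_comp measurable_scaled_kernel); exact: measurable_mx_affine.
  by apply: (measurableT_comp mpsi); exact: measurable_mx_affine.
- by move=> u _; rewrite mule_ge0// lee_fin.
- by rewrite lee_fin exprn_ge0// ltW.
Qed.

Let ge0_integral_phi (phi : R -> R) :
  measurable_fun setT phi -> (forall r, 0 <= phi r) ->
  (forall c r, 0 <= c -> phi (c * r) = c * phi r) ->
  (\int[Lp]_y (phi (kz y))%:E = \int[Lp]_u (phi (K u))%:E)%E.
Proof.
move=> mphi phi0 phiZ.
have := ge0_integral_scaled_kernel mphi phi0 phiZ (@measurable_cst _ _ _ _ setT 1%E) (fun=> lee01).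
by under eq_integral do rewrite mule1; under [in RHS]eq_integral do rewrite mule1.
Qed.

Lemma integral_normr_scaled_kernel : \int[Lp]_y `|kz y| = \int[Lp]_u `|K u|.
Proof.
rewrite /Rintegral (ge0_integral_phi (phi := fun r => `|r|))//.
by move=> c r c0; rewrite normrM ger0_norm.
Qed.

Lemma integrable_scaled_kernel : Lp.-integrable setT (EFin \o kz).
Proof.
apply/integrableP; split; first by apply: measurable_EFin; exact: measurable_scaled_kernel.
rewrite (ge0_integral_phi (phi := fun r => `|r|))//; last first.
  by move=> c r c0; rewrite normrM ger0_norm.
by have /integrableP[] := iK.
Qed.

Lemma integral_scaled_kernel : \int[Lp]_y kz y = \int[Lp]_u K u.
Proof.
(* Writing [u] as [(|u| + u) - |u|] reduces the signed kernel to two positively homogeneous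
   nonnegative functions. *)
have E (u : 'rV[R]_p -> R) : Lp.-integrable setT (EFin \o u) ->
    \int[Lp]_y u y = \int[Lp]_y (`|u y| + u y) - \int[Lp]_y `|u y|.
  move=> iu; rewrite RintegralD//; last exact: integrable_norm.
  by rewrite addrAC subrr add0r.
rewrite (E kz); last exact: integrable_scaled_kernel.
rewrite (E K)// integral_normr_scaled_kernel; congr (_ - _).
rewrite /Rintegral (ge0_integral_phi (phi := fun r => `|r| + r))//.
- exact: (measurable_funD (@normr_measurable _ _) (@measurable_id _ _ _)).
- by move=> r; rewrite -lerBlDr sub0r -normrN ler_norm.
- by move=> c r c0; rewrite normrM ger0_norm// mulrDr.
Qed.

End scaled_kernel.

Section sigma_finite_product.
Context {d1 d2 : measure_display} {T1 : measurableType d1}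
  {T2 : measurableType d2} {R : realType}.
Variable m1 : {sigma_finite_measure set T1 -> \bar R}.
Variable m2 : {sigma_finite_measure set T2 -> \bar R}.

(* The library declares [m1 \x m2] as a sigma-finite measure for
   subprobabilities only. *)
Definition sf_product : set (T1 * T2) -> \bar R := (m1 \x m2)%E.

HB.instance Definition _ := Measure.copy sf_product (m1 \x m2)%E.

Let sf_product_sigma_finite : sigma_finite setT sf_product.
Proof.
have /sigma_finiteP[F [TF ndF Foo]] := sigma_finiteT m1.
have /sigma_finiteP[G [TG ndG Goo]] := sigma_finiteT m2.
exists (fun n => F n `*` G n).
  rewrite -setXTT TF TG; apply/seteqP; split => [[x y] [/= [n _ Fn] [k _ Gk]]|].
    exists (maxn n k) => //; split => /=.
    - by move: x Fn; exact/subsetPset/ndF/leq_maxl.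
    - by move: y Gk; exact/subsetPset/ndG/leq_maxr.
  by move=> [x y] [n _ [/= Fn Gn]]; split; exists n.
move=> k; have [mF Fk] := Foo k; have [mG Gk] := Goo k.
split; first exact: measurableX.
by rewrite /sf_product product_measure1E// lte_mul_pinfty// ge0_fin_numE.
Qed.

HB.instance Definition _ := Measure_isSigmaFinite.Build _ _ _ sf_product
  sf_product_sigma_finite.

End sigma_finite_product.

Section kernel_moments.
Context {R : realType} {p : nat}.
Notation L2 := (@lebesgue_rV R 2).
Notation Lp := (@lebesgue_rV R p).
Notation m := (L2 \x Lp)%E.
Notation M := (sf_product L2 Lp).
Notation mm := (M \x M)%E.
Variables (f : 'rV[R]_2 * 'rV[R]_p -> R) (K : 'rV[R]_p -> R) (CK : R).
Notation fZ := (marginal_density f).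
Hypothesis mf : measurable_fun setT f.
Hypothesis f0 : forall x, 0 <= f x.
Hypothesis iK : Lp.-integrable setT (EFin \o K).
Hypothesis K1 : \int[Lp]_u K u = 1.
Hypothesis KC : forall u, `|K u| <= CK.
Variable nu : probability ('rV[R]_2 * 'rV[R]_p)%type R.
Hypothesis nuE : forall A, measurable A -> nu A = (\int[m]_(x in A) (f x)%:E)%E.
Variables (h Q : R) (z : 'rV[R]_p).
Hypothesis h0 : 0 < h.
Hypothesis iF : L2.-integrable setT (EFin \o (fun x => f (x, z))).

Let F (y : 'rV[R]_p) (x : 'rV[R]_2) := f (x, y).

Hypothesis kernel_l1 :
  (\int[Lp]_u (`|K u|%:E * l1_dist L2 F (z + h *: u)%R z) <= Q%:E)%E.

Let kz (y : 'rV[R]_p) := scaled_kernel K h (y - z).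
Let IK := \int[Lp]_u `|K u|.
(** [a] is the density weighted by the kernel, and [b] freezes the density at [z]. The latter is a
    tensor product, so its integrals factor, and the former is within [Q] of it in L^1. *)
Let a (w : 'rV[R]_2 * 'rV[R]_p) := f w * kz w.2.
Let b (w : 'rV[R]_2 * 'rV[R]_p) := f (w.1, z) * kz w.2.

Let mkz : measurable_fun setT kz.
Proof. exact: measurable_scaled_kernel. Qed.

Let mkz2 : measurable_fun setT (fun w : 'rV[R]_2 * 'rV[R]_p => kz w.2).
Proof. exact: measurableT_comp. Qed.

Let ikz : Lp.-integrable setT (EFin \o kz).
Proof. exact: integrable_scaled_kernel. Qed.

Let ib : m.-integrable setT (EFin \o b).
Proof. exact: (integrable_tensor iF ikz). Qed.

Let mF y : measurable_fun setT (F y).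
Proof. by apply: (measurableT_comp mf); exact: measurable_fun_pair. Qed.

Let mb : measurable_fun setT b.
Proof. by apply/measurable_EFinP; exact: measurable_int ib. Qed.

Let ma : measurable_fun setT a. Proof. exact: measurable_funM. Qed.

Let ab_small : (\int[m]_w `|a w - b w|%:E <= Q%:E)%E.
Proof.
apply: le_trans kernel_l1.
rewrite fubini_tonelli2//; last first.
  by apply: measurable_EFin; apply: measurableT_comp => //; exact: measurable_funB.
have mlz : measurable_fun setT (fun y => l1_dist L2 F y z).
  exact: measurable_l1_dist.
have lz0 y : (0 <= l1_dist L2 F y z)%E.
  by apply: integral_ge0 => x _; rewrite lee_fin.
have nM (c r : R) : 0 <= c -> `|c * r| = c * `|r|.
  by move=> c0; rewrite normrM ger0_norm.
have <- : (\int[Lp]_y (`|kz y|%:E * l1_dist L2 F y z) =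
    \int[Lp]_u (`|K u|%:E * l1_dist L2 F (z + h *: u)%R z))%E.
  exact: (ge0_integral_scaled_kernel z h0 iK (@normr_measurable _ _)
    (@normr_ge0 _ _) nM mlz lz0).
rewrite le_eqVlt; apply/orP; left; apply/eqP; apply: eq_integral => y _.
rewrite /fubini_G /l1_dist -ge0_integral_EFinZl//.
- by apply: eq_integral => x _; rewrite /a /b /= -mulrBl normrM mulrC.
- exact: measurable_l1_integrand.
Qed.

Lemma integrable_kernel_density : m.-integrable setT (EFin \o a).
Proof.
have iab : m.-integrable setT (EFin \o (fun w => a w - b w)).
  apply/integrableP; split; first by apply: measurable_EFin; exact: measurable_funB.
  by rewrite (le_lt_trans ab_small)// ltry.
rewrite (_ : a = fun w => (a w - b w) + b w); first exact: integrable_EFinD iab ib.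
by apply/funext => w; rewrite subrK.
Qed.

Let ia := integrable_kernel_density.

Let iab : m.-integrable setT (EFin \o (fun w => a w - b w)).
Proof. exact: integrable_EFinB ia ib. Qed.

Let ab_le : \int[m]_w `|a w - b w| <= Q.
Proof.
by rewrite -lee_fin -integral_EFin_fine//; exact: integrable_norm iab.
Qed.

Let b_norm : \int[m]_w `|b w| = fZ z * IK.
Proof.
have -> : \int[m]_w `|b w| = \int[m]_w (f (w.1, z) * `|kz w.2|).
  by apply: eq_Rintegral => w _; rewrite normrM ger0_norm.
by rewrite (integral_tensor iF (integrable_norm ikz)) integral_normr_scaled_kernel.
Qed.

Let a_norm : \int[m]_w `|a w| <= Q + fZ z * IK.
Proof.
rewrite -b_norm; apply: (@le_trans _ _ (\int[m]_w (`|a w - b w| + `|b w|))).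
  apply: le_Rintegral => //; first exact: integrable_norm ia.
    exact: integrable_EFinD (integrable_norm iab) (integrable_norm ib).
  by move=> w _; rewrite -[X in `|X|](subrK (b w)) ler_normD.
rewrite RintegralD//; [|exact: integrable_norm iab|exact: integrable_norm ib].
by rewrite lerD2r.
Qed.

Let kappa := CK * h ^- p.

Lemma scaled_kernel_le y : `|kz y| <= kappa.
Proof.
have hp : 0 <= h ^- p by rewrite invr_ge0 exprn_ge0// ltW.
by rewrite /kz /scaled_kernel normrM mulrC (ger0_norm hp) ler_wpM2r.
Qed.

(** One copy of the kernel is bounded by [kappa]; the other, integrated against the density, stays
    bounded as [h] tends to 0. The result is of order [h^-p], not [h^(-2p)]. *)
Lemma kernel_second_moment :
  \int[nu]_w (kz w.2 ^+ 2) <= kappa * (Q + fZ z * IK).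
Proof.
rewrite /Rintegral (integral_density mf f0 nuE); last exact: measurable_funX.
rewrite -[X in X <= _]/(Rintegral _ _ _).
have ika := integrable_EFinZl kappa (integrable_norm ia).
have le w : kz w.2 ^+ 2 * f w <= kappa * `|a w|.
  rewrite expr2 -mulrA [kz _ * f w]mulrC -/(a w) (le_trans (ler_norm _))// normrM.
  by rewrite ler_wpM2r// scaled_kernel_le.
apply: (@le_trans _ _ (\int[m]_w (kappa * `|a w|))).
  apply: le_Rintegral => //.
  apply: (le_integrable measurableT _ _ ika).
    by apply: measurable_EFin; apply: measurable_funM => //; exact: measurable_funX.
  move=> w _; rewrite /= lee_fin (ger0_norm (mulr_ge0 (sqr_ge0 _) (f0 _))).
  by rewrite (le_trans (le w))// ler_norm.
rewrite RintegralZl//; last exact: integrable_norm ia.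
by rewrite ler_wpM2l// (le_trans _ (scaled_kernel_le z)).
Qed.

Variables (G : 'rV[R]_2 * 'rV[R]_2 -> R) (CG : R).
Hypothesis mG : measurable_fun setT G.
Hypothesis GC : forall x, `|G x| <= CG.

Let G' (x : ('rV[R]_2 * 'rV[R]_p) * ('rV[R]_2 * 'rV[R]_p)) := G (x.1.1, x.2.1).

Let iaM : M.-integrable setT (EFin \o a). Proof. exact: ia. Qed.
Let ibM : M.-integrable setT (EFin \o b). Proof. exact: ib. Qed.

Let mG' : measurable_fun setT G'.
Proof.
apply: (measurableT_comp mG); apply: measurable_fun_pair => //.
  by apply: (measurableT_comp (f := fst)).
by apply: (measurableT_comp (f := fst)).
Qed.

Lemma kernel_pair_expectation :
  \int[(nu \x nu)%E]_x (kz x.1.2 * kz x.2.2 * G (x.1.1, x.2.1)) =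
  \int[mm]_x (G' x * (a x.1 * a x.2)).
Proof.
have mff : measurable_fun setT
    (fun x : ('rV[R]_2 * 'rV[R]_p) * ('rV[R]_2 * 'rV[R]_p) => f x.1 * f x.2).
  by apply: measurable_funM; exact: measurableT_comp.
rewrite /Rintegral (integral_density (mu := mm) (nu := (nu \x nu)%E) mff); last 3 first.
- by move=> x; exact: mulr_ge0.
- by move=> A mA; exact: product_density.
- apply: measurable_funM; last exact: mG'.
  by apply: measurable_funM; apply: (measurableT_comp mkz2).
congr fine; apply: eq_integral => x _; congr _%:E; rewrite /a /G'; ring.
Qed.

(** With the density frozen at [z], the two kernels integrate out to 1 each, so the identity is
    exact for every [h]. *)
Lemma kernel_pair_limit :
  \int[mm]_x (G' x * (b x.1 * b x.2)) =
  \int[(L2 \x L2)%E]_x (G x * (f (x.1, z) * f (x.2, z))).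
Proof.
have kz1 : \int[Lp]_y kz y = 1 by rewrite integral_scaled_kernel.
have mGx x : measurable_fun setT (fun x' => G (x, x')).
  by apply: (measurableT_comp mG); exact: measurable_fun_pair.
have iGF x : L2.-integrable setT (EFin \o (fun x' => G (x, x') * f (x', z))).
  apply: (le_integrable measurableT _ _ (integrable_EFinZl CG iF)).
    by apply: measurable_EFin; apply: measurable_funM => //; exact: mF.
  move=> x' _; rewrite /= lee_fin !normrM ler_wpM2r//.
  by rewrite (le_trans (GC _))// ler_norm.
pose J x := \int[L2]_x' (G (x, x') * f (x', z)).
have iGbb : mm.-integrable setT (EFin \o (fun x => G' x * (b x.1 * b x.2))).
  exact: (@integrable_tensor_mul _ _ _ _ G' CG mG' (fun x => GC _) b b ibM ibM).
have iGff : (L2 \x L2)%E.-integrable setT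
    (EFin \o (fun x => G x * (f (x.1, z) * f (x.2, z)))).
  exact: (integrable_tensor_mul mG GC iF iF).
have iFJ : L2.-integrable setT (EFin \o (fun x => f (x, z) * J x)).
  have := integrable_fubini_F iGff.
  apply: eq_integrable => // x _; rewrite /fubini_F /=.
  under eq_integral do rewrite mulrCA.
  by rewrite (integral_EFin_fine (integrable_EFinZl _ (iGF x))) RintegralZl.
rewrite {1}/Rintegral -(integral12_prod_meas1 iGbb) [in RHS]/Rintegral.
rewrite -(integral12_prod_meas1 iGff).
transitivity (fine (\int[m]_w ((f (w.1, z) * J w.1) * kz w.2)%:E)%E).
  congr fine; apply: eq_integral => w _; rewrite /fubini_F /=.
  transitivity (\int[m]_w' ((b w) * ((G (w.1, w'.1) * f (w'.1, z)) * kz w'.2))%:E)%E.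
    by apply: eq_integral => w' _; congr _%:E; rewrite /G' /b /=; ring.
  have iT := integrable_tensor (iGF w.1) ikz.
  rewrite (integral_EFin_fine (integrable_EFinZl (b w) iT)) RintegralZl//.
  rewrite (integral_tensor (iGF w.1) ikz) kz1 mulr1 /b -/(J w.1).
  by congr _%:E; ring.
rewrite -[LHS]/(Rintegral _ _ _) (integral_tensor iFJ ikz) kz1 mulr1.
congr fine; apply: eq_integral => x _; rewrite /fubini_F /=.
under [RHS]eq_integral do rewrite mulrCA.
by rewrite (integral_EFin_fine (integrable_EFinZl _ (iGF x))) RintegralZl.
Qed.

Lemma kernel_pair_bias :
  `|\int[(nu \x nu)%E]_x (kz x.1.2 * kz x.2.2 * G (x.1.1, x.2.1)) -
    \int[(L2 \x L2)%E]_x (G x * (f (x.1, z) * f (x.2, z)))| <=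
  CG * (Q * (Q + 2 * (fZ z * IK))).
Proof.
rewrite kernel_pair_expectation -kernel_pair_limit.
have GC' x : `|G' x| <= CG by exact: GC.
apply: (le_trans (tensor_difference mG' GC' iaM ibM)).
have CG0 : 0 <= CG by rewrite (le_trans _ (GC (0, 0))).
rewrite ler_wpM2l// ler_pM//.
- by apply: Rintegral_ge0.
- by apply: addr_ge0; apply: Rintegral_ge0.
- by rewrite b_norm mulr_natl mulr2n addrA lerD2r.
Qed.

End kernel_moments.

(** * Deviation of kernel statistics *)

Section vstat.
Context {d : measure_display} {Omega : measurableType d} {R : realType}.
Variable P : probability Omega R.
Context {d' : measure_display} {T : measurableType d'}.
Variables (Y : nat -> Omega -> T) (nu : probability T R).
Hypothesis mY : forall i, measurable_fun setT (Y i).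
Hypothesis Y_indep : mutually_independent P Y.
Hypothesis Y_law : forall i A, measurable A -> P (Y i @^-1` A) = nu A.

Definition vstat (q : T * T -> R) n w : R :=
  n%:R ^- 2 * \sum_(i < n) \sum_(j < n) q (Y i w, Y j w).

Lemma measurable_vstat q n : measurable_fun setT q ->
  measurable_fun setT (vstat q n).
Proof.
move=> mq; apply: measurable_funM => //; apply: measurable_sum => i.
apply: measurable_sum => j.
by apply: measurableT_comp => //; exact: measurable_fun_pair.
Qed.

(** The [n] diagonal terms contribute at most [B / n], and the change of normalization from
    [n (n - 1)] to [n^2] contributes as much again. *)
Lemma vstat_ustat_le q n (B : R) w : (1 < n)%N -> (forall x, `|q x| <= B) ->
  `|vstat q n w - ustat Y q n w| <= 2 * B / n%:R.
Proof.
move=> n1 qB; set S := \sum_(i < n) \sum_(j < n | j != i) q (Y i w, Y j w).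
pose D := \sum_(i < n) q (Y i w, Y i w).
have n0 : 0 < n%:R :> R by rewrite ltr0n ltnW.
have n10 : 0 < n.-1%:R :> R by rewrite ltr0n; lia.
have nE : n%:R = n.-1%:R + 1 :> R by rewrite natr1 prednK// ltnW.
have VE : vstat q n w = n%:R ^- 2 * (D + S).
  rewrite /vstat -big_split /=; congr (_ * _); apply: eq_bigr => i _.
  by rewrite (bigD1 i).
have UE : ustat Y q n w = (n%:R * n.-1%:R)^-1 * S by rewrite /ustat natrM.
have DB : `|D| <= n%:R * B.
  rewrite (le_trans (ler_norm_sum _ _ _))// (le_trans (ler_sum _ (fun i _ => qB _)))//.
  by rewrite sumr_const card_ord -[leLHS]mulr_natl.
have SB : `|S| <= n%:R * (n.-1%:R * B).
  rewrite (le_trans (ler_norm_sum _ _ _))//.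
  apply: (@le_trans _ _ (\sum_(i < n) (n.-1%:R * B))); last first.
    by rewrite sumr_const card_ord -[leLHS]mulr_natl.
  apply: ler_sum => i _; rewrite (le_trans (ler_norm_sum _ _ _))//.
  rewrite (le_trans (ler_sum _ (fun j _ => qB _)))//.
  by rewrite sumr_const cardC1 card_ord -[leLHS]mulr_natl.
have -> : vstat q n w - ustat Y q n w =
    n%:R ^- 2 * D - n%:R ^- 2 * n.-1%:R^-1 * S.
  by rewrite VE UE; move: nE => ->; field; rewrite -?nE !gt_eqF// -nE.
have a0 : 0 <= n%:R ^- 2 :> R by rewrite invr_ge0 exprn_ge0.
have b0 : 0 <= n%:R ^- 2 * n.-1%:R^-1 :> R by rewrite mulr_ge0// invr_ge0.
rewrite (le_trans (ler_normB _ _))// normrM [X in _ + X]normrM.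
rewrite (ger0_norm a0) (ger0_norm b0).
have -> : 2 * B / n%:R = n%:R ^- 2 * (n%:R * B) +
    n%:R ^- 2 * n.-1%:R^-1 * (n%:R * (n.-1%:R * B)).
  by field; rewrite !gt_eqF.
by apply: lerD; rewrite ler_wpM2l.
Qed.

(** The one-sided bound is applied to [q] and to [- q] at level [eps / 2]; the other half of [eps]
    pays for the bias and the diagonal. *)
Lemma vstat_deviation (q : T * T -> R) n (B s2 t eps theta : R) : (1 < n)%N ->
  measurable_fun setT q -> (forall x, `|q x| <= B) ->
  \int[(nu \x nu)%E]_x (q x ^+ 2) <= s2 ->
  0 <= t -> 4 * (t * B) <= 1 ->
  `|\int[(nu \x nu)%E]_x q x - theta| + 2 * B / n%:R <= eps / 2 ->
  (P [set w | (eps <= `|vstat q n w - theta|)%R] <=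
   (2 * expR (- (n./2%:R * (t * (eps / 2) - 2 * t ^+ 2 * s2))))%:E)%E.
Proof.
move=> n1 mq qB q2 t0 tB bias; set mu := \int[_]_x q x in bias *.
have mNq : measurable_fun setT (fun x => - q x) by exact: measurableT_comp.
have NqB x : `|- q x| <= B by rewrite normrN.
have Nq2 : \int[(nu \x nu)%E]_x ((- q x) ^+ 2) <= s2.
  by under eq_Rintegral do rewrite sqrrN.
have iq : (nu \x nu)%E.-integrable setT (EFin \o q).
  exact: (bounded_integrable _ mq qB).
have muN : \int[(nu \x nu)%E]_x (- q x) = - mu.
  under eq_Rintegral do rewrite -mulN1r.
  by rewrite RintegralZl// mulN1r.
have UN w : ustat Y (fun x => - q x) n w = - ustat Y q n w.
  rewrite /ustat -mulrN; congr (_ * _); rewrite -sumrN.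
  by apply: eq_bigr => i _; rewrite sumrN.
have d1 := ustat_deviation mY Y_indep Y_law (eps / 2) n1 mq qB q2 t0 tB.
have d2 := ustat_deviation mY Y_indep Y_law (eps / 2) n1 mNq NqB Nq2 t0 tB.
rewrite -/mu in d1; rewrite muN in d2.
set A1 := [set w | _] in d1; set A2 := [set w | _] in d2.
have msub (u : Omega -> R) (c c' : R) : measurable_fun setT u ->
    measurable [set w | c <= u w - c'].
  move=> mu0; rewrite (_ : [set _ | _] = (fun w => u w - c') @^-1` `[c, +oo[).
    by rewrite -[X in measurable X]setTI; apply: measurable_funB.
  by apply/seteqP; split => w; rewrite /= in_itv /= andbT.
have mA1 : measurable A1 by apply: msub; exact: measurable_ustat.
have mA2 : measurable A2 by apply: msub; exact: measurable_ustat.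
have mV : measurable [set w | eps <= `|vstat q n w - theta|].
  rewrite (_ : [set _ | _] = [set w | eps <= `|vstat q n w - theta| - 0]).
    apply: msub; apply: measurableT_comp => //; apply: measurable_funB => //.
    exact: measurable_vstat.
  by apply/seteqP; split => w; rewrite /= subr0.
apply: (@le_trans _ _ (P (A1 `|` A2))).
  rewrite le_measure ?inE//; first exact: measurableU.
  move=> w /= epsV.
  have := vstat_ustat_le w n1 qB; rewrite /A1 /A2 /= UN.
  set u := ustat Y q n w; set v := vstat q n w in epsV *; move: epsV bias.
  case: (lerP 0 (u - mu)) => [h0|h0] epsV bias uv.
    left; rewrite -/u.
    have : eps <= `|v - u| + `|u - mu| + `|mu - theta|.
      rewrite (le_trans epsV)// (le_trans (ler_distD u _ _))// -addrA lerD2l.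
      exact: ler_distD.
    rewrite (ger0_norm h0); lra.
  right; rewrite -/u.
  have : eps <= `|v - u| + `|u - mu| + `|mu - theta|.
    rewrite (le_trans epsV)// (le_trans (ler_distD u _ _))// -addrA lerD2l.
    exact: ler_distD.
  rewrite (ltr0_norm h0); lra.
rewrite (le_trans (measureU2 P mA1 mA2))// mulr_natl mulr2n EFinD.
exact: leeD.
Qed.

End vstat.

Lemma double_le_quarter {R : realFieldType} (b c : R) : 8 * b <= c -> 2 * b <= c / 4.
Proof. lra. Qed.

Lemma quarter_le_half {R : realFieldType} (b c : R) : b <= c / 4 -> c / 4 <= c / 2 - b.
Proof. lra. Qed.

Lemma quarter_le_halfn {R : realFieldType} n : (1 < n)%N -> n%:R / 4 <= n./2%:R :> R.
Proof. by move=> n1; rewrite ler_pdivrMr// -natrM ler_nat; lia. Qed.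

Section kernel_vstat.
Context {R : realType} {p : nat}.
Notation L2 := (@lebesgue_rV R 2).
Notation Lp := (@lebesgue_rV R p).
Variables (f : 'rV[R]_2 * 'rV[R]_p -> R) (K : 'rV[R]_p -> R) (alpha : nat)
  (Z : set 'rV[R]_p).
Notation fZ := (marginal_density f).
Hypothesis mf : measurable_fun setT f.
Hypothesis f0 : forall x, 0 <= f x.
Hypothesis f1 : (\int[L2 \x Lp]_x (f x)%:E = 1)%E.
Hypothesis cZ : compact Z.
Hypothesis A1 : kernel_of_order alpha K.
Hypothesis A2 : smooth_marginal alpha K Z f.
Hypothesis A3 : bounded_marginal Z f.
Hypothesis alpha_gt1 : (1 < alpha)%N.
Hypothesis cf : forall z, Z z ->
  {ae L2, forall x, {for z, continuous (fun y => f (x, y))}}.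
Context {d : measure_display} {Omega : measurableType d}.
Variable P : probability Omega R.
Variables (Y : nat -> Omega -> 'rV[R]_2 * 'rV[R]_p)
  (nu : probability ('rV[R]_2 * 'rV[R]_p)%type R).
Hypothesis mY : forall i, measurable_fun setT (Y i).
Hypothesis Y_indep : mutually_independent P Y.
Hypothesis Y_law : forall i A, measurable A -> P (Y i @^-1` A) = nu A.
Hypothesis nuE : forall A, measurable A ->
  nu A = (\int[(L2 \x Lp)%E]_(x in A) (f x)%:E)%E.

Lemma integrable_section z : Z z -> L2.-integrable setT (EFin \o (fun x => f (x, z))).
Proof.
move=> Zz; apply: integrable_of_fine => //.
  by apply: (measurableT_comp mf); exact: measurable_fun_pair.
have [fmin [fmax [fmin0 _ hf]]] := A3.
by have /andP[h _] := hf z Zz; exact: lt_le_trans h.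
Qed.

Definition pair_kernel (G : 'rV[R]_2 * 'rV[R]_2 -> R) (h : R) (z : 'rV[R]_p)
    (x : ('rV[R]_2 * 'rV[R]_p) * ('rV[R]_2 * 'rV[R]_p)) : R :=
  scaled_kernel K h (x.1.2 - z) * scaled_kernel K h (x.2.2 - z) *
  G (x.1.1, x.2.1).

Definition pair_limit (G : 'rV[R]_2 * 'rV[R]_2 -> R) (z : 'rV[R]_p) : R :=
  \int[(L2 \x L2)%E]_x (G x * (f (x.1, z) * f (x.2, z))).

Lemma measurable_pair_kernel G h z : 0 < h -> measurable_fun setT G ->
  measurable_fun setT (pair_kernel G h z).
Proof.
move=> h0 mG; have [_ _ iK _ _] := A1.
have mk := @measurable_scaled_kernel R p K h z iK.
apply: measurable_funM.
  by apply: measurable_funM; apply: (measurableT_comp mk); exact: measurableT_comp.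
apply: (measurableT_comp mG); apply: measurable_fun_pair => //.
  by apply: (measurableT_comp (f := fst)).
by apply: (measurableT_comp (f := fst)).
Qed.

(** With [L = h^(2p)] and [t = t0 L], the bound on the kernel and its second moment are both
    constants over [L], so the constants found below depend neither on [h] nor on [z]. *)
Lemma kernel_vstat_deviation (G : 'rV[R]_2 * 'rV[R]_2 -> R) (CG eps : R) :
  measurable_fun setT G ->
  (forall x, `|G x| <= CG) -> 0 < eps ->
  exists A c delta : R, [/\ 0 < A, 0 < delta & forall n h z, 0 < h < delta ->
    Z z -> c <= n%:R * h ^+ (2 * p) ->
    (P [set w | (eps <= `|vstat Y (pair_kernel G h z) n w - pair_limit G z|)%R]
     <= (2 * expR (- (A * n%:R * h ^+ (2 * p))))%:E)%E].
Proof.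
move=> mG GC eps0.
have [[CK KC] _ iK K1 _] := A1; have [fmin [fmax [_ fmax0 hf]]] := A3.
have CK0 : 0 <= CK by rewrite (le_trans _ (KC 0)).
have CG0 : 0 <= CG by rewrite (le_trans _ (GC (0, 0))).
set IK := \int[Lp]_u `|K u|.
have IK0 : 0 <= IK by exact: Rintegral_ge0.
pose W := (CG + 1) * (1 + 2 * (fmax * IK)).
have fI0 : 0 <= fmax * IK by rewrite mulr_ge0// ltW.
have W0 : 0 < W by rewrite mulr_gt0//; lra.
(* The bias is at most [CG Q (Q + 2 fmax IK)], hence at most [Q W <= eps / 4] as [Q <= 1]. *)
pose Q := Num.min 1 (eps / (4 * W)).
have Q0 : 0 < Q by rewrite lt_min ltr01 divr_gt0// mulr_gt0.
have Q1 : Q <= 1 by rewrite ge_min lexx.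
have QW : Q * W <= eps / 4.
  rewrite -ler_pdivlMr// /Q ge_min; apply/orP; right.
  by rewrite le_eqVlt; apply/orP; left; apply/eqP; field; rewrite gt_eqF.
have [delta1 delta10 hdelta] := kernel_l1_small mf f0 f1 cZ A1 A2 A3 alpha_gt1 cf Q0.
pose C2 := CK * (1 + fmax * IK).
pose S := CG ^+ 2 * C2 ^+ 2.
have S0 : 0 <= S by rewrite mulr_ge0// sqr_ge0.
pose B0 := CG * CK ^+ 2.
have B00 : 0 <= B0 by rewrite mulr_ge0// sqr_ge0.
(* With [t = L / D], the first summand gives [4 t B <= 1], and the second keeps the variance term
   below half of the linear gain [t eps / 2]. *)
pose D := 4 * B0 + 8 * S / eps + 1.
have D1 : 1 <= D.
  rewrite lerDr; apply: addr_ge0; first exact: mulr_ge0.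
  by apply: divr_ge0; [exact: mulr_ge0|exact: ltW].
have D0 : 0 < D by exact: lt_le_trans D1.
pose t0 := D^-1.
have t00 : 0 < t0 by rewrite invr_gt0.
(* The 16 comes from [n./2 >= n / 4] and from the gain [eps / 4] left after the variance term. In
   the threshold, [8 * B0 / eps] makes the diagonal correction at most [eps / 4], and 2 forces
   [n > 1] since [h < 1]. *)
exists (t0 * eps / 16), (8 * B0 / eps + 2), (Num.min 1 delta1).
split; first by rewrite divr_gt0// mulr_gt0.
  by rewrite lt_min ltr01.
move=> n h z /andP[h0]; rewrite lt_min => /andP[h1 hd] Zz.
set L := h ^+ (2 * p) => cL.
have L0 : 0 < L by rewrite exprn_gt0.
have L1 : L <= 1 by rewrite exprn_ile1// ltW.
pose H := h ^- p.
have HL : H ^+ 2 * L = 1.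
  by rewrite /H /L mulnC exprM -exprMn mulVf ?expr1n// expf_neq0// gt_eqF.
have H0 : 0 <= H by rewrite invr_ge0 exprn_ge0// ltW.
have c2 : 2 <= 8 * B0 / eps + 2.
  by rewrite lerDr; apply: divr_ge0; [exact: mulr_ge0|exact: ltW].
have n1 : (1 < n)%N.
  rewrite -(ler_nat R) (le_trans c2)// (le_trans cL)// -[leRHS]mulr1.
  by rewrite ler_wpM2l.
have n0 : 0 < n%:R :> R by rewrite ltr0n ltnW.
have iF := integrable_section Zz.
have hh : 0 < h < delta1 by rewrite h0.
have l1 := hdelta h z hh Zz.
have fz := hf z Zz; have /andP[_ fzmax] := fz.
have fz0 : 0 <= fZ z by exact: marginal_density_ge0.
have fzI : fZ z * IK <= fmax * IK by rewrite ler_wpM2r.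
have fzI0 : 0 <= fZ z * IK by rewrite mulr_ge0.
have bias := kernel_pair_bias mf f0 iK K1 nuE h0 iF l1 mG GC.
have k2 := kernel_second_moment mf f0 iK KC nuE h0 iF l1.
have kle y := scaled_kernel_le KC z h0 y.
pose k (y : 'rV[R]_p) := scaled_kernel K h (y - z).
have mk : measurable_fun setT k by exact: measurable_scaled_kernel.
have mk2 : measurable_fun setT (fun w : 'rV[R]_2 * 'rV[R]_p => k w.2).
  exact: measurableT_comp.
pose q := pair_kernel G h z.
have mq : measurable_fun setT q by exact: measurable_pair_kernel.
have qB x : `|q x| <= (CK * H) * (CK * H) * CG.
  rewrite /q /pair_kernel normrM [X in X * _]normrM; apply: ler_pM => //.
  by apply: ler_pM => //; exact: kle.
have ik2 : nu.-integrable setT (EFin \o (fun w => k w.2 ^+ 2)).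
  apply: (@bounded_integrable _ _ _ _ _ ((CK * H) ^+ 2)).
    exact: measurable_funX.
  by move=> w; rewrite normrX lerXn2r ?nnegrE ?mulr_ge0//; exact: kle.
have k2' : \int[nu]_w (k w.2 ^+ 2) <= C2 * H.
  apply: (le_trans k2); rewrite -/H -/IK /C2 (mulrAC CK _ H) ler_wpM2l//.
    exact: mulr_ge0.
  exact: lerD.
have q2 : \int[(nu \x nu)%E]_x (q x ^+ 2) <= S * H ^+ 2.
  have iq2 := integrable_tensor ik2 ik2.
  apply: (@le_trans _ _ (CG ^+ 2 * \int[(nu \x nu)%E]_x (k x.1.2 ^+ 2 * k x.2.2 ^+ 2))).
    rewrite -RintegralZl//; apply: le_Rintegral => //.
    - apply: (@bounded_integrable _ _ _ _ _ (((CK * H) * (CK * H) * CG) ^+ 2)).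
        exact: measurable_funX.
      by move=> x; rewrite normrX lerXn2r ?nnegrE ?mulr_ge0.
    - exact: (integrable_EFinZl (CG ^+ 2) iq2).
    move=> x _; rewrite /q /pair_kernel exprMn mulrC exprMn ler_wpM2r//.
      by rewrite mulr_ge0// sqr_ge0.
    by rewrite -[X in X ^+ 2 <= _]/(G _) -real_normK ?num_real// lerXn2r ?nnegrE.
  rewrite (integral_tensor ik2 ik2) /S -mulrA ler_wpM2l ?sqr_ge0// -exprMn expr2.
  by rewrite ler_pM//; apply: Rintegral_ge0 => w _; exact: sqr_ge0.
(* From here on only [H^2 L = 1], the signs and the bounds on [L] matter. *)
clearbody H L.
have tB : 4 * (t0 * L * ((CK * H) * (CK * H) * CG)) <= 1.
  have -> : 4 * (t0 * L * ((CK * H) * (CK * H) * CG)) = t0 * (4 * B0) * (H ^+ 2 * L).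
    by rewrite /B0; ring.
  rewrite HL mulr1 mulrC ler_pdivrMr// mul1r /D -addrA lerDl.
  by apply: addr_ge0 => //; apply: divr_ge0; [exact: mulr_ge0|exact: ltW].
have biasL : `|\int[(nu \x nu)%E]_x q x - pair_limit G z| +
    2 * ((CK * H) * (CK * H) * CG) / n%:R <= eps / 2.
  have b1 : `|\int[(nu \x nu)%E]_x q x - pair_limit G z| <= eps / 4.
    apply: (le_trans bias); apply: le_trans QW.
    rewrite /W mulrCA ler_wpM2l ?(ltW Q0)// ler_pM//.
    - by rewrite addr_ge0 ?mulr_ge0// ltW.
    - by rewrite lerDl.
    - by rewrite lerD// ler_wpM2l.
  have b2 : 2 * ((CK * H) * (CK * H) * CG) / n%:R <= eps / 4.
    have -> : 2 * ((CK * H) * (CK * H) * CG) / n%:R = 2 * B0 * H ^+ 2 / n%:R.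
      by rewrite /B0; ring.
    rewrite ler_pdivrMr//.
    have : 8 * B0 / eps <= n%:R * L by apply: le_trans cL; rewrite lerDl.
    rewrite ler_pdivrMr// => h8.
    rewrite -(ler_pM2r L0) -[leLHS]mulrA HL mulr1.
    have -> : eps / 4 * n%:R * L = n%:R * L * eps / 4 by field.
    exact: double_le_quarter.
  have -> : eps / 2 = eps / 4 + eps / 4 by field.
  exact: lerD.
have t0L : 0 <= t0 * L by rewrite mulr_ge0// ltW.
apply: (le_trans (vstat_deviation mY Y_indep Y_law n1 mq qB q2 t0L tB biasL)).
rewrite lee_fin ler_pM2l// ler_expR lerN2.
have n4 : n%:R / 4 <= n./2%:R :> R.
  exact: quarter_le_halfn.
have -> : t0 * L * (eps / 2) - 2 * (t0 * L) ^+ 2 * (S * H ^+ 2) =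
    L * t0 * (eps / 2 - 2 * t0 * S * (H ^+ 2 * L)) by ring.
rewrite HL mulr1.
have tS : 2 * t0 * S <= eps / 4.
  have : 8 * S / eps <= D.
    by rewrite /D addrAC lerDr; apply: addr_ge0 => //; exact: mulr_ge0.
  rewrite ler_pdivrMr// => h8.
  have -> : 2 * t0 * S = (2 * S) / D by rewrite /t0; ring.
  rewrite ler_pdivrMr//; have -> : eps / 4 * D = D * eps / 4 by field.
  exact: double_le_quarter.
have -> : t0 * eps / 16 * n%:R * L = n%:R / 4 * (L * t0 * (eps / 4)) by field.
rewrite ler_pM//.
- by apply: mulr_ge0; [rewrite mulrC|apply: divr_ge0 => //; exact: ltW].
- by rewrite ler_wpM2l//; [rewrite mulrC|exact: quarter_le_half].
Qed.

End kernel_vstat.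

(** * Consequences of the smoothness of the joint density *)

Section joint_continuity.
Context {R : realType} {p : nat}.
Notation L2 := (@lebesgue_rV R 2).
Notation Lp := (@lebesgue_rV R p).
Variables (f : 'rV[R]_2 * 'rV[R]_p -> R) (K : 'rV[R]_p -> R) (alpha : nat)
  (Z : set 'rV[R]_p).
Hypothesis p_gt0 : (0 < p)%N.
Hypothesis alpha_gt0 : (0 < alpha)%N.
Hypothesis iK : Lp.-integrable setT (EFin \o K).
Hypothesis K1 : \int[Lp]_u K u = 1.
Hypothesis A4 : smooth_joint alpha K Z f.

Let mK : measurable_fun setT K.
Proof. by apply/measurable_EFinP; exact: measurable_int iK. Qed.

Let KN0 := [set u | K u != 0].

Let mKN0 : measurable KN0.
Proof.
rewrite (_ : KN0 = K @^-1` (~` [set 0])).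
  by rewrite -[X in measurable X]setTI; apply: mK => //; exact: measurableC.
by apply/seteqP; split => u /=; move=> /eqP.
Qed.

Let KN0_gt0 : (0 < Lp KN0)%E.
Proof.
rewrite lt0e measure_ge0 andbT; apply/eqP => KN00.
have : \int[Lp]_u K u = 0.
  rewrite /Rintegral (ae_eq_integral (cst 0%E))//.
  - by rewrite integral_cst// mul0e.
  - exact: measurable_EFin.
  - exists KN0; split => // u /= h; apply/eqP => Ku; apply: h => _.
    by rewrite Ku.
by rewrite K1 => /eqP; rewrite oner_eq0.
Qed.

Let ip : 'I_p := Ordinal p_gt0.
Let iota : alpha.-tuple 'I_p := nseq_tuple alpha ip.

Let mono_iota (v : 'rV[R]_p) : v 0 ip != 0 -> monomial iota v != 0.
Proof.
move=> v0; rewrite /monomial big_nseq.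
by elim: alpha => [|n IH] /=; rewrite ?oner_eq0// mulf_neq0.
Qed.

Let coord0 := [set v : 'rV[R]_p | v 0 ip = 0].

Let mcoord0 : measurable coord0.
Proof.
rewrite (_ : coord0 = (fun v : 'rV[R]_p => v 0 ip) @^-1` [set 0])//.
by rewrite -[X in measurable X]setTI; exact: measurable_mx_entry.
Qed.

Let KM0_gt0 : (0 < Lp (KN0 `\` coord0))%E.
Proof.
have mD : measurable (KN0 `\` coord0) by exact: measurableD.
rewrite lt0e measure_ge0 andbT; apply/eqP => D0.
have : (Lp KN0 <= Lp (KN0 `\` coord0) + Lp coord0)%E.
  apply: (le_trans _ (measureU2 Lp mD mcoord0)).
  rewrite le_measure ?inE//; first exact: measurableU.
  by move=> u Ku; have [u0|u0] := pselect (coord0 u); [right|left].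
rewrite D0 lebesgue_rV_hyperplane add0e => h.
by have := lt_le_trans KN0_gt0 h; rewrite ltxx.
Qed.

(** A nonexistent derivative counts as infinite in the suprema of (A4), so finiteness of the
    integrand, where its weights do not vanish, yields differentiability. The term [k = 0] leaves
    [f(x1, .)] underived and puts all [alpha] derivatives on [f(x2, .)]. *)
Lemma joint_continuous z : Z z ->
  {ae L2, forall x, {for z, continuous (fun y => f (x, y))}}.
Proof.
move=> Zz; have [_ iW _] := A4.
(* In the first case everything is null; in the second [x1] contributes positive mass to the set
   used below. *)
have [L20|L20] := eqVneq (L2 setT) 0%E.
  by exists setT; split.
have := integrable_ae measurableT (iW z 0%N iota Zz (leq0n _)).
case=> N [mN N0 WN].
(* Fubini fixes [(u, v, x1)] with nonzero weights such that almost every [x2] is good. *)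
have [w [Gw Nw]] : exists w : 'rV[R]_p * 'rV[R]_p * 'rV[R]_2,
    (KN0 `*` (KN0 `\` coord0) `*` setT) w /\ (L2 (xsection N w) = 0)%E.
  apply: contrapT => noW.
  pose GG := (KN0 `*` (KN0 `\` coord0) `*` [set: 'rV[R]_2]).
  have mKM : measurable (KN0 `\` coord0) by exact: measurableD.
  have mGG : measurable GG by do ?[apply: measurableX => //].
  have GG0 : (0 < (Lp \x Lp \x L2) GG)%E.
    rewrite product_measure1E//; last exact: measurableX.
    rewrite mule_gt0//; last by rewrite lt0e L20 measure_ge0.
    rewrite /= product_measure1E//; exact: mule_gt0.
  have : (0 < \int[(Lp \x Lp \x L2)%E]_w (L2 \o xsection N) w)%E.
    apply: (integral_gt0 measurableT mGG _ _ _ _ GG0) => //.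
    - exact: measurable_fun_xsection.
    - move=> w Gw; rewrite lt0e measure_ge0 andbT; apply/eqP => Nw0.
      by apply: noW; exists w.
  by rewrite -[X in (0 < X)%E]/((Lp \x Lp \x L2 \x L2)%E N) N0 ltxx.
move: w Gw Nw => [[u v] x1] /= [[Ku [Kv v0]] _] Nw.
exists (xsection N (u, v, x1)); split => //.
  exact: measurable_xsection.
apply: subset_trans (_ : ~` [set x2 |
  weighted_sup_partials K f 0 iota z (u, v, x1, x2) \is a fin_num] `<=` _); last first.
  move=> x2 /= h; rewrite /xsection /= inE; apply: WN => /= h'; apply: h; exact: h'.
move=> x2 /= ncf Wfin; apply: ncf.
set S := sup_partials _ _ _ _ _ _ _ _ in Wfin.
have c1 : 0 < `|K u| * `|K v| by rewrite mulr_gt0// normr_gt0.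
have c2 : 0 < `|monomial (take 0 iota) u * monomial (drop 0 iota) v|.
  by rewrite normr_gt0 take0 drop0 /monomial big_nil mul1r mono_iota//; apply/eqP.
(* At [t = 0] both translates are [z] itself. *)
have t0 : `[0, 1]%classic (0 : R) by rewrite /= in_itv /= lexx ler01.
have S0 : (abs_partials_prod (fun y => f (x1, y)) (fun y => f (x2, y))
    (take 0 iota) (drop 0 iota) (z + 0 *: u) (z + 0 *: v) <= S)%E.
  by apply: ereal_sup_ubound; exists 0.
have Soo : S != +oo%E.
  apply/eqP => Soo; move: Wfin; rewrite /weighted_sup_partials -/S Soo.
  by rewrite -EFinM gt0_muley ?lte_fin// gt0_mulye ?lte_fin.
have : abs_partials_prod (fun y => f (x1, y)) (fun y => f (x2, y))
    (take 0 iota) (drop 0 iota) (z + 0 *: u) (z + 0 *: v) != +oo%E.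
  by rewrite -lteey (le_lt_trans S0)// lteey.
rewrite /abs_partials_prod; case: asboolP => // -[_ td] _.
rewrite scale0r addr0 drop0 size_tuple in td.
have : differentiable (partials [::] (fun y => f (x2, y))) z.
  exact: times_differentiable_partials td _.
exact: differentiable_continuous.
Qed.

End joint_continuity.

Lemma g_choice_le {R : realType} (g : 'rV[R]_2 -> 'rV[R]_2 -> R) x1 x2 :
  g = g1 \/ g = g2 \/ g = g3 -> `|g x1 x2| <= 3.
Proof.
case=> [->|[->|->]]; rewrite ?/g1 ?/g2 ?/g3 ler_norml.
- have h (b : bool) : (-3 : R) <= 4 * b%:R - 1 <= (3 : R).
    by case: b; rewrite /= ?mulr1n ?mulr0n; apply/andP; split; lra.
  exact: h.
- have h (b c : bool) : (-3 : R) <= b%:R - c%:R <= (3 : R).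
    by case: b; case: c; rewrite /= ?mulr1n ?mulr0n; apply/andP; split; lra.
  exact: h.
- have h (b : bool) : (-3 : R) <= 1 - 4 * b%:R <= (3 : R).
    by case: b; rewrite /= ?mulr1n ?mulr0n; apply/andP; split; lra.
  exact: h.
Qed.

Lemma measurable_natr_bool {d : measure_display} {T : measurableType d}
    {R : realType} (b : T -> bool) : measurable_fun setT b ->
  measurable_fun setT (fun x => (b x)%:R : R).
Proof.
move=> mb; have mB : measurable (b @^-1` [set true]).
  by rewrite -[X in measurable X]setTI; exact: mb.
rewrite (_ : (fun x => _) = \1_(b @^-1` [set true])); first exact: measurable_indic.
apply/funext => x; rewrite indicE; congr (_%:R); congr nat_of_bool.
by apply/idP/idP => [h|]; rewrite inE.
Qed.

Lemma measurable_g_choice {R : realType} (g : 'rV[R]_2 -> 'rV[R]_2 -> R) :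
  g = g1 \/ g = g2 \/ g = g3 ->
  measurable_fun setT (fun x : 'rV[R]_2 * 'rV[R]_2 => g x.1 x.2).
Proof.
have m1 (i : 'I_2) : measurable_fun setT (fun x : 'rV[R]_2 * 'rV[R]_2 => x.1 0 i).
  by apply: (measurableT_comp (measurable_mx_entry _ _)).
have m2 (i : 'I_2) : measurable_fun setT (fun x : 'rV[R]_2 * 'rV[R]_2 => x.2 0 i).
  by apply: (measurableT_comp (measurable_mx_entry _ _)).
case=> [->|[->|->]]; rewrite ?/g1 ?/g2 ?/g3.
- apply: measurable_funB => //; apply: measurable_funM => //.
  by apply: measurable_natr_bool; apply: measurable_and; exact: measurable_fun_ltr.
- apply: measurable_funB; apply: measurable_natr_bool; apply: measurable_fun_ltr => //;
    exact: measurable_concordance.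
- apply: measurable_funB => //; apply: measurable_funM => //.
  by apply: measurable_natr_bool; apply: measurable_and; exact: measurable_fun_ltr.
Qed.

(** * Continuity of the conditional tau and its distance from -1 and 1 *)

Section tau.
Context {R : realType} {p : nat}.
Notation L2 := (@lebesgue_rV R 2).
Notation Lp := (@lebesgue_rV R p).
Variables (f : 'rV[R]_2 * 'rV[R]_p -> R) (K : 'rV[R]_p -> R) (alpha : nat)
  (Z : set 'rV[R]_p).
Notation fZ := (marginal_density f).
Notation tau := (conditional_tau f).
Hypothesis mf : measurable_fun setT f.
Hypothesis f0 : forall x, 0 <= f x.
Hypothesis cZ : compact Z.
Hypothesis A2 : smooth_marginal alpha K Z f.
Hypothesis A3 : bounded_marginal Z f.
Hypothesis alpha_gt1 : (1 < alpha)%N.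
Hypothesis cf : forall z, Z z ->
  {ae L2, forall x, {for z, continuous (fun y => f (x, y))}}.

Let F (y : 'rV[R]_p) (x : 'rV[R]_2) := f (x, y).

Let mF y : measurable_fun setT (F y).
Proof. by apply: (measurableT_comp mf); exact: measurable_fun_pair. Qed.

Let iF z : Z z -> L2.-integrable setT (EFin \o F z).
Proof. exact: integrable_section. Qed.

Let fZ_gt0 z : Z z -> 0 < fZ z.
Proof.
have [fmin [fmax [fmin0 _ hf]]] := A3 => Zz.
by have /andP[h _] := hf z Zz; exact: lt_le_trans h.
Qed.

Lemma conditional_density_ge0 z x : 0 <= conditional_density f z x.
Proof. by rewrite divr_ge0//; exact: marginal_density_ge0. Qed.

Lemma measurable_conditional_density z :
  measurable_fun setT (conditional_density f z).
Proof. by apply: measurable_funM => //; exact: mF. Qed.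

Lemma integral_conditional_density z : Z z ->
  (\int[L2]_x (conditional_density f z x)%:E = 1)%E.
Proof.
move=> Zz.
under eq_integral do rewrite /conditional_density mulrC.
rewrite (integral_EFin_fine (integrable_EFinZl _ (iF Zz))) RintegralZl//; last exact: iF.
by rewrite mulVf// gt_eqF// fZ_gt0.
Qed.

Let pair_limit_conditional (G : 'rV[R]_2 * 'rV[R]_2 -> R) (CG : R) z :
  measurable_fun setT G -> (forall x, `|G x| <= CG) -> Z z ->
  pair_limit f G z = fZ z ^+ 2 * \int[(L2 \x L2)%E]_x
    (G x * (conditional_density f z x.1 * conditional_density f z x.2)).
Proof.
move=> mG GC Zz.
have iq : L2.-integrable setT (EFin \o conditional_density f z).
  rewrite (_ : conditional_density f z = fun x => (fZ z)^-1 * F z x).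
    exact: (integrable_EFinZl _ (iF Zz)).
  by apply/funext => x; rewrite /conditional_density mulrC.
rewrite -RintegralZl//; last exact: (integrable_tensor_mul mG GC iq iq).
apply: eq_Rintegral => x _; rewrite /conditional_density; field.
by rewrite gt_eqF// fZ_gt0.
Qed.

Lemma pair_limit_g (g : 'rV[R]_2 -> 'rV[R]_2 -> R) z :
  g = g1 \/ g = g2 \/ g = g3 -> Z z ->
  pair_limit f (fun x => g x.1 x.2) z = fZ z ^+ 2 * tau z.
Proof.
move=> hg Zz; rewrite (@pair_limit_conditional _ 3)//.
- congr (_ * _); apply: integral_g_choice => //.
  + exact: measurable_conditional_density.
  + exact: conditional_density_ge0.
  + exact: integral_conditional_density.
- exact: measurable_g_choice.
- by move=> x; exact: g_choice_le.
Qed.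

Lemma pair_limit_cst1 z : Z z -> pair_limit f (cst 1) z = fZ z ^+ 2.
Proof.
move=> Zz; rewrite (@pair_limit_conditional _ 1)//; last by move=> x; rewrite normr1.
rewrite -[RHS]mulr1; congr (_ * _).
under eq_Rintegral do rewrite mul1r.
apply: pair_probT => //.
- exact: measurable_conditional_density.
- exact: conditional_density_ge0.
- exact: integral_conditional_density.
Qed.

Lemma conditional_tau_lt1 z : Z z -> `|tau z| < 1.
Proof.
move=> Zz.
have mq := measurable_conditional_density z.
have q0 := conditional_density_ge0 z.
have q1 := integral_conditional_density Zz.
have := pair_prob_conc_disc mq q0 q1; have [] := pair_prob_conc_disc_gt0 mq q0 q1.
rewrite /conditional_tau /conditional_pair_prob -!/(pair_prob _ _).
set c := pair_prob _ _; set e := pair_prob _ _ => c0 e0 ce.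
by rewrite ltr_norml; apply/andP; split; lra.
Qed.

(** Continuity of the slices in L^1 passes to the bilinear integral by [tensor_difference], the L^1
    norms on [Z] being at most [fmax]. *)
Lemma pair_limit_continuous (G : 'rV[R]_2 * 'rV[R]_2 -> R) (CG : R) :
  measurable_fun setT G -> (forall x, `|G x| <= CG) ->
  {within Z, continuous (pair_limit f G)}.
Proof.
move=> mG GC; apply/subspace_continuousP => z Zz.
have [fmin [fmax [_ fmax0 hf]]] := A3.
have CG0 : 0 <= CG by rewrite (le_trans _ (GC (0, 0))).
apply/cvgrPdist_le => eps eps0.
pose e := eps / ((CG + 1) * (2 * fmax)).
have W0 : 0 < (CG + 1) * (2 * fmax) by rewrite mulr_gt0 ?mulr_gt0// ltr_wpDl.
have e0 : 0 < e by rewrite divr_gt0.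
have [delta delta0 hd] := l1_dist_unif mf f0 cZ A2 A3 alpha_gt1 cf e0.
rewrite near_withinE; near=> a => Za.
have az : `|a - z| < delta.
  by rewrite distrC; near: a; apply: cvgr_dist_lt.
have le := tensor_difference mG GC (iF Za) (iF Zz).
rewrite distrC (le_trans le)//.
have norm1 y : Z y -> \int[L2]_x `|F y x| <= fmax.
  move=> Zy; have -> : \int[L2]_x `|F y x| = fZ y.
    by apply: eq_Rintegral => x _; exact/ger0_norm/f0.
  by have /andP[] := hf y Zy.
have l1 : \int[L2]_x `|F a x - F z x| <= e.
  rewrite -lee_fin -integral_EFin_fine.
    by apply/ltW; exact: hd.
  exact: integrable_norm (integrable_EFinB (iF Za) (iF Zz)).
have -> : eps = (CG + 1) * (e * (fmax + fmax)).
  by rewrite /e; field; rewrite !gt_eqF ?ltr_wpDl.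
apply: ler_pM => //.
- by apply: mulr_ge0; [|apply: addr_ge0]; exact: Rintegral_ge0.
- by rewrite lerDl.
- apply: ler_pM => //; [exact: Rintegral_ge0|apply: addr_ge0; exact: Rintegral_ge0|].
  by apply: lerD; exact: norm1.
Unshelve. all: end_near. Qed.

Lemma conditional_tau_bound : exists2 rho : R, 0 < rho &
  forall z, Z z -> `|tau z| <= 1 - rho.
Proof.
have [Z0|/set0P[z0 Zz0]] := eqVneq Z set0.
  by exists 1 => // z; rewrite Z0.
have ctau : {within Z, continuous (fun z => `|tau z|)}.
  apply/subspace_continuousP => z Zz; apply: cvg_norm.
  have c1 : {within Z, continuous (pair_limit f (fun x => g1 x.1 x.2))}.
    apply: (@pair_limit_continuous _ 3); first by apply: measurable_g_choice; left.
    by move=> x; apply: g_choice_le; left.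
  have c2 : {within Z, continuous (pair_limit f (cst 1))}.
    by apply: (@pair_limit_continuous _ 1) => // x; rewrite normr1.
  move/subspace_continuousP : c1 => /(_ z Zz) c1.
  move/subspace_continuousP : c2 => /(_ z Zz) c2.
  have tE y : Z y -> tau y = pair_limit f (fun x => g1 x.1 x.2) y / pair_limit f (cst 1) y.
    move=> Zy; rewrite pair_limit_g//; last by left.
    by rewrite pair_limit_cst1// mulrAC divff ?mul1r// sqrf_eq0 gt_eqF// fZ_gt0.
  rewrite tE//; apply: cvg_trans (cvgM c1 (cvgV _ c2)); last first.
    by rewrite /from_subspace pair_limit_cst1// sqrf_eq0 gt_eqF// fZ_gt0.
  apply: near_eq_cvg; rewrite near_withinE; near=> y => Zy.
  by rewrite /= tE.
have [|c /set_mem Zc cmax] := compact_EVT_max _ cZ ctau; first by exists z0.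
exists (1 - `|tau c|); first by rewrite subr_gt0 conditional_tau_lt1.
by move=> z Zz; rewrite subKr; apply: cmax; rewrite inE.
Unshelve. all: end_near. Qed.

End tau.

(** * Deviation of the responses *)

(** Near [x] the difference quotient along [A] is within 1 of [F' x]; endpoints of a segment are
    thereby included. *)
Lemma C1_within_locally_lipschitz {R : realType} (A : set R) (F F' : R -> R) x :
  C1_within A F F' -> A x ->
  exists2 delta : R, 0 < delta & forall y, A y -> `|y - x| < delta ->
    `|F y - F x| <= (`|F' x| + 1) * `|y - x|.
Proof.
move=> [dF _] Ax; have /cvgrPdist_lt/(_ 1 ltr01) := dF x Ax.
rewrite near_withinE near_withinE => /nbhs_ballP[delta /= delta0 hd].
exists delta => // y Ay yx; have [->|yx'] := eqVneq y x.
  by rewrite subrr normr0 mulr_ge0// addr_ge0.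
have yx0 : y - x != 0 by rewrite subr_eq0.
have bxy : ball x delta y by rewrite -ball_normE /= distrC.
have := hd y bxy yx' Ay; rewrite distrC => h.
rewrite -[F y - F x](divfK yx0) normrM ler_wpM2r//.
rewrite -[X in `|X|](subrK (F' x)) (le_trans (ler_normD _ _))// addrC lerD2l ltW//.
Qed.

Lemma C1_within_unif_continuous {R : realType} (A : set R) (F F' : R -> R) eps :
  compact A -> C1_within A F F' -> 0 < eps ->
  exists2 delta : R, 0 < delta & forall x y, A x -> A y -> `|y - x| < delta ->
    `|F y - F x| <= eps.
Proof.
move=> cA C1 eps0.
have : \forall d \near (0 : R)^'+, A `<=`
    (fun x => A x -> forall y, A y -> `|y - x| < d -> `|F y - F x| <= eps).
  apply: ((compact_near_coveringP _).1 cA _ _ (fun d x => A x -> forall y, A y ->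
    `|y - x| < d -> `|F y - F x| <= eps)) => x0 Ax0.
  have [d0 d00 hd] := C1_within_locally_lipschitz C1 Ax0.
  pose L := `|F' x0| + 1.
  have L0 : 0 < L by rewrite ltr_wpDl.
  pose d1 := Num.min d0 (eps / (2 * L)).
  have d10 : 0 < d1 by rewrite lt_min d00 divr_gt0// mulr_gt0.
  have close y : A y -> `|y - x0| < d1 -> `|F y - F x0| <= eps / 2.
    move=> Ay; rewrite lt_min => /andP[y1 y2]; rewrite (le_trans (hd y Ay y1))//.
    rewrite -/L (le_trans (ler_wpM2l (ltW L0) (ltW y2)))// le_eqVlt; apply/orP; left.
    by apply/eqP; field; rewrite gt_eqF.
  near=> x e => /= Ax y Ay xy.
  have xx0 : `|x - x0| < d1 / 2.
    near: x; apply: (filterS _ (nbhsx_ballx x0 (d1 / 2) _)); last by rewrite divr_gt0.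
    by move=> x; rewrite -ball_normE /= distrC.
  have ed1 : e < d1 / 2 by near: e; apply: nbhs_right_lt; rewrite divr_gt0.
  rewrite (le_trans (ler_distD (F x0) _ _))// [eps]splitr.
  apply: lerD; last rewrite distrC; apply: close => //.
    by rewrite (le_lt_trans (ler_distD x _ _))// [d1]splitr ltrD// (lt_trans xy).
move=> [e /= e0 He]; exists (e / 2); first by rewrite divr_gt0.
move=> x y Ax Ay xy; apply: (He (e / 2)) => //=; last by rewrite divr_gt0.
by rewrite sub0r normrN gtr0_norm ?divr_gt0// ltr_pdivrMr// ltr_pMr// ltr1n.
Unshelve. all: by end_near. Qed.

(** [a - b t = (a - b0 t) - (b - b0) t] is at most [2 e] in absolute value, while [b >= m / 2]. *)
Lemma ratio_close {R : realFieldType} (a b b0 m t e : R) :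
  0 < m -> m <= b0 -> `|t| <= 1 -> `|a - b0 * t| <= e -> `|b - b0| <= e ->
  2 * e <= m -> `|a / b - t| <= 4 * e / m.
Proof.
move=> m0 mb0 t1 ae be em.
have bm : m / 2 <= b.
  by move: be; rewrite ler_norml => /andP[h _]; lra.
have b0' : 0 < b by apply: lt_le_trans bm; rewrite divr_gt0.
have -> : a / b - t = (a - b * t) / b by field; rewrite gt_eqF.
rewrite normrM normfV (gtr0_norm b0') ler_pdivrMr//.
have n1 : `|a - b * t| <= 2 * e.
  rewrite (le_trans (ler_distD (b0 * t) _ _))// mulr_natl mulr2n lerD//.
  rewrite -mulrBl normrM distrC -[leRHS]mulr1 ler_pM//.
rewrite (le_trans n1)//.
have e0 : 0 <= e by rewrite (le_trans _ be).
have -> : 4 * e / m * b = 2 * e * (b / (m / 2)) by field; rewrite gt_eqF.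
by rewrite ler_peMr ?mulr_ge0// ler_pdivlMr ?divr_gt0// mul1r.
Qed.

Section tau_hat.
Context {R : realType} {p : nat}.
Variables (g : 'rV[R]_2 -> 'rV[R]_2 -> R) (K : 'rV[R]_p -> R).
Context {d : measure_display} {Omega : measurableType d}.
Variable Y : nat -> Omega -> 'rV[R]_2 * 'rV[R]_p.

(** The double sum includes the diagonal, and [n^-2] cancels. The identity survives a vanishing
    kernel sum [S], since division by 0 gives 0 on both sides. *)
Lemma tau_hat_vstat h n z w : (0 < n)%N ->
  tau_hat g K h n (fun i => Y i w) z =
  vstat Y (pair_kernel K (fun x => g x.1 x.2) h z) n w /
  vstat Y (pair_kernel K (cst 1) h z) n w.
Proof.
move=> n0; pose k i := scaled_kernel K h ((Y i w).2 - z).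
pose S := \sum_(j < n) k j.
have V1 : vstat Y (pair_kernel K (cst 1) h z) n w = n%:R ^- 2 * S ^+ 2.
  rewrite /vstat (expr2 S) {1}/S mulr_suml; congr (_ * _); apply: eq_bigr => i _.
  by rewrite mulr_sumr; apply: eq_bigr => j _; rewrite /pair_kernel /= mulr1.
rewrite V1 {1}/vstat -mulf_div divff ?mul1r; last by rewrite invr_eq0 expf_neq0// pnatr_eq0 -lt0n.
rewrite /tau_hat /= mulr_suml; apply: eq_bigr => i _.
rewrite mulr_suml; apply: eq_bigr => j _; rewrite /kernel_weight -/S /pair_kernel /=.
by rewrite -/(k i) -/(k j) (expr2 S) invfM; ring.
Qed.

End tau_hat.

Section response.
Context {R : realType} {p : nat}.
Notation L2 := (@lebesgue_rV R 2).
Notation Lp := (@lebesgue_rV R p).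
Variables (f : 'rV[R]_2 * 'rV[R]_p -> R) (K : 'rV[R]_p -> R) (alpha : nat)
  (Z : set 'rV[R]_p).
Notation fZ := (marginal_density f).
Notation tau := (conditional_tau f).
Hypothesis p_gt0 : (0 < p)%N.
Hypothesis mf : measurable_fun setT f.
Hypothesis f0 : forall x, 0 <= f x.
Hypothesis f1 : (\int[L2 \x Lp]_x (f x)%:E = 1)%E.
Hypothesis cZ : compact Z.
Hypothesis A1 : kernel_of_order alpha K.
Hypothesis A2 : smooth_marginal alpha K Z f.
Hypothesis A3 : bounded_marginal Z f.
Hypothesis A4 : smooth_joint alpha K Z f.
Hypothesis alpha_gt1 : (1 < alpha)%N.
Context {d : measure_display} {Omega : measurableType d}.
Variable P : probability Omega R.
Variables (Y : nat -> Omega -> 'rV[R]_2 * 'rV[R]_p)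
  (nu : probability ('rV[R]_2 * 'rV[R]_p)%type R).
Hypothesis mY : forall i, measurable_fun setT (Y i).
Hypothesis Y_indep : mutually_independent P Y.
Hypothesis Y_law : forall i A, measurable A -> P (Y i @^-1` A) = nu A.
Hypothesis nuE : forall A, measurable A ->
  nu A = (\int[(L2 \x Lp)%E]_(x in A) (f x)%:E)%E.
Variables (Lambda Lambda' : R -> R).
Hypothesis Lambda_C1 : C1_within `[-1, 1]%classic Lambda Lambda'.
Variable g : 'rV[R]_2 -> 'rV[R]_2 -> R.
Hypothesis g_choice : g = g1 \/ g = g2 \/ g = g3.

Let cf z : Z z -> {ae L2, forall x, {for z, continuous (fun y => f (x, y))}}.
Proof.
have [_ _ iK K1 _] := A1; apply: (joint_continuous p_gt0 _ iK K1 A4).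
exact: ltnW.
Qed.

(** The bad event is given as a measurable superset: [Lambda] is arbitrary outside [-1, 1], so the
    response itself need not be measurable. It is the union of the deviations of numerator and
    denominator, whence the factor 4. *)
Lemma response_deviation (eta : R) : 0 < eta ->
  exists A c delta : R, [/\ 0 < A, 0 < delta & forall n h z, 0 < h < delta ->
    Z z -> c <= n%:R * h ^+ (2 * p) ->
    exists E : set Omega, [/\ measurable E,
      (P E <= (4 * expR (- (A * n%:R * h ^+ (2 * p))))%:E)%E &
      forall w, ~ E w ->
        `|Lambda (tau_hat g K h n (fun i => Y i w) z) - Lambda (tau z)| <= eta]].
Proof.
move=> eta0.
have [fmin [fmax [fmin0 _ hf]]] := A3.
have [rho rho0 hrho] := conditional_tau_bound mf f0 cZ A2 A3 alpha_gt1 cf.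
have [dL dL0 hL] := C1_within_unif_continuous (@segment_compact _ (-1) 1) Lambda_C1 eta0.
pose m := fmin ^+ 2.
have m0 : 0 < m by rewrite exprn_gt0.
(* [dL / 2] serves the uniform continuity of [Lambda], and [rho] keeps the estimate in [-1, 1]. The
   level [e] below is what [ratio_close] needs: [2 e <= m] and [4 e / m <= r]. *)
pose r := Num.min (dL / 2) rho.
have r0 : 0 < r by rewrite lt_min rho0 divr_gt0.
pose e := Num.min (m / 2) (m * r / 4).
have e0 : 0 < e by rewrite lt_min !divr_gt0// mulr_gt0.
have mg := measurable_g_choice g_choice.
have gC (x : 'rV[R]_2 * 'rV[R]_2) : `|g x.1 x.2| <= 3 by exact: g_choice_le.
have mone : measurable_fun setT (cst 1 : 'rV[R]_2 * 'rV[R]_2 -> R) by exact: measurable_cst.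
have oneC (x : 'rV[R]_2 * 'rV[R]_2) : `|(cst 1 : _ -> R) x| <= 1 by rewrite normr1.
have dev := kernel_vstat_deviation mf f0 f1 cZ A1 A2 A3 alpha_gt1 cf mY Y_indep Y_law nuE.
have [Ag [cg [dg [Ag0 dg0 hg]]]] := dev _ _ _ mg gC e0.
have [Ao [co [do_ [Ao0 do0 ho]]]] := dev _ _ _ mone oneC e0.
(* The entry 1 in [c] excludes [n = 0]. *)
pose A := Num.min Ag Ao; pose c := Num.max 1 (Num.max cg co).
exists A, c, (Num.min dg do_); split; [by rewrite lt_min Ag0|by rewrite lt_min dg0|].
move=> n h z /andP[h0]; rewrite lt_min => /andP[hdg hdo] Zz.
rewrite !ge_max => /and3P[n1 cgn con].
have hp0 : 0 <= h ^+ (2 * p) by rewrite exprn_ge0// ltW.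
have n0 : (0 < n)%N.
  by rewrite lt0n; apply/eqP => n0; move: n1; rewrite n0 mul0r ler10.
have hhg : 0 < h < dg by rewrite h0.
have hho : 0 < h < do_ by rewrite h0.
have := ho n h z hho Zz con; have := hg n h z hhg Zz cgn.
set Eg := [set w | _]; set Eo := [set w | _] => PEg PEo.
have mE (G : 'rV[R]_2 * 'rV[R]_2 -> R) : measurable_fun setT G ->
    measurable [set w | e <= `|vstat Y (pair_kernel K G h z) n w - pair_limit f G z|].
  move=> mG; pose V w := `|vstat Y (pair_kernel K G h z) n w - pair_limit f G z|.
  have mV : measurable_fun setT V.
    apply: measurableT_comp => //; apply: measurable_funB => //.
    by apply: measurable_vstat => //; exact: (measurable_pair_kernel A1).
  rewrite (_ : [set _ | _] = V @^-1` `[e, +oo[).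
    by rewrite -[X in measurable X]setTI; exact: mV.
  by apply/seteqP; split => w; rewrite /= in_itv /= andbT.
have mEg : measurable Eg by exact: mE.
have mEo : measurable Eo by exact: mE.
exists (Eg `|` Eo); split; first exact: measurableU.
  rewrite (le_trans (measureU2 P mEg mEo))//.
  have -> : (4 * expR (- (A * n%:R * h ^+ (2 * p))))%:E =
     ((2 * expR (- (A * n%:R * h ^+ (2 * p))))%:E +
      (2 * expR (- (A * n%:R * h ^+ (2 * p))))%:E)%E.
    by rewrite -EFinD; congr _%:E; ring.
  apply: leeD; [apply: (le_trans PEg)|apply: (le_trans PEo)];
    rewrite lee_fin ler_pM2l// ler_expR lerN2 -!mulrA ler_wpM2r ?mulr_ge0//;
    by rewrite ge_min lexx ?orbT.
move=> w /not_orP[/= /negP + /negP]; rewrite -!ltNge.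
rewrite (pair_limit_g mf f0 A3 g_choice Zz) (pair_limit_cst1 mf f0 A3 Zz).
rewrite tau_hat_vstat//; set a := vstat _ _ _ _; set b := vstat _ _ _ _ => ag bo.
have mz : m <= fZ z ^+ 2.
  have /andP[h1 _] := hf z Zz; rewrite lerXn2r// nnegrE ?(ltW fmin0)//.
  exact: le_trans (ltW fmin0) h1.
have t1 : `|tau z| <= 1 by rewrite ltW//; exact: (conditional_tau_lt1 mf f0 A3).
have em : 2 * e <= m.
  by rewrite mulrC -ler_pdivlMr// ge_min lexx.
have ab := ratio_close m0 mz t1 (ltW ag) (ltW bo) em.
have er : 4 * e / m <= r.
  rewrite ler_pdivrMr// mulrC -ler_pdivlMr// [r * m]mulrC ge_min lexx orbT //.
have abr := le_trans ab er.
have := hrho z Zz => tr.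
have rr : r <= rho by rewrite ge_min lexx orbT.
have rd : r <= dL / 2 by rewrite ge_min lexx.
apply: hL.
- by rewrite /= in_itv /= -ler_norml.
- rewrite /= in_itv /= -ler_norml -[a / b](subrK (tau z)).
  rewrite (le_trans (ler_normD _ _))// -[1](subrKC rho) lerD//.
  exact: le_trans abr rr.
- by rewrite (le_lt_trans abr)// (le_lt_trans rd)// ltr_pdivrMr// ltr_pMr// ltr1n.
Qed.

End response.

(** * Consistency *)

(** The norm is the largest absolute entry, or 0 if there is none; for [eps > 0] the event is thus a
    finite union over entries. *)
Lemma measurable_mx_dist_ge {R : realType} {d : measure_display}
    {Omega : measurableType d} {m n} (b : Omega -> 'M[R]_(m, n)) (l : 'M[R]_(m, n)) (eps : R) :
  0 < eps -> measurable_fun setT b -> measurable [set w | eps <= `|b w - l|].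
Proof.
move=> eps0 mb.
have -> : [set w | eps <= `|b w - l|] =
    \bigcup_(ij in [set: 'I_m * 'I_n]) [set w | eps <= `|b w ij.1 ij.2 - l ij.1 ij.2|].
  apply/seteqP; split => w /=; last first.
    move=> [ij _ h]; rewrite (le_trans h)//.
    by have := normr_entry_le (b w - l) ij.1 ij.2; rewrite !mxE.
  move=> h; apply: contrapT => nh; move: h; apply/negP; rewrite -ltNge.
  rewrite [ltLHS]mx_normrE; apply: bigmax_lt => // ij _; rewrite ltNge; apply/negP => h.
  by apply: nh; exists ij => //; move: h; rewrite !mxE.
apply: fin_bigcup_measurable => // -[i j] _ /=.
have mV : measurable_fun setT (fun w => `|b w i j - l i j|).
  apply: measurableT_comp => //; apply: measurable_funB => //.
  by apply: (measurableT_comp (measurable_mx_entry i j)).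
rewrite (_ : [set _ | _] = (fun w => `|b w i j - l i j|) @^-1` `[eps, +oo[).
  by rewrite -[X in measurable X]setTI; exact: mV.
by apply/seteqP; split => w; rewrite /= in_itv /= andbT.
Qed.

Section gram_limit.
Context {R : realType} {p p' : nat}.
Variables (psi : 'rV[R]_p -> 'cV[R]_p') (zs : nat -> 'rV[R]_p).
Variables (m_ : nat -> nat) (M : 'M[R]_p').
Hypothesis gramM : gram psi (m_ n) zs @[n --> \oo] --> M.

Lemma gram_limit_sym : M^T = M.
Proof.
have gramS m i j : gram psi m zs i j = gram psi m zs j i.
  rewrite /gram !mxE !summxE; congr (_ * _); apply: eq_bigr => k _.
  by rewrite !mxE; apply: eq_bigr => l _; rewrite !mxE mulrC.
apply/matrixP => i j; rewrite mxE.
have c i' j' : gram psi (m_ n) zs i' j' @[n --> \oo] --> M i' j'.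
  exact: (cvg_comp _ _ gramM (@coord_continuous _ _ _ i' j' M)).
have cS : gram psi (m_ n) zs j i @[n --> \oo] --> M i j.
  have -> : (fun n => gram psi (m_ n) zs j i) = (fun n => gram psi (m_ n) zs i j).
    by apply/funext => n; exact: gramS.
  exact: c.
by have := cvg_unique _ (c j i) cS; exact.
Qed.

Lemma gram_limit_psd v : 0 <= dotc v (M *m v).
Proof.
rewrite leNgt; apply/negP; set x := dotc _ _ => x0.
pose c := p'%:R * (`|v| * (p'%:R * `|v|)).
have c0 : 0 <= c by rewrite !mulr_ge0.
(* A Gram matrix within this distance of [M] has a form at [v] that differs from [x] by less than
   [- x], hence is still negative. *)
have e0 : 0 < - x / (c + 1) by rewrite divr_gt0 ?oppr_gt0// ltr_wpDl.
have /cvgrPdist_lt/(_ _ e0)[N _ /(_ N (leqnn N)) /= hN] := gramM.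
set G := gram _ _ _ in hN.
have g0 : 0 <= dotc v (G *m v).
  by rewrite dotc_gram mulr_ge0 ?invr_ge0// sumr_ge0// => i _; exact: sqr_ge0.
have : dotc v (G *m v) - x <= c * `|M - G|.
  rewrite -dotcBr -mulmxBl (le_trans (ler_norm _))// (le_trans (dotc_le _ _))//.
  rewrite /c -mulrA ler_wpM2l// -mulrA ler_wpM2l//.
  by rewrite (le_trans (mulmx_normr_le _ _))// distrC mulrA mulrAC.
have : c * `|M - G| <= - x * (c / (c + 1)).
  have -> : - x * (c / (c + 1)) = c * (- x / (c + 1)) by ring.
  by rewrite ler_wpM2l// ltW.
have : - x * (c / (c + 1)) < - x.
  by rewrite gtr_pMr ?oppr_gt0// ltr_pdivrMr ?ltr_wpDl// mul1r ltrDl.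
lra.
Qed.

End gram_limit.

Theorem theorem13 (R : realType) (p p' : nat) (p_gt0 : (0 < p)%N)
  (p'_gt0 : (0 < p')%N)
  (d : measure_display) (Omega : measurableType d) (P : probability Omega R)
  (* the i.i.d. sample and its joint density *)
  (XZ : nat -> {RV P >-> ('rV[R]_2 * 'rV[R]_p)%type})
  (f : 'rV[R]_2 * 'rV[R]_p -> R)
  (XZ_indep : mutually_independent P (fun i => XZ i : Omega -> _))
  (XZ_density : forall i,
     has_density P (lebesgue_rV 2 \x lebesgue_rV p)%E (XZ i) f)
  (Zset : set 'rV[R]_p) (Zset_compact : compact Zset)
  (* kernel and smoothness assumptions *)
  (K : 'rV[R]_p -> R) (alpha : nat) (alpha_gt1 : (1 < alpha)%N)
  (A1 : kernel_of_order alpha K)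
  (A2 : smooth_marginal alpha K Zset f)
  (A3 : bounded_marginal Zset f)
  (A4 : smooth_joint alpha K Zset f)
  (* model *)
  (Lambda Lambda' : R -> R)
  (Lambda_incr : {in `[-1, 1] &, {homo Lambda : x y / x <= y}})
  (Lambda_C1 : C1_within `[-1, 1] Lambda Lambda')
  (psi : 'rV[R]_p -> 'cV[R]_p') (bstar : 'cV[R]_p')
  (model : forall z, Zset z ->
     Lambda (conditional_tau f z) = dotc (psi z) bstar)
  (B_psi : bounded_design Zset psi)
  (B_Lambda : link_derivative_bounded Zset f Lambda')
  (* design points, bandwidth, regularization *)
  (n' : nat -> nat) (n'_infty : n' n @[n --> \oo] --> \oo)
  (zs : nat -> 'rV[R]_p) (zs_in : forall i, Zset (zs i))
  (M : 'M[R]_p')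
  (M_lim : (n' n)%:R^-1 *: (\sum_(i < n' n) psi (zs i) *m (psi (zs i))^T)
             @[n --> \oo] --> M)
  (h : nat -> R) (h_gt0 : forall n, 0 < h n)
  (h_lim : h n @[n --> \oo] --> (0 : R))
  (lambda : nat -> R) (lambda_ge0 : forall n, 0 <= lambda n)
  (lambda0 : R) (lambda_lim : lambda n @[n --> \oo] --> lambda0)
  (rate : forall A : R, 0 < A ->
     (n' n)%:R * expR (- (A * n%:R * h n ^+ (2 * p))) @[n --> \oo] --> (0 : R))
  (* estimator *)
  (g : 'rV[R]_2 -> 'rV[R]_2 -> R) (g_choice : g = g1 \/ g = g2 \/ g = g3)
  (bhat : nat -> {RV P >-> 'cV[R]_p'})
  (bhat_min : forall n w,
     is_minimizer
       (lasso_criterion psi (n' n) zs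
          (fun i => Lambda (tau_hat g K (h n) n (fun j => XZ j w) (zs i)))
          (lambda n))
       (bhat n w)) :
  (forall binf : 'cV[R]_p',
     is_unique_minimizer (limit_criterion M lambda0 bstar) binf ->
     cvg_in_probability P (fun n => bhat n : Omega -> _) binf) /\
  (lambda0 = 0 -> M \in unitmx ->
     cvg_in_probability P (fun n => bhat n : Omega -> _) bstar).

Proof.
have [mf f0 fE] := XZ_density 0%N.
pose nu := distribution P (XZ 0%N).
have nuE A : measurable A ->
    nu A = (\int[(lebesgue_rV 2 \x lebesgue_rV p)%E]_(x in A) (f x)%:E)%E.
  by move=> mA; exact: fE.
have XZ_law i A : measurable A -> P (XZ i @^-1` A) = nu A.
  by move=> mA; rewrite nuE//; have [_ _ ->] := XZ_density i.
have f1 : (\int[(lebesgue_rV 2 \x lebesgue_rV p)%E]_x (f x)%:E = 1)%E.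
  by rewrite -nuE// /nu probability_setT.
have mXZ i : measurable_fun setT (XZ i) by [].
have [C psiC] : exists C, forall z, Zset z -> `|psi z| <= C.
  have [C hC] := B_psi; exists `|C| => z Zz; apply: mx_normr_le => // i j.
  by rewrite (ord1 j) (le_trans (hC z i Zz))// ler_norm.
have consistent binf : is_unique_minimizer (limit_criterion M lambda0 bstar) binf ->
    cvg_in_probability P (fun n => bhat n : Omega -> _) binf.
  move=> ubinf eps eps0.
  have [eta eta0 lasso] := lasso_argmin_close psi C eps0 ubinf.
  have [A [c [delta [A0 delta0 dev]]]] := response_deviation p_gt0 mf f0 f1
    Zset_compact A1 A2 A3 A4 alpha_gt1 mXZ XZ_indep XZ_law nuE Lambda_C1 g_choice eta0.
  pose B n := (n' n)%:R * expR (- (A * n%:R * h n ^+ (2 * p))).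
  have B0 : (4 * B n)%:E @[n --> \oo] --> 0%E.
    apply: cvg_EFin; first exact: nearW.
    rewrite -[X in _ --> X](mulr0 4); apply: cvgMl_tmp; exact: rate.
  apply: (squeeze_cvge _ (cvg_cst _) B0); near=> n.
  rewrite measure_ge0 /=.
  have n'0 : (0 < n' n)%N.
    by near: n; move/cvgnyPgt : n'_infty; apply.
  have gM : `|gram psi (n' n) zs - M| <= eta.
    by rewrite distrC; near: n; move/cvgrPdist_le : M_lim; apply.
  have lM : `|lambda n - lambda0| <= eta.
    by rewrite distrC; near: n; move/cvgrPdist_le : lambda_lim; apply.
  have hd : 0 < h n < delta.
    rewrite h_gt0 /=; have : `|0 - h n| < delta.
      by near: n; move/cvgrPdist_lt : h_lim; apply.
    by rewrite sub0r normrN gtr0_norm.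
  (* The rate with [A = 1] makes [n'] times the exponential smaller than [expR (- c)]; as [n' >= 1],
     so is the exponential alone. *)
  have nh : c <= n%:R * h n ^+ (2 * p).
    have : `|0 - (n' n)%:R * expR (- (1 * n%:R * h n ^+ (2 * p)))| < expR (- c).
      near: n; move/cvgrPdist_lt : (rate 1 ltr01); apply; exact: expR_gt0.
    rewrite sub0r normrN ger0_norm ?mulr_ge0// ?expR_ge0// mul1r => h1.
    have : expR (- (n%:R * h n ^+ (2 * p))) < expR (- c).
      apply: le_lt_trans h1; rewrite ler_peMl ?expR_ge0// ler1n //.
    by rewrite ltr_expR ltrN2 => /ltW.
  have /choice[E hE] i := dev n (h n) (zs i) hd (zs_in i) nh.
  have mE i : measurable (E i) by have [] := hE i.
  (* Off the union of the bad events of the first [n'] design points all residuals are at most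
     [eta], and the deterministic lemma localizes the minimizer. *)
  apply: (@le_trans _ _ (P (\big[setU/set0]_(i < n' n) E i))).
    rewrite le_measure ?inE//.
    - exact: measurable_mx_dist_ge.
    - exact: bigsetU_measurable.
    move=> w /= far; apply: contrapT => nE; move: far; apply/negP; rewrite -ltNge.
    apply: (lasso (n' n) zs (fun i => Lambda
      (tau_hat g K (h n) n (fun j => XZ j w) (zs i))) (lambda n)) => //.
    - by move=> i; exact: psiC.
    - move=> i im; rewrite -model//; have [_ _] := hE i; apply => Ei.
      by apply: nE; rewrite -bigcup_mkord; exists i.
  apply: (le_trans (Boole_inequality P _)) => //.
  apply: (@le_trans _ _ (\sum_(i < n' n) (4 * expR (- (A * n%:R * h n ^+ (2 * p))))%:E)%E).
    by apply: lee_sum => i _; have [] := hE i.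
  rewrite sumEFin lee_fin sumr_const card_ord -[leLHS]mulr_natl /B.
  by rewrite [leRHS]mulrCA.
split => // lambda00 uM; apply: consistent; rewrite lambda00.
apply: gram_limit_unique_minimizer => //.
- exact: (@gram_limit_sym _ _ _ psi zs n' M M_lim).
- exact: (@gram_limit_psd _ _ _ psi zs n' M M_lim).
Unshelve. all: end_near. Qed.
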